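(* Let $q$ be a nonzero complex number with $|q|<1$, let $m$ be a nonnegative integer, and let $a,b,c,d,e,f$ be complex parameters such that all expressions below are well defined (no division by zero occurs). If $|bd/a|<1$ and $|a^2q^2/bcdef|<1$, then $$ \sum_{k=-m}^{\infty}\frac{(q^{m-k+1}/a,\,fq^m;q)_{k}}{(q^{m-k}f/a,\,q^{1+m};q)_k}\cdot \frac{(qa^{1/2},-qa^{1/2},b,c,d,e;q)_k}{(a^{1/2},-a^{1/2},aq/b,aq/c,aq/d,aq/e;q)_k} \left(\frac{qa^2}{bcde}\right)^k = T_1+T_2, $$ where $$ \begin{aligned} T_1={}&\frac{1-efq^{2m}/c}{1-efq^m/c}\cdot\frac{(q/a,\,df/a,\,ef/a,\,aq/bc,\,aq/cd,\,efq^m/a;q)_m} {(f/a,\,q/b,\,q/c,\,q/d,\,def/a,\,fq^{1+m}/c;q)_m}\\ &\times\frac{(aq,\,aq/de,\,aq/df,\,aq/ef,\,eq^{1+m}/c,\,fq^{1+m}/c,\,b/a,\,befq^m/a;q)_{\infty}} {(aq/d,\,aq/e,\,aq/f,\,aq/def,\,q^{1+m}/c,\,efq^{1+m}/c,\,be/a,\,bfq^m/a;q)_{\infty}}\\ &\times\sum_{k=-m}^{\infty}\frac{(efq^m/c,\,q^{1+m}(ef/c)^{1/2},\,-q^{1+m}(ef/c)^{1/2},\,aq^{1+m}/bc;q)_k} {(q^{1+m},\,q^{m}(ef/c)^{1/2},\,-q^{m}(ef/c)^{1/2},\,befq^m/a;q)_k}\\ &\qquad\cdot\frac{(aq^{1+m}/cd,\,efq^{2m}/a,\,e,\,fq^m;q)_k}{(defq^m/a,\,aq/c,\,fq^{1+2m}/c,\,eq^{1+m}/c;q)_k}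 \left(\frac{bd}{a}\right)^k \end{aligned} $$ and $$ \begin{aligned} T_2={}&\frac{b}{a}\cdot\frac{1-b^2q^{2m}/a}{1-b^2q^m/a}\left(\frac{a^2q}{bcde}\right)^m \frac{(q/a,\,bc/a;q)_{m}}{(f/a;q)_m}\cdot\frac{(aq,\,bq^{1+2m}/a,\,bq^{1+m}/c;q)_\infty} {(aq/b,\,aq/c,\,aq/d;q)_\infty}\\ &\times \frac{(bq^{1+m}/d,\,bq^{1+m}/e,\,bq/f,\,d,\,e,\,fq^m,\,aq/bc,\,bdef/a^2,\,a^2q/bdef;q)_{\infty}} {(aq/e,\,aq/f,\,bdq^m/a,\,beq^m/a,\,bfq^{2m}/a,\,def/a,\,aq/def,\,q/c,\,b^2q^{1+m}/a;q)_{\infty}}\\ &\times \sum_{k=-m}^{\infty}\frac{(b^2q^m/a,\,q^{1+m}ba^{-1/2},\,-q^{1+m}ba^{-1/2};q)_k} {(q^{1+m},\,q^{m}ba^{-1/2},\,-q^mba^{-1/2};q)_k}\\ &\qquad\cdot\frac{(b,\,bcq^m/a,\,bdq^m/a,\,beq^m/a,\,bfq^{2m}/a;q)_k}{(bq^{1+2m}/a,\,bq^{1+m}/c,\,bq^{1+m}/d,\,bq^{1+m}/e,\,bq/f;q)_k} \left(\frac{a^2q^2}{bcdef}\right)^k. \end{aligned} $$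
   Context: For $|q|<1$, $(x;q)_\infty=\prod_{i\ge 0}(1-xq^i)$, and for any integer $n$, $(x;q)_n=(x;q)_\infty/(xq^n;q)_\infty$. Thus for $n\ge 0$, $(x;q)_n=\prod_{i=0}^{n-1}(1-xq^i)$ and $(x;q)_{-n}=\dfrac{1}{(xq^{-n};q)_n}=\dfrac{(-q/x)^n q^{\binom n2}}{(q/x;q)_n}$. Multi-parameter notation: $(x_1,\ldots,x_r;q)_n=(x_1;q)_n\cdots(x_r;q)_n$ for $n$ an integer or $\infty$. In every inline fraction, everything written after the slash is in the denominator, e.g. $aq/def=aq/(def)$, $aq/bc=aq/(bc)$, $a^2q/bdef=a^2q/(bdef)$, $a^2q^2/bcdef=a^2q^2/(bcdef)$. The symbols $a^{1/2}$ and $(ef/c)^{1/2}$ denote fixed choices of square roots, and $a^{-1/2}=1/a^{1/2}$ (the expressions depend only on the pairs $\pm a^{1/2}$, $\pm (ef/c)^{1/2}$). *)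

(* Defs.v *)
From mathcomp Require Export all_boot all_order all_algebra.
From mathcomp Require Export complex.
From mathcomp Require Export boolp classical_sets reals topology normedtype sequences.
Set Implicit Arguments.
Unset Strict Implicit.
Unset Printing Implicit Defensive.
Import Order.TTheory GRing.Theory Num.Theory.
Import numFieldNormedType.Exports.
Local Open Scope classical_set_scope.
Local Open Scope ring_scope.

Definition qprod (C : numClosedFieldType) (q x : C) (n : nat) : C :=
  \prod_(i < n) (1 - x * q ^+ i).

Definition qpoch_inf (C : numClosedFieldType) (q x : C) : C :=
  limn (qprod q x).

(* (x; q)_n for an integer n. For n < 0 it is 1 / (x q^n; q)_{-n}. The products
   are used rather than (x; q)_oo / (x q^n; q)_oo, which is 0 / 0 at some points
   where the products make sense; see qpochE. *)
Definition qpoch (C : numClosedFieldType) (q x : C) (n : int) : C :=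
  match n with
  | Posz k => qprod q x k
  | Negz k => (qprod q (x * q ^ n) k.+1)^-1
  end.

Definition qpoch_wd (C : numClosedFieldType) (q x : C) (n : int) : bool :=
  match n with
  | Posz _ => true
  | Negz k => qprod q (x * q ^ n) k.+1 != 0
  end.

(* A pair (xs, ys) of parameter lists stands for the stacked fraction
   (xs; q)_n / (ys; q)_n. *)
Definition qfrac (C : numClosedFieldType) (q : C) (r : seq C * seq C)
    (n : int) : C :=
  (\prod_(x <- r.1) qpoch q x n) / (\prod_(y <- r.2) qpoch q y n).

Definition qfrac_wd (C : numClosedFieldType) (q : C) (r : seq C * seq C)
    (n : int) : bool :=
  all (fun x => qpoch_wd q x n) r.1 &&
  all (fun y => qpoch_wd q y n && (qpoch q y n != 0)) r.2.

Definition qfrac_inf (C : numClosedFieldType) (q : C) (r : seq C * seq C) : C :=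
  (\prod_(x <- r.1) qpoch_inf q x) / (\prod_(y <- r.2) qpoch_inf q y).

Definition qfrac_inf_wd (C : numClosedFieldType) (q : C)
    (r : seq C * seq C) : bool :=
  all (fun y => qpoch_inf q y != 0) r.2.

(* Sums over the integers k >= -m, reindexed by n = k + m. *)
Definition sum_from (C : numClosedFieldType) (m : nat) (t : int -> C) : C :=
  limn (series (fun n : nat => t (n%:Z - m%:Z))).

Definition summable_from (C : numClosedFieldType) (m : nat)
    (t : int -> C) : Prop :=
  cvgn (series (fun n : nat => t (n%:Z - m%:Z))).

Lemma qprodD (C : numClosedFieldType) (q x : C) (n k : nat) :
  qprod q x (n + k) = qprod q x n * qprod q (x * q ^+ n) k.
Proof.
rewrite /qprod big_split_ord /=; congr (_ * _).
by apply: eq_bigr => i _; rewrite exprD mulrA.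
Qed.

Lemma qpoch_inf_cvg (C : numClosedFieldType) (q x : C) :
  qpoch_inf q x != 0 -> qprod q x @ \oo --> qpoch_inf q x.
Proof.
move=> h; apply: contrapT => nc.
suff e : qpoch_inf q x = 0 by rewrite e eqxx in h.
by rewrite /qpoch_inf dvgP.
Qed.

Lemma qpochE (C : numClosedFieldType) (q x : C) (n : int) :
  q != 0 -> qpoch_inf q (x * q ^ n) != 0 ->
  qpoch q x n = qpoch_inf q x / qpoch_inf q (x * q ^ n).
Proof.
move=> q0 h; have cv := qpoch_inf_cvg h; move: h cv.
case: n => n h cv.
  have : qprod q x @ \oo --> qprod q x n * qpoch_inf q (x * q ^ n).
    rewrite -(cvg_shiftn n) /=.
    under eq_fun do rewrite addnC qprodD.
    by apply: cvgM => //; apply: cvg_cst.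
  move=> /(cvg_lim (@norm_hausdorff _ C^o)) e.
  by rewrite {1}/qpoch_inf e mulfK.
rewrite /=; set y := x * _ in h cv *.
have xy : x = y * q ^+ n.+1.
  by rewrite /y NegzE -exprnN -mulrA mulVf ?mulr1 // expf_neq0.
have cv' : qprod q y n.+1 * qprod q x k @[k --> \oo] --> qpoch_inf q y.
  have := cv; rewrite -(cvg_shiftn n.+1) /=.
  by under eq_fun do rewrite addnC qprodD -xy.
have P0 : qprod q y n.+1 != 0.
  apply: contraNneq h => e; apply/eqP; move: cv'; rewrite e.
  under eq_fun do rewrite mul0r.
  move=> /(cvg_lim (@norm_hausdorff _ C^o)) <-.
  by rewrite lim_cst //; exact: (@norm_hausdorff _ C^o).
have : qprod q x @ \oo --> (qprod q y n.+1)^-1 * qpoch_inf q y.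
  have -> : qprod q x = fun k => (qprod q y n.+1)^-1 * (qprod q y n.+1 * qprod q x k).
    by apply/funext => k; rewrite mulKf.
  by apply: cvgM => //; apply: cvg_cst.
by move=> /(cvg_lim (@norm_hausdorff _ C^o)) e; rewrite {1}/qpoch_inf e mulfK.
Qed.

(* Main.v *)
Require Import Defs.
From mathcomp Require Import ring zify.
Set Implicit Arguments.
Unset Strict Implicit.
Unset Printing Implicit Defensive.
Import Order.TTheory GRing.Theory Num.Theory.
Import numFieldNormedType.Exports.
Local Open Scope classical_set_scope.
Local Open Scope ring_scope.

(** Write W(a; b, c, d, e, f) for the very-well-poised series 8W7 with
argument a^2 q^2 / (b c d e f), and P(x) for (x; q)_oo.

The sum on the left is such a series in disguise.  The denominator
(q^{1+m}; q)_k makes it start at k = -m, and the substitution k = n - m turns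
it into its first term times W(A; B, C, D, E, f), where A = a q^{-2m} and
B, C, D, E are b, c, d, e times q^{-m} ([lhs_shift]).  The two sums on the
right are W(Ef/C; Aq/CD, Ef/A, Aq/BC, E, f) and
W(B^2/A; B, BC/A, BD/A, BE/A, Bf/A) up to their first terms ([rhs1_shift],
[rhs2_shift]).  So the statement is Bailey's three-term relation
([bailey_three_term]) at the shifted parameters, and the finite products in
T_1 and T_2 are what the shift produces ([rhs1_coefficient],
[rhs2_coefficient]).

Bailey's relation is the additivity of a q-integral.  With g = aq/bc,
u = def/a, v = aq/b, w = aq/c, put
  Phi(t) = P(qt) P(ut) P(vt) P(wt) / (P(dt) P(et) P(ft) P(gt)).
By the nonterminating form of Watson's transformation
([watson_nonterminating]), W(a; b, c, d, e, f) is an explicit constant times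
the q-integral of Phi from q/u to 1.  The same theorem identifies the other
two series of the relation with the q-integrals of the same Phi from q/v to 1
and from q/u to q/v.

Watson's transformation comes from exchanging two summations.  The
nonterminating q-Saalschuetz sum ([saalschutz_nonterminating]) writes the
products in d, e, f of the n-th term of W as a q-integral over t; for each node
t the remaining sum over n is a very-well-poised 6phi5 series with one
parameter 1/t, which is summed in closed form ([vwp6_sum_nodeE],
[vwp6_sumE]).  Both of these summations are proved by telescoping: each side
obeys a first-order recurrence under a q-shift of one parameter, and iterating
the recurrence pushes that parameter to 0.

The identities before Bailey's relation are cleared of the infinite products
that may vanish: numerator parameters may make some of the series terminate,
and then quotients of infinite products would be 0 / 0.  Convergence is handled by
geometric majorants throughout, with Tannery's theorem ([csum_tannery]) for
every passage to the limit under a sum. *)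

(** The side conditions of [field] are matched syntactically: leaving them to
    [done] would compare unrelated hypotheses up to conversion, which is
    very slow over the complex numbers. *)
Ltac field_nonzero := field; repeat (apply/andP; split);
  match goal with H : is_true (?x != _) |- is_true (?x != _) => exact: H end.

Definition geobound (C : numClosedFieldType) (M r : C) (u : nat -> C) :=
  forall n, `|u n| <= M * r ^+ n.

(** The only form of completeness that is needed.  Working with an abstract field
    and this property, instead of the complex numbers themselves, keeps their
    arithmetic opaque. *)
Definition geometric_complete (C : numClosedFieldType) :=
  forall (M r : C) (u : nat -> C),
    0 <= r -> r < 1 -> geobound M r u -> cvgn (series u).

Definition csum (C : numClosedFieldType) (u : nat -> C) : C := limn (series u).

(** * Sums with a geometric majorant *)

Section Limits.
Variable C : numClosedFieldType.
Implicit Types (u v : nat -> C) (M r l : C).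

Lemma cvgn_lim u l : u @ \oo --> l -> limn u = l.
Proof. exact: (cvg_lim (@norm_hausdorff _ C^o)). Qed.

Lemma cvgn_uniq u l l' : u @ \oo --> l -> u @ \oo --> l' -> l = l'.
Proof. by move=> /cvgn_lim <- /cvgn_lim. Qed.

Lemma cvgnP u l : u @ \oo --> l <->
  forall eps : C, 0 < eps ->
    exists N, forall n, (N <= n)%N -> `|l - u n| < eps.
Proof.
split=> [/(@cvgrPdist_lt _ C^o) h eps /h [N _ hN]|h].
  by exists N => n /hN.
apply/(@cvgrPdist_lt _ C^o) => eps /h [N hN].
by exists N => // n /= /hN.
Qed.

(** A limit inequality in a partially ordered field: norms are real, hence
    comparable with the bound, which dominates a norm and so is real too. *)
Lemma cvgn_norm_le u l M : u @ \oo --> l ->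
  (exists N, forall n, (N <= n)%N -> `|u n| <= M) -> `|l| <= M.
Proof.
move=> /cvgnP h [N hN].
have M0 : 0 <= M := le_trans (normr_ge0 _) (hN N (leqnn N)).
rewrite real_leNgt ?ger0_real//; apply/negP => lt.
have /h [N' hN'] : 0 < `|l| - M by rewrite subr_gt0.
suff /le_gtF : `|l| - M <= `|l - u (maxn N N')| by rewrite hN' ?leq_maxr.
have := ler_normD (l - u (maxn N N')) (u (maxn N N')); rewrite subrK lerBlDr.
by move/le_trans; apply; rewrite lerD2l hN // leq_maxl.
Qed.

Lemma cvgn_sum (I : Type) (s : seq I) (u : I -> nat -> C) (l : I -> C) :
  (forall i, u i @ \oo --> l i) ->
  (fun n => \sum_(i <- s) u i n) @ \oo --> \sum_(i <- s) l i.
Proof.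
move=> h; elim: s => [|i s IH].
  rewrite big_nil; under eq_fun do rewrite big_nil; exact: cvg_cst.
rewrite big_cons; under eq_fun do rewrite big_cons.
by apply: (@cvgD _ C^o); [apply: h | apply: IH].
Qed.

Lemma cvgn_prod (I : Type) (s : seq I) (u : I -> nat -> C) (l : I -> C) :
  (forall i, u i @ \oo --> l i) ->
  (fun n => \prod_(i <- s) u i n) @ \oo --> \prod_(i <- s) l i.
Proof.
move=> h; elim: s => [|i s IH].
  rewrite big_nil; under eq_fun do rewrite big_nil; exact: cvg_cst.
rewrite big_cons; under eq_fun do rewrite big_cons.
by apply: cvgM; [apply: h | apply: IH].
Qed.

Lemma geobound_ge0 M r u : geobound M r u -> 0 <= M.
Proof. by move=> /(_ 0%N); rewrite expr0 mulr1; apply: le_trans. Qed.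

Lemma geom_sum_le r N : 0 <= r -> r < 1 -> \sum_(i < N) r ^+ i <= (1 - r)^-1.
Proof.
move=> r0 r1; rewrite -[leRHS]div1r ler_pdivlMr ?subr_gt0 //.
rewrite mulrC -opprB mulNr -subrX1 opprB lerBlDr lerDl.
exact: exprn_ge0.
Qed.

Lemma csum_eq u v : u =1 v -> csum u = csum v.
Proof. by move=> /funext ->. Qed.

Lemma csumZ (k : C) u : cvgn (series u) -> csum (fun n => k * u n) = k * csum u.
Proof.
move=> cu; apply: cvgn_lim.
have -> : series (fun n => k * u n) = fun n => k * series u n.
  by apply/funext => n; rewrite /series /= mulr_sumr.
by apply: cvgM => //; apply: cvg_cst.
Qed.

Lemma cvgn_seriesZ (k : C) u : cvgn (series u) ->
  cvgn (series (fun n => k * u n)).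
Proof.
move=> cu; apply/cvg_ex; exists (k * limn (series u)).
have -> : series (fun n => k * u n) = fun n => k * series u n.
  by apply/funext => n; rewrite /series /= mulr_sumr.
by apply: cvgM => //; apply: cvg_cst.
Qed.

Lemma csumB u v : cvgn (series u) -> cvgn (series v) ->
  csum (fun n => u n - v n) = csum u - csum v.
Proof.
move=> cu cv; apply: cvgn_lim.
have -> : series (fun n => u n - v n) = fun n => series u n - series v n.
  by apply/funext => n; rewrite /series /= big_split sumrN.
exact: (@cvgB _ C^o).
Qed.

Lemma csum_finite u N : (forall n, (N <= n)%N -> u n = 0) ->
  csum u = \sum_(n < N) u n.
Proof.
move=> h; apply: cvgn_lim; apply/cvgnP => eps e0; exists N => n Nn.
rewrite /series /= -(big_mkord xpredT u) (big_cat_nat (leq0n N) Nn) /=.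
have -> : \sum_(N <= i < n) u i = 0.
  by rewrite big_nat; apply: big1 => i /andP [/h].
by rewrite addr0 subrr normr0.
Qed.

(* Dropping n leading zeros. *)
Lemma csum_shift u n : (forall k, (k < n)%N -> u k = 0) ->
  csum u = csum (fun k => u (n + k)%N).
Proof.
move=> h; rewrite /csum.
have e : (fun k => series u (k + n)%N) = series (fun k => u (n + k)%N).
  apply/funext => k; rewrite /series /= addnC big_mkord big_split_ord /= big1.
    by rewrite add0r big_mkord.
  by move=> i _; apply: h.
have := @cvg_shiftn n C^o (series u); rewrite e => {}e.
rewrite /lim; congr (get _); apply/funext => l /=.
by rewrite -e.
Qed.

Hypothesis geoC : geometric_complete C.

Lemma csum_cvg M r u : 0 <= r -> r < 1 -> geobound M r u ->
  series u @ \oo --> csum u.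
Proof. by move=> r0 r1 /(geoC r0 r1). Qed.

Lemma cvgn_expr r : 0 <= r -> r < 1 -> (fun n => r ^+ n) @ \oo --> (0 : C).
Proof.
move=> r0 r1; apply: (@cvg_series_cvg_0 _ C^o); apply: (geoC (M := 1) r0 r1).
by move=> n; rewrite mul1r ger0_norm ?exprn_ge0.
Qed.

Lemma csum_tail M r u N : 0 <= r -> r < 1 -> geobound M r u ->
  `|csum u - series u N| <= M * (r ^+ N / (1 - r)).
Proof.
move=> r0 r1 h.
apply: (@cvgn_norm_le (fun n => series u n - series u N)).
  by apply: (@cvgB _ C^o); [apply: csum_cvg h | apply: cvg_cst].
exists N => n Nn; rewrite /series /= (big_cat_nat (leq0n N) Nn) /= addrAC subrr add0r.
apply: le_trans (ler_norm_sum _ _ _) _.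
rewrite -{1}[N]add0n big_addn big_mkord.
apply: (@le_trans _ _ (\sum_(i < n - N) M * (r ^+ i * r ^+ N))).
  by apply: ler_sum => i _; rewrite -exprD.
rewrite -mulr_sumr ler_wpM2l ?(geobound_ge0 h) // -mulr_suml mulrC.
by rewrite ler_wpM2l ?exprn_ge0 ?geom_sum_le.
Qed.

Lemma csum_norm_le M r u : 0 <= r -> r < 1 -> geobound M r u ->
  `|csum u| <= M / (1 - r).
Proof.
move=> r0 r1 h; have := csum_tail 0 r0 r1 h.
by rewrite /series /= big_geq // subr0 expr0 div1r.
Qed.

Lemma cvgn_small (M eps : C) r : 0 <= r -> r < 1 -> 0 <= M -> 0 < eps ->
  exists N, forall n, (N <= n)%N -> M * r ^+ n < eps.
Proof.
move=> r0 r1 M0 e0.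
have [|N hN] := (cvgnP _ _).1 (cvgn_expr r0 r1) (eps / (M + 1)).
  by rewrite divr_gt0 ?ltr_wpDl.
exists N => n /hN; rewrite sub0r normrN ger0_norm ?exprn_ge0 // => h.
apply: (@le_lt_trans _ _ ((M + 1) * r ^+ n)).
  by rewrite ler_wpM2r ?exprn_ge0 // lerDl.
by rewrite mulrC -ltr_pdivlMr ?ltr_wpDl.
Qed.

(** Tannery's theorem.  The sum is cut at an index K whose tails are uniformly
    small; the finitely many remaining terms converge one by one. *)
Lemma csum_tannery M r (u : nat -> nat -> C) (l : nat -> C) :
  0 <= r -> r < 1 -> (forall N, geobound M r (u N)) ->
  (forall k, u N k @[N --> \oo] --> l k) ->
  csum (u N) @[N --> \oo] --> csum l.
Proof.
move=> r0 r1 hb hl.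
have hbl : geobound M r l.
  by move=> k; apply: cvgn_norm_le (hl k) _; exists 0%N => N _; apply: hb.
have M0 := geobound_ge0 hbl.
apply/cvgnP => eps e0.
have e3 : 0 < eps / 3 by rewrite divr_gt0.
have [|K hK] := @cvgn_small (M / (1 - r)) _ r r0 r1 _ e3.
  by rewrite divr_ge0 // subr_ge0 ltW.
have tail w : geobound M r w -> `|csum w - series w K| < eps / 3.
  move=> hw; apply: le_lt_trans (csum_tail K r0 r1 hw) _.
  by rewrite mulrA mulrAC; apply: hK.
have hS : (fun N => series (u N) K) @ \oo --> series l K.
  rewrite /series /= big_mkord.
  under eq_fun do rewrite big_mkord.
  by apply: cvgn_sum => i; apply: hl.
have [N hN] := (cvgnP _ _).1 hS _ e3.
exists N => n /hN hn.
have -> : csum l - csum (u n) = (csum l - series l K)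
    + (series l K - series (u n) K) - (csum (u n) - series (u n) K) by ring.
have -> : eps = eps / 3 + eps / 3 + eps / 3 by field.
apply: le_lt_trans (ler_normB _ _) _; apply: ltrD (tail _ (hb n)).
by apply: le_lt_trans (ler_normD _ _) _; apply: ltrD (tail _ hbl) hn.
Qed.

Lemma csum_sum (I : Type) (s : seq I) M r (u : I -> nat -> C) :
  0 <= r -> r < 1 -> (forall i, geobound M r (u i)) ->
  \sum_(i <- s) csum (u i) = csum (fun n => \sum_(i <- s) u i n).
Proof.
move=> r0 r1 h; apply/esym/cvgn_lim.
have -> : series (fun n => \sum_(i <- s) u i n) =
          fun n => \sum_(i <- s) series (u i) n.
  by apply/funext => n; rewrite /series /= exchange_big.
by apply: cvgn_sum => i; apply: csum_cvg (h i).
Qed.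

(** Tannery's theorem applied to the partial sums over n. *)
Lemma csum_exchange M r s (u : nat -> nat -> C) :
  0 <= r -> r < 1 -> 0 <= s -> s < 1 ->
  (forall n k, `|u n k| <= M * r ^+ n * s ^+ k) ->
  csum (fun n => csum (fun k => u n k)) = csum (fun k => csum (fun n => u n k)).
Proof.
move=> r0 r1 s0 s1 h.
have M0 : 0 <= M.
  by have := h 0%N 0%N; rewrite !expr0 !mulr1; apply: le_trans.
have hr k : geobound (M * s ^+ k) r (u^~ k) by move=> n; rewrite mulrAC.
have hs n : geobound (M * r ^+ n) s (u n) by move=> k; apply: h.
have hs' n : geobound M s (u n).
  move=> k; apply: le_trans (h n k) _; rewrite ler_wpM2r ?exprn_ge0 //.
  by rewrite ler_piMr // exprn_ile1 // ltW.
apply: cvgn_lim.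
have -> : series (fun n => csum (fun k => u n k)) =
          fun N => csum (fun k => series (u^~ k) N).
  by apply/funext => N; rewrite /series /= (csum_sum _ s0 s1 hs').
apply: (@csum_tannery (M / (1 - r)) s) => // [N k|k]; last exact: csum_cvg (hr k).
rewrite /series /= big_mkord; apply: le_trans (ler_norm_sum _ _ _) _.
apply: le_trans (ler_sum _ (G := fun i : 'I_N => M * s ^+ k * r ^+ i) _) _.
  by move=> i _; apply: hr.
rewrite -mulr_sumr mulrAC ler_wpM2r ?exprn_ge0 //.
by rewrite ler_wpM2l // geom_sum_le.
Qed.

End Limits.

Section ComplexComplete.
Local Open Scope complex_scope.

(** The real and imaginary parts are absolutely convergent real series. *)
Lemma complex_geometric_complete (R : realType) : geometric_complete R[i].
Proof.
move=> M r u r0 r1 h; have M0 := geobound_ge0 h.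
have [s rs] : exists s, r = s%:C by apply/complex_realP/ger0_real.
have [K MK] : exists s, M = s%:C by apply/complex_realP/ger0_real.
move: r0 r1 M0; rewrite rs MK !ler0c -[1]/(1%:C) ltcR => s0 s1 K0.
have bnd n : Num.sqrt (complex.Re (u n) ^+ 2 + complex.Im (u n) ^+ 2) <= K * s ^+ n.
  by have := h n; rewrite rs MK -rmorphXn -rmorphM normc_def lecR.
have part (f : R[i] -> R) :
    (forall z, `|f z| <= Num.sqrt (complex.Re z ^+ 2 + complex.Im z ^+ 2)) ->
    cvgn (series (f \o u)).
  move=> hf; apply: normed_cvg.
  apply: (@series_le_cvg _ _ (geometric K s)) => [n|n|n|] //=.
  - by rewrite mulr_ge0 ?exprn_ge0.
  - exact: le_trans (hf _) (bnd n).
  - by apply: is_cvg_geometric_series; rewrite ger0_norm.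
have /part /cvg_ex [x hx] : forall z : R[i],
    `|complex.Re z| <= Num.sqrt (complex.Re z ^+ 2 + complex.Im z ^+ 2).
  by move=> z; rewrite -sqrtr_sqr ler_wsqrtr // lerDl sqr_ge0.
have /part /cvg_ex [y hy] : forall z : R[i],
    `|complex.Im z| <= Num.sqrt (complex.Re z ^+ 2 + complex.Im z ^+ 2).
  by move=> z; rewrite -sqrtr_sqr ler_wsqrtr // lerDr sqr_ge0.
have norm_lt (a b e : R) : `|a| < e / 2 -> `|b| < e / 2 -> `|a +i* b| < e%:C.
  move=> ha hb; rewrite [a +i* b]complexE /=.
  apply: le_lt_trans (ler_normD _ _) _.
  rewrite normrM !normc_def /= !(expr0n, expr1n, addr0, add0r) sqrtr1 !sqrtr_sqr.
  by rewrite mul1r -rmorphD ltcR [e]splitr ltrD.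
apply/cvg_ex; exists (x +i* y); apply/cvgnP => eps e0.
have [e ee] : exists e, eps = e%:C by apply/complex_realP/gtr0_real.
move: e0; rewrite ee ltcR => e0; have e2 : 0 < e / 2 by rewrite divr_gt0.
move/cvgrPdist_lt: hx => /(_ _ e2) [N _ hN].
move/cvgrPdist_lt: hy => /(_ _ e2) [N' _ hN'].
exists (maxn N N') => n; rewrite geq_max => /andP [/hN h1 /hN' h2].
have -> : x +i* y - series u n =
    (x - series (@complex.Re R \o u) n) +i* (y - series (@complex.Im R \o u) n).
  apply/eqP; rewrite eq_complex /series /= !raddfB !raddf_sum /=.
  by rewrite !eqxx.
exact: norm_lt.
Qed.

End ComplexComplete.

(** * Infinite q-products *)

Section InfiniteProducts.
Variable C : numClosedFieldType.
Hypothesis geoC : geometric_complete C.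
Implicit Types (x y z : C) (M X r : C).

(** A tail of the product with small sum S of its y r^i satisfies
    product * (1 - S) <= 1, so it is at most 2 as soon as S <= 1/2. *)
Lemma prod_geo_bound (y r : C) : 0 <= y -> 0 <= r -> r < 1 ->
  exists M, forall n, \prod_(i < n) (1 + y * r ^+ i) <= M.
Proof.
move=> y0 r0 r1; have h2 : 0 < 2^-1 :> C by rewrite invr_gt0.
have r1' : 0 < 1 - r by rewrite subr_gt0.
have [|N hN] := cvgn_small geoC (M := y / (1 - r)) r0 r1 _ h2.
  by rewrite divr_ge0 // ltW.
have t0 i : 0 <= y * r ^+ i by rewrite mulr_ge0 ?exprn_ge0.
have t1 i : 1 <= 1 + y * r ^+ i by rewrite lerDl.
have t1' i : 0 <= 1 + y * r ^+ i by rewrite (le_trans _ (t1 i)).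
have p0 m n : 0 <= \prod_(i < n) (1 + y * r ^+ (m + i)).
  by apply: prodr_ge0 => i _.
exists (\prod_(i < N) (1 + y * r ^+ i) * 2) => n.
apply: (@le_trans _ _ (\prod_(i < N + n) (1 + y * r ^+ i))).
  rewrite addnC big_split_ord /= ler_peMr //; first exact: (p0 0%N).
  elim: {hN p0}N => [|N IH]; first by rewrite big_ord0.
  by rewrite big_ord_recr /= -[leLHS]mulr1 ler_pM.
rewrite big_split_ord /=; apply: ler_wpM2l; first exact: (p0 0%N).
have tail : \prod_(i < n) (1 + y * r ^+ (N + i)) *
            (1 - \sum_(i < n) y * r ^+ (N + i)) <= 1.
  elim: n => [|n IH]; first by rewrite !big_ord0 subr0 mulr1.
  rewrite !big_ord_recr /=; set s := \sum_(i < n) _; set p := \prod_(i < n) _.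
  set t := y * _.
  have -> : p * (1 + t) * (1 - (s + t)) = p * (1 - s) - p * (t * s + t * t).
    by ring.
  apply: le_trans IH; rewrite lerBlDr lerDl mulr_ge0 ?p0 // addr_ge0 //.
    by rewrite mulr_ge0 ?t0 // sumr_ge0 // => i _; apply: t0.
  by rewrite mulr_ge0 ?t0.
have sum_le : \sum_(i < n) y * r ^+ (N + i) <= 2^-1.
  apply: le_trans (ltW (hN N (leqnn N))).
  rewrite [leRHS]mulrAC; apply: (@le_trans _ _ (y * r ^+ N * \sum_(i < n) r ^+ i)).
    by rewrite mulr_sumr; apply: ler_sum => i _; rewrite exprD mulrA.
  by rewrite ler_wpM2l // geom_sum_le.
rewrite -[leRHS]mul1r -ler_pdivrMr //.
apply: le_trans tail; rewrite ler_wpM2l ?p0 //.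
by rewrite lerBrDr -lerBrDl (_ : 1 - 2^-1 = 2^-1) //; field.
Qed.

(** Factoring the mean r of s and 1 out of each factor leaves a bounded product.
    This is what makes the sums over n below converge geometrically, uniformly in
    the node t. *)
Lemma prod_geo_small (s y t : C) : 0 <= s -> s < 1 -> 0 <= y -> 0 <= t -> t < 1 ->
  exists M r, [/\ 0 <= r, r < 1 &
    forall n, \prod_(i < n) (s + y * t ^+ i) <= M * r ^+ n].
Proof.
move=> s0 s1 y0 t0 t1; pose r := (1 + s) / 2.
have r0 : 0 < r by rewrite divr_gt0 // ltr_wpDr.
have r1 : r < 1 by rewrite ltr_pdivrMr // mul1r ltrD2l.
have sr : s <= r by rewrite ler_pdivlMr // mulrDr mulr1 lerD2r ltW.
have [|M hM] := @prod_geo_bound (y / r) t _ t0 t1.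
  by rewrite divr_ge0 // ltW.
exists M, r; split=> // [|n]; first exact: ltW.
apply: (@le_trans _ _ (\prod_(i < n) ((1 + y / r * t ^+ i) * r))).
  apply: ler_prod => i _; rewrite addr_ge0 ?mulr_ge0 ?exprn_ge0 //=.
  by rewrite mulrDl mul1r lerD // mulrAC divfK ?gt_eqF.
rewrite big_split /= prodr_const card_ord.
by apply: ler_wpM2r; rewrite ?hM // exprn_ge0 // ltW.
Qed.

Variable q : C.
Hypothesis q1 : `|q| < 1.
Local Notation P := (qpoch_inf q).

Lemma qprod0 x : qprod q x 0 = 1. Proof. by rewrite /qprod big_ord0. Qed.

Lemma qprodS x n : qprod q x n.+1 = qprod q x n * (1 - x * q ^+ n).
Proof. by rewrite /qprod big_ord_recr. Qed.

Lemma qprodSl x n : qprod q x n.+1 = (1 - x) * qprod q (x * q) n.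
Proof. by rewrite -add1n qprodD expr1 qprodS qprod0 mul1r expr0 mulr1. Qed.

Lemma qprod_bound X : 0 <= X ->
  exists M, forall x, `|x| <= X -> forall n, `|qprod q x n| <= M.
Proof.
move=> X0; have [M hM] := prod_geo_bound X0 (normr_ge0 q) q1.
exists M => x hx n; apply: le_trans (hM n); rewrite /qprod normr_prod.
apply: ler_prod => i _; rewrite normr_ge0 /=.
apply: le_trans (ler_normB _ _) _; rewrite normr1 lerD2l normrM normrX.
by rewrite ler_wpM2r ?exprn_ge0.
Qed.

(** The product as a sum of its increments, which decay geometrically. *)
Lemma qprod_series x : qprod q x = fun n =>
  1 + series (fun k => - (x * q ^+ k * qprod q x k)) n.
Proof.
apply/funext; elim=> [|n IH].
  by rewrite qprod0 /series /= big_geq // addr0.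
by rewrite qprodS /series /= big_nat_recr //= addrA -/(series _ n) -IH; ring.
Qed.

(** The bound on the distance to 1 is uniform on discs, which gives at once the
    continuity of the infinite product at 0. *)
Lemma qprod_cvg_near X : 0 <= X ->
  exists M, forall x, `|x| <= X ->
    qprod q x @ \oo --> P x /\ `|P x - 1| <= M * `|x|.
Proof.
move=> X0; have [M hM] := qprod_bound X0; exists (M / (1 - `|q|)) => x hx.
have gb : geobound (M * `|x|) `|q| (fun k => - (x * q ^+ k * qprod q x k)).
  move=> k; rewrite normrN !normrM normrX -[leRHS]mulrA [leRHS]mulrC.
  by rewrite ler_wpM2l ?hM ?mulr_ge0 ?exprn_ge0.
have c := csum_cvg geoC (normr_ge0 q) q1 gb.
have cv : qprod q x @ \oo -->
    1 + csum (fun k => - (x * q ^+ k * qprod q x k)).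
  rewrite [X in X @ _]qprod_series.
  by apply: (@cvgD _ C^o) => //; apply: cvg_cst.
have e : P x = 1 + csum (fun k => - (x * q ^+ k * qprod q x k)).
  exact: cvgn_lim.
split; first by rewrite e.
by rewrite e addrC addKr mulrAC; apply: csum_norm_le gb.
Qed.

Lemma qprod_cvg x : qprod q x @ \oo --> P x.
Proof. by have [M /(_ x (lexx _)) []] := qprod_cvg_near (normr_ge0 x). Qed.
Arguments qprod_cvg : clear implicits.

Lemma qinf_bound X : 0 <= X -> exists M, forall x, `|x| <= X -> `|P x| <= M.
Proof.
move=> /qprod_bound [M hM]; exists M => x hx.
by apply: cvgn_norm_le (qprod_cvg x) _; exists 0%N => n _; apply: hM.
Qed.

Lemma qinf_split x n : P x = qprod q x n * P (x * q ^+ n).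
Proof.
have h : (fun k => qprod q x (k + n)%N) @ \oo --> P x.
  by have := qprod_cvg x; rewrite -(@cvg_shiftn n C^o).
apply: cvgn_uniq h _; under eq_fun do rewrite addnC qprodD.
by apply: cvgM; [apply: cvg_cst | apply: qprod_cvg].
Qed.

Lemma qinf_S x : P x = (1 - x) * P (x * q).
Proof. by rewrite (qinf_split x 1) qprodS qprod0 mul1r expr0 mulr1 expr1. Qed.

Lemma qinf0 : P 0 = 1.
Proof.
have [M /(_ 0)] := qprod_cvg_near (lexx 0).
rewrite normr0 => /(_ (lexx _)) [_].
by rewrite mulr0 normr_le0 subr_eq0 => /eqP.
Qed.

Lemma qinf1 : P 1 = 0.
Proof. by rewrite qinf_S subrr mul0r. Qed.

Lemma cvg_mulq x : (fun N => x * q ^+ N) @ \oo --> (0 : C).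
Proof.
apply/cvgnP => eps e0.
have [N hN] := cvgn_small geoC (normr_ge0 q) q1 (normr_ge0 x) e0.
by exists N => n /hN; rewrite sub0r normrN normrM normrX.
Qed.
Arguments cvg_mulq : clear implicits.

Lemma mulq_bound x n : `|x * q ^+ n| <= `|x|.
Proof. by rewrite normrM normrX ler_piMr // exprn_ile1 // ltW. Qed.

Lemma qinf_cvg1 x : P (x * q ^+ N) @[N --> \oo] --> (1 : C).
Proof.
have [M hM] := qprod_cvg_near (normr_ge0 x).
have M0 : 0 <= M * `|x| by have [_] := hM x (lexx _); apply: le_trans.
apply/cvgnP => eps e0.
have [N hN] := cvgn_small geoC (normr_ge0 q) q1 M0 e0.
exists N => n /hN; apply: le_lt_trans; rewrite distrC.
by have [_] := hM _ (mulq_bound x n); rewrite normrM normrX mulrA.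
Qed.
Arguments qinf_cvg1 : clear implicits.

Lemma qprod_cvg1 x k : qprod q (x * q ^+ N) k @[N --> \oo] --> (1 : C).
Proof.
rewrite /qprod; rewrite [X in _ --> X](_ : 1 = \prod_(i < k) 1); last by rewrite big1.
apply: cvgn_prod => i; rewrite -[X in _ --> X](subr0 (1 : C)).
apply: (@cvgB _ C^o); first exact: cvg_cst.
under eq_fun do rewrite mulrAC; exact: cvg_mulq.
Qed.
Arguments qprod_cvg1 : clear implicits.

(** Split off factors until the remaining product is within distance 1 of its
    limit value 1. *)
Lemma qinf_neq0 x : (forall n, qprod q x n != 0) -> P x != 0.
Proof.
move=> h; have [N hN] := (cvgnP _ _).1 (qinf_cvg1 x) 1 ltr01.
rewrite (qinf_split x N) mulf_neq0 //; apply/eqP => e.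
by have := hN N (leqnn N); rewrite e subr0 normr1 ltxx.
Qed.

Lemma qprod_neq0 x n : P x != 0 -> qprod q x n != 0.
Proof. by rewrite (qinf_split x n) mulf_eq0 negb_or => /andP []. Qed.

Lemma qinf_shift_neq0 x n : P x != 0 -> P (x * q ^+ n) != 0.
Proof. by rewrite (qinf_split x n) mulf_eq0 negb_or => /andP []. Qed.

Lemma qprod_inv x n : P x != 0 -> (qprod q x n)^-1 = P (x * q ^+ n) / P x.
Proof.
move=> h; rewrite [in RHS](qinf_split x n) invfM mulrCA divff ?mulr1 //.
exact: qinf_shift_neq0.
Qed.

(** The inverse is the quotient of a bounded tail by a fixed nonzero number. *)
Lemma qprod_inv_bound x : P x != 0 -> exists M, forall n, `|(qprod q x n)^-1| <= M.
Proof.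
move=> h; have [M hM] := qinf_bound (normr_ge0 x).
exists (M * `|(P x)^-1|) => n; rewrite qprod_inv // normrM.
by rewrite ler_wpM2r // hM // mulq_bound.
Qed.

Lemma qinf_small x : `|x| < 1 -> P x != 0.
Proof.
move=> x1; apply: qinf_neq0 => n; apply/prodf_neq0 => i _.
rewrite subr_eq0; apply/eqP => e.
have := le_lt_trans (mulq_bound x i) x1.
by rewrite -e normr1 ltxx.
Qed.

Lemma qinf_q : P q != 0.
Proof. exact: qinf_small. Qed.

End InfiniteProducts.
Arguments qprod_cvg {C} _ {q} _ x [t].
Arguments cvg_mulq {C} _ {q} _ x [t].
Arguments qinf_cvg1 {C} _ {q} _ x [t].
Arguments qprod_cvg1 {C} _ {q} _ x k [t].

(** * Bounded expressions in q-products *)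

Section Bounded.
Variable C : numClosedFieldType.
Hypothesis geoC : geometric_complete C.
Variable q : C.
Hypothesis q1 : `|q| < 1.
Variable I : Type.
Implicit Types f g : I -> C.

Definition bdd f := exists M, forall i, `|f i| <= M.

Lemma bdd_cst (x : C) : bdd (fun=> x). Proof. by exists `|x|. Qed.

Lemma bddM f g : bdd f -> bdd g -> bdd (fun i => f i * g i).
Proof.
by move=> [M hM] [K hK]; exists (M * K) => i; rewrite normrM ler_pM.
Qed.

Lemma bddB f g : bdd f -> bdd g -> bdd (fun i => f i - g i).
Proof.
move=> [M hM] [K hK]; exists (M + K) => i.
by apply: le_trans (ler_normB _ _) _; apply: lerD.
Qed.

Lemma bdd_expq (n : I -> nat) : bdd (fun i => q ^+ n i).
Proof. by exists 1 => i; rewrite normrX exprn_ile1 // ltW. Qed.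

Lemma bdd_ge0 f : bdd f -> exists2 M, 0 <= M & forall i, `|f i| <= M.
Proof.
case: (pselect (inhabited I)) => [[j] [M hM]|nI _].
  by exists M => //; apply: le_trans (hM j).
by exists 0 => // i; case: nI.
Qed.

Lemma bdd_qprod f (n : I -> nat) : bdd f -> bdd (fun i => qprod q (f i) (n i)).
Proof.
move=> /bdd_ge0 [X X0 hX]; have [M hM] := qprod_bound geoC q1 X0.
by exists M => i; apply: hM.
Qed.

Lemma bdd_qinf f : bdd f -> bdd (fun i => qpoch_inf q (f i)).
Proof.
move=> /bdd_ge0 [X X0 hX]; have [M hM] := qinf_bound geoC q1 X0.
by exists M => i; apply: hM.
Qed.

Lemma bdd_qprodV (x : C) (n : I -> nat) :
  qpoch_inf q x != 0 -> bdd (fun i => (qprod q x (n i))^-1).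
Proof. by move=> /(qprod_inv_bound geoC q1) [M hM]; exists M. Qed.

End Bounded.

Ltac prove_bdd geoC q1 :=
  repeat (apply: (bdd_expq q1) || apply: bdd_cst || apply: bddM ||
    apply: bddB || apply: (bdd_qprodV geoC q1) || apply: (bdd_qprod geoC q1) ||
    apply: (bdd_qinf geoC q1)); try assumption.

(** * The nonterminating q-Saalschuetz sum *)

Section Saalschutz.
Variable C : numClosedFieldType.
Hypothesis geoC : geometric_complete C.
Variable q : C.
Hypothesis q1 : `|q| < 1.
Local Notation P := (qpoch_inf q).
Local Notation "[ x ]_ n" := (qprod q x n)
  (at level 0, x at level 99, n at level 2, format "[ x ]_ n").
Implicit Types a b c e : C.

(** The k-th term of the balanced series 3phi2(a, b, c; e, f; q, q) with
    f = abcq/e, multiplied by P(q) P(e) P(f) and by the products P(aq/e) P(bq/e)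
    P(cq/e) of the companion series, so that no denominator remains except e. *)
Definition saalschutz_term a b c e (k : nat) : C :=
  P (a * q / e) * P (b * q / e) * P (c * q / e) * q ^+ k *
  ([a]_k * [b]_k * [c]_k) *
  (P (q ^+ k.+1) * P (e * q ^+ k) * P (a * b * c * q / e * q ^+ k)).

(** The certificate behind the recurrence in c.  With x = q^k the summand is the
    common factor of both terms times a linear polynomial in x, which is the
    difference of (1 - ax)(1 - bx)(1 - cx) and (1 - x)(1 - ex/q)(1 - fx) up to
    the constant -cq/e. *)
Lemma saalschutz_telescope a b c e N : e != 0 ->
  \sum_(k < N.+1) (saalschutz_term a b c e k -
     (1 - a * c * q / e) * (1 - b * c * q / e) * saalschutz_term a b (c * q) e k) =
  - (c * q / e) * (P (a * q / e) * P (b * q / e) * P (c * q * q / e)) *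
   ([a]_N.+1 * [b]_N.+1 * [c * q]_N) *
   (P (q ^+ N.+1) * P (e * q ^+ N) * P (a * b * c * q / e * q ^+ N.+1)).
Proof.
move=> e0; set f := a * b * c * q / e.
have Ef k : a * b * (c * q) * q / e * q ^+ k = f * q ^+ k.+1.
  by rewrite /f exprS; field.
have Ec : P (c * q / e) = (1 - c * q / e) * P (c * q * q / e).
  by rewrite (qinf_S geoC q1) [c * q / e * q]mulrAC.
have Sf k : P (f * q ^+ k) = (1 - f * q ^+ k) * P (f * q ^+ k.+1).
  by rewrite (qinf_S geoC q1) -mulrA -exprSr.
elim: N => [|N IH].
  rewrite big_ord1 /saalschutz_term -/f Ef Ec !qprodS !qprod0 Sf.
  rewrite !expr0 !expr1 /f; set A := P _; set B := P (b * q / e).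
  set X := P (_ / e); set Y := P q; set Z := P (e * 1); set U := P (_ * q).
  by field.
rewrite big_ord_recr /= {}IH /saalschutz_term -/f Ef Ec !(qprodS _ _ N.+1).
rewrite (qprodSl _ c) (qprodS _ (c * q) N) (Sf N.+1).
have -> : P (q ^+ N.+1) = (1 - q ^+ N.+1) * P (q ^+ N.+2).
  by rewrite (qinf_S geoC q1) -exprSr.
have -> : P (e * q ^+ N) = (1 - e * q ^+ N) * P (e * q ^+ N.+1).
  by rewrite (qinf_S geoC q1) -mulrA -exprSr.
set A := P _; set B := P (b * q / e).
set X := P (_ / e); set Y := P (q ^+ _); set Z := P (e * _); set U := P (f * _).
rewrite /f !exprS; move: [a]_N.+1 [b]_N.+1 [c * q]_N (q ^+ N) => a' b' c' x.
by field.
Qed.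

Lemma saalschutz_bound a b c e :
  exists M, forall N, geobound M `|q| (saalschutz_term a b (c * q ^+ N) e).
Proof.
pose G (i : nat * nat) := 
  P (a * q / e) * P (b * q / e) * P (c * q ^+ i.1 * (q / e)) *
  ([a]_i.2 * [b]_i.2 * [c * q ^+ i.1]_i.2) *
  (P (q ^+ i.2.+1) * P (e * q ^+ i.2) *
   P (c * q ^+ i.1 * (a * b * q / e) * q ^+ i.2)).
have [M hM] : bdd G.
  by rewrite /G; prove_bdd geoC q1.
exists M => N k.
have -> : saalschutz_term a b (c * q ^+ N) e k = q ^+ k * G (N, k).
  rewrite /saalschutz_term /G /= -[c * q ^+ N * q / e]mulrA.
  have -> : a * b * (c * q ^+ N) * q / e = c * q ^+ N * (a * b * q / e) by ring.
  by ring.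
by rewrite normrM normrX mulrC ler_wpM2r ?exprn_ge0.
Qed.

Definition saalschutz_sum a b c e : C := csum (saalschutz_term a b c e).

(** The q-integral from q/e to 1.  Dividing the variable by q/e exchanges the roles
    of the two endpoints and turns a, b, c, e into aq/e, bq/e, cq/e, q^2/e. *)
Definition saalschutz_pair a b c e : C :=
  saalschutz_sum a b c e -
  q / e * saalschutz_sum (a * q / e) (b * q / e) (c * q / e) (q ^+ 2 / e).

Lemma saalschutz_cvg a b c e :
  series (saalschutz_term a b c e) @ \oo --> saalschutz_sum a b c e.
Proof.
have [M hM] := saalschutz_bound a b c e.
apply: (csum_cvg geoC (M := M) (normr_ge0 q) q1).
by have := hM 0%N; rewrite expr0 mulr1.
Qed.

(** The telescoped sums do not tend to 0: the boundary term at infinity survives. *)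
Lemma saalschutz_sum_rec a b c e : e != 0 ->
  saalschutz_sum a b c e -
    (1 - a * c * q / e) * (1 - b * c * q / e) * saalschutz_sum a b (c * q) e =
  - (c * q / e) * (P (a * q / e) * P (b * q / e) * P (c * q * q / e)) *
    (P a * P b * P (c * q)).
Proof.
move=> e0; set k1 := (1 - _) * _.
have h1 : (fun N => series (saalschutz_term a b c e) N.+1 -
     k1 * series (saalschutz_term a b (c * q) e) N.+1) @ \oo -->
    saalschutz_sum a b c e - k1 * saalschutz_sum a b (c * q) e.
  apply: (@cvgB _ C^o).
    by have := @saalschutz_cvg a b c e; rewrite -(@cvg_shiftn 1 C^o);
       under eq_fun do rewrite addn1.
  apply: cvgM; first exact: cvg_cst.
  by have := @saalschutz_cvg a b (c * q) e; rewrite -(@cvg_shiftn 1 C^o);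
       under eq_fun do rewrite addn1.
apply: cvgn_uniq h1 _; set K := - _ * _; set f := a * b * c * q / e.
have -> : (fun N => series (saalschutz_term a b c e) N.+1 -
     k1 * series (saalschutz_term a b (c * q) e) N.+1) =
  fun N => K * ([a]_N.+1 * [b]_N.+1 * [c * q]_N) *
   (P (q * q ^+ N) * P (e * q ^+ N) * P (f * q * q ^+ N)).
  apply/funext => N; rewrite /series /= mulr_sumr -sumrB big_mkord.
  by rewrite saalschutz_telescope // -exprS -[f * q * _]mulrA -exprS.
have cS x : (fun N => [x]_N.+1) @ \oo --> P x.
  have := qprod_cvg geoC q1 x; rewrite -(@cvg_shiftn 1 C^o).
  by under eq_fun do rewrite addn1.
rewrite -[K * (P a * P b * _)]mulr1.
rewrite -[X in K * _ * X](_ : 1 * 1 * 1 = 1); last by rewrite !mulr1.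
apply: cvgM; [apply: cvgM|]; first exact: cvg_cst.
  by apply: cvgM; [apply: cvgM; apply: cS | apply: qprod_cvg].
by apply: cvgM; [apply: cvgM|]; apply: qinf_cvg1.
Qed.

(** The boundary terms at infinity of the two series cancel. *)
Lemma saalschutz_pair_rec a b c e : q != 0 -> e != 0 ->
  saalschutz_pair a b c e =
    (1 - a * c * q / e) * (1 - b * c * q / e) * saalschutz_pair a b (c * q) e.
Proof.
move=> q0 e0; have e0' : q ^+ 2 / e != 0.
  by rewrite mulf_neq0 ?expf_neq0 ?invr_eq0.
have h1 := saalschutz_sum_rec a b c e0.
have h2 := saalschutz_sum_rec (a * q / e) (b * q / e) (c * q / e) e0'.
have E x : x * q / e * q / (q ^+ 2 / e) = x by field; rewrite q0 e0.
have E2 x : x * q / e * (c * q / e) * q / (q ^+ 2 / e) = x * c * q / e.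
  by field; rewrite q0 e0.
have E3 : c * q / e * q * q / (q ^+ 2 / e) = c * q by field; rewrite q0 e0.
move: h2; rewrite !E !E2 E3 => h2.
have E5 : c * q / e * q = c * q * q / e by ring.
move: h2; rewrite E5 => h2.
rewrite /saalschutz_pair.
move/eqP: h1; rewrite subr_eq => /eqP ->.
move/eqP: h2; rewrite subr_eq => /eqP ->.
by field.
Qed.

Lemma saalschutz_pair_sym a b c e : saalschutz_pair a b c e = saalschutz_pair a c b e.
Proof.
rewrite /saalschutz_pair; congr (_ - _ * _); apply: csum_eq => k; rewrite /saalschutz_term.
  by rewrite [a * b * c]mulrAC; ring.
by rewrite [_ * (b * q / e) * (c * q / e)]mulrAC; ring.
Qed.

Lemma saalschutz_pair_rot a b c e : saalschutz_pair a b c e = saalschutz_pair b c a e.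
Proof.
rewrite /saalschutz_pair; congr (_ - _ * _); apply: csum_eq => k; rewrite /saalschutz_term.
  by rewrite -[b * c * a]mulrC [a * (b * c)]mulrA; ring.
rewrite -[_ * (b * q / e) * (c * q / e)]mulrA.
by rewrite [a * q / e * (_ * _)]mulrC; ring.
Qed.

Lemma saalschutz_sum_cvg0 a b c e :
  saalschutz_sum a b (c * q ^+ N) e @[N --> \oo] --> saalschutz_sum a b 0 e.
Proof.
have [M hM] := saalschutz_bound a b c e.
apply: (csum_tannery geoC (M := M) (normr_ge0 q) q1) => // k.
pose K := P (a * q / e) * P (b * q / e) * q ^+ k * ([a]_k * [b]_k) *
  (P (q ^+ k.+1) * P (e * q ^+ k)).
have -> : (fun N => saalschutz_term a b (c * q ^+ N) e k) = fun N =>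
   K * (P (c * q / e * q ^+ N) * [c * q ^+ N]_k *
        P (a * b * c * q / e * q ^+ k * q ^+ N)).
  apply/funext => N; rewrite /saalschutz_term /K.
  have -> : c * q ^+ N * q / e = c * q / e * q ^+ N by ring.
  have -> : a * b * (c * q ^+ N) * q / e * q ^+ k =
            a * b * c * q / e * q ^+ k * q ^+ N by ring.
  by ring.
have -> : saalschutz_term a b 0 e k = K * (1 * 1 * 1).
  rewrite /saalschutz_term !mulr0 !mul0r (qinf0 geoC q1) /K.
  have -> : [0]_k = 1 by rewrite /qprod big1 // => i _; rewrite mul0r subr0.
  by ring.
apply: cvgM; first exact: cvg_cst.
by apply: cvgM; [apply: cvgM|]; [apply: qinf_cvg1|apply: qprod_cvg1|apply: qinf_cvg1].
Qed.

(** Iterate the recurrence: c q^N tends to 0. *)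
Lemma saalschutz_pair_inf a b c e : q != 0 -> e != 0 ->
  saalschutz_pair a b c e = P (a * c * q / e) * P (b * c * q / e) * saalschutz_pair a b 0 e.
Proof.
move=> q0 e0.
have iter N : saalschutz_pair a b c e =
    [a * c * q / e]_N * [b * c * q / e]_N * saalschutz_pair a b (c * q ^+ N) e.
  elim: N => [|N IH]; first by rewrite !qprod0 expr0 !(mulr1, mul1r).
  rewrite {}IH (saalschutz_pair_rec a b (c * q ^+ N)) // !qprodS exprSr [c * (_ * q)]mulrA.
  have -> x : x * (c * q ^+ N) * q / e = x * c * q / e * q ^+ N by ring.
  by ring.
have h : (fun N : nat => saalschutz_pair a b c e) @ \oo -->
         P (a * c * q / e) * P (b * c * q / e) * saalschutz_pair a b 0 e.
  under eq_fun => N do rewrite (iter N).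
  apply: cvgM; first by apply: cvgM; apply: (qprod_cvg geoC q1).
  apply: (@cvgB _ C^o); first exact: saalschutz_sum_cvg0.
  apply: cvgM; first exact: cvg_cst.
  rewrite mul0r mul0r.
  have -> : (fun N => saalschutz_sum (a * q / e) (b * q / e) (c * q ^+ N * q / e)
      (q ^+ 2 / e)) = fun N => saalschutz_sum (a * q / e) (b * q / e)
      (c * q / e * q ^+ N) (q ^+ 2 / e).
    by apply/funext => N; rewrite (_ : c * q ^+ N * q / e = c * q / e * q ^+ N); last by ring.
  exact: saalschutz_sum_cvg0.
apply: cvgn_uniq h; exact: cvg_cst.
Qed.

(** Send c and then b to 0.  Sending a to 0 as well costs only factors P(0) = 1, so
    what is left does not depend on a; at a = 1 the first series has a single term
    and the second vanishes. *)
Theorem saalschutz_nonterminating a b c e : q != 0 -> e != 0 ->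
  saalschutz_pair a b c e = P q * P e * P (q / e) *
    (P (b * c * q / e) * P (a * c * q / e) * P (a * b * q / e)).
Proof.
move=> q0 e0.
have base x : saalschutz_pair x 0 0 e = saalschutz_pair 0 0 0 e.
  rewrite saalschutz_pair_rot saalschutz_pair_inf //.
  by rewrite !mul0r (qinf0 geoC q1) !mul1r.
rewrite saalschutz_pair_inf // saalschutz_pair_sym saalschutz_pair_inf // base -(base 1).
rewrite !mul0r (qinf0 geoC q1) mulr1.
have -> : saalschutz_pair 1 0 0 e = P q * P e * P (q / e).
  rewrite /saalschutz_pair [X in _ - q / e * X](_ : _ = 0); last first.
    rewrite /saalschutz_sum (@csum_finite _ _ 0) ?big_ord0 // => k _; rewrite /saalschutz_term.
    have -> : 1 * q / e * q / (q ^+ 2 / e) = 1 by field; rewrite q0 e0.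
    by rewrite (qinf1 geoC q1) !mul0r.
  rewrite mulr0 subr0 /saalschutz_sum (@csum_finite _ _ 1) => [|k k1].
    rewrite big_ord1 /saalschutz_term !qprod0 !mul0r !mulr0 !mul0r (qinf0 geoC q1).
    by rewrite !expr0 expr1 !mul1r !mulr1; ring.
  rewrite /saalschutz_term; have -> : [1]_k = 0.
    by case: k k1 => // k _; rewrite qprodSl subrr mul0r.
  by rewrite !(mul0r, mulr0).
by ring.
Qed.

End Saalschutz.

(** * The very-well-poised 6phi5 sum *)

Section SixPhiFive.
Variable C : numClosedFieldType.
Hypothesis geoC : geometric_complete C.
Variable q : C.
Hypothesis q1 : `|q| < 1.
Local Notation P := (qpoch_inf q).
Local Notation "[ x ]_ n" := (qprod q x n)
  (at level 0, x at level 99, n at level 2, format "[ x ]_ n").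

(** (1/t; q)_n t^n, written as a polynomial in t so that t = 0 is allowed. *)
Definition qnodes (t : C) n := \prod_(i < n) (t - q ^+ i).

Lemma qnodesS t n : qnodes t n.+1 = qnodes t n * (t - q ^+ n).
Proof. by rewrite /qnodes big_ord_recr. Qed.

Lemma qnodes_mulq t n : qnodes (t * q) n.+1 = q ^+ n * (t * q - 1) * qnodes t n.
Proof.
rewrite /qnodes big_ord_recl /= expr0 mulrAC mulrC; congr (_ * _).
rewrite -[X in _ ^+ X]card_ord -prodr_const -big_split /=.
by apply: eq_bigr => i _; rewrite /bump /= exprS; ring.
Qed.

Lemma qnodes_pow k n : (k < n)%N -> qnodes (q ^+ k) n = 0.
Proof.
by move=> kn; rewrite /qnodes (bigD1 (Ordinal kn)) //= subrr mul0r.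
Qed.

(** The nodes t at which the 6phi5 series converges: either its argument g t is
    small, or t = q^k and the series terminates. *)
Definition tame (g s t : C) := `|g * t| <= s \/ exists k, t = q ^+ k.

Lemma tame_mulq g s t : tame g s t -> tame g s (t * q).
Proof.
case=> [h|[k ->]]; [left|by right; exists k.+1; rewrite exprSr].
by rewrite mulrA normrM (le_trans _ h) // ler_piMr // ltW.
Qed.

(** For t = q^k only the n <= k matter, and then |q^k| <= |q^i|; so the same
    product of factors s + 2 |g| |q|^i is a majorant in both cases. *)
Lemma qnodes_bound g s : 0 <= s -> s < 1 ->
  exists M r, [/\ 0 <= r, r < 1 &
    forall t, tame g s t -> geobound M r (fun n => qnodes t n * g ^+ n)].
Proof.
move=> s0 s1; have [|M [r [r0 r1 hM]]] :=
  prod_geo_small geoC s0 s1 (y := 2 * `|g|) _ (normr_ge0 q) q1.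
  by rewrite mulr_ge0.
exists M, r; split=> // t ht n.
have [k0|hn] := pselect (qnodes t n = 0).
  by rewrite k0 mul0r normr0 (le_trans _ (hM n)) // prodr_ge0 // => i _;
    rewrite addr_ge0 ?mulr_ge0 ?exprn_ge0.
apply: le_trans (hM n).
rewrite -[n in g ^+ n]card_ord -prodr_const /qnodes -big_split normr_prod.
apply: ler_prod => i _; rewrite normr_ge0 /= mulrBl.
apply: le_trans (ler_normB _ _) _; rewrite ![_ * g]mulrC.
rewrite [`|g * q ^+ i|]normrM normrX.
case: ht => [ht|[k tk]].
  by rewrite lerD // -mulrA ler_peMl ?mulr_ge0 ?exprn_ge0 // ler1n.
have ik : (i <= k)%N.
  by rewrite leqNgt; apply/negP => ki; apply: hn; rewrite tk qnodes_pow //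
    (ltn_trans ki).
rewrite -[leLHS]add0r lerD // -mulrA mulr_natl mulr2n lerD // tk normrM.
rewrite ler_wpM2l // normrX; exact: ler_wiXn2l (normr_ge0 _) (ltW q1) _ _ ik.
Qed.

Lemma bdd_geo_cvg0 (h k : nat -> C) M r : 0 <= r -> r < 1 ->
  bdd h -> geobound M r k -> (fun n => h n * k n) @ \oo --> (0 : C).
Proof.
move=> r0 r1 [K hK] hk; apply: (@cvg_series_cvg_0 _ C^o).
apply: (geoC (M := K * M) r0 r1) => n; rewrite normrM -mulrA.
by rewrite ler_pM.
Qed.

Variables a b c : C.
Hypotheses (b0 : b != 0) (c0 : c != 0) (a1 : 1 - a != 0).
Local Notation v := (a * q / b).
Local Notation w := (a * q / c).
Local Notation g := (a * q / (b * c)).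
Hypotheses (Pv : P v != 0) (Pw : P w != 0).

Definition vwp6_coef n : C :=
  (1 - a * q ^+ n.*2) / (1 - a) * ([a]_n * [b]_n * [c]_n) /
  ([q]_n * [v]_n * [w]_n).

(** The n-th term of 6phi5 with base a and parameters b, c, 1/t, multiplied by
    P(aqt). *)
Definition vwp6 (t : C) n : C :=
  vwp6_coef n * (qnodes t n * g ^+ n) * P (a * q ^+ n.+1 * t).

Definition vwp6_sum t := csum (vwp6 t).

(** The certificate behind the recurrence t -> tq. *)
Lemma vwp6_telescope t N :
  \sum_(n < N.+1) ((1 - g * t) * vwp6 t n -
                   (1 - v * t) * (1 - w * t) * vwp6 (t * q) n) =
  - (t * g) * (([a]_N.+1 * [b]_N.+1 * [c]_N.+1) / (1 - a) *
     ([q]_N * [v]_N * [w]_N)^-1 * P (a * q ^+ N.+2 * t)) *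
     (qnodes t N * g ^+ N).
Proof.
have Pt n : P (a * q ^+ n * t) = (1 - a * q ^+ n * t) * P (a * q ^+ n.+1 * t).
  rewrite (qinf_S geoC q1); congr (_ * P _); rewrite exprSr; ring.
have Ptq n : P (a * q ^+ n * (t * q)) = P (a * q ^+ n.+1 * t).
  by congr (P _); rewrite exprSr; ring.
elim: N => [|N IH].
  rewrite big_ord1 /vwp6 /vwp6_coef Ptq Pt /qnodes !big_ord0 !qprodS !qprod0.
  move: (P _) => X; rewrite !expr0 !mulr1 expr1.
  by field; rewrite a1 c0 b0.
rewrite big_ord_recr /= {}IH /vwp6 /vwp6_coef Ptq (Pt N.+2) qnodes_mulq qnodesS.
rewrite !(qprodS _ _ N.+1) !(qprodS _ _ N).
have nz x : P x != 0 -> [x]_N != 0 /\ 1 - x * q ^+ N != 0.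
  by move=> /(qprod_neq0 geoC q1 N.+1); rewrite qprodS mulf_eq0 negb_or => /andP.
have [v1 v2] := nz _ Pv; have [w1 w2] := nz _ Pw.
have [z1 z2] := nz _ (qinf_q geoC q1).
have -> : q ^+ N.+1.*2 = (q ^+ N) ^+ 2 * q ^+ 2.
  by rewrite -exprM -exprD; congr (_ ^+ _); lia.
rewrite !exprS in z2 v2 w2 *; rewrite !expr0.
set X := P _; set A := [a]_N; set B := [b]_N; set D := [c]_N.
set Q := [q]_N in z1 *; set V := [v]_N in v1 *; set W := [w]_N in w1 *.
set x := q ^+ N in z2 v2 w2 *; set G := g ^+ N; set T := qnodes t N.
have v3 : b - a * q * x != 0.
  have -> : b - a * q * x = b * (1 - v * x) by field.
  by rewrite mulf_neq0.
have w3 : c - a * q * x != 0.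
  have -> : c - a * q * x = c * (1 - w * x) by field.
  by rewrite mulf_neq0.
by field; rewrite c0 b0 v3 w3 v1 w1 z1 z2.
Qed.

Lemma vwp6_coef_bdd : bdd vwp6_coef.
Proof.
have Pq := qinf_q geoC q1.
have [M hM] : bdd (fun n : nat => (1 - a * q ^+ n.*2) * (1 - a)^-1 *
    ([a]_n * [b]_n * [c]_n) *
    (([q]_n)^-1 * ([v]_n)^-1 * ([w]_n)^-1)).
  by prove_bdd geoC q1.
by exists M => n; rewrite /vwp6_coef !invfM.
Qed.

Lemma vwp6_bound s T : 0 <= s -> s < 1 ->
  exists M r, [/\ 0 <= r, r < 1 &
    forall t, tame g s t -> `|t| <= T -> geobound M r (vwp6 t)].
Proof.
move=> s0 s1; have [M [r [r0 r1 hM]]] := qnodes_bound g s0 s1.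
have [K hK] : bdd (fun it : nat * {t : C | `|t| <= T} =>
    vwp6_coef it.1 * P (a * q ^+ it.1.+1 * sval it.2)).
  apply: bddM; first by have [K hK] := vwp6_coef_bdd; exists K => i; apply: hK.
  apply: (bdd_qinf geoC q1); apply: bddM; last by exists T => -[i [t ht]].
  by apply: bddM; [apply: bdd_cst | apply: (bdd_expq q1)].
exists (K * M), r; split=> // t ht tT n; rewrite /vwp6 mulrAC normrM -[K * M * _]mulrA.
by apply: ler_pM => //; [apply: (hK (n, exist _ t tT)) | apply: hM].
Qed.

Lemma vwp6_cvg s t : 0 <= s -> s < 1 -> tame g s t ->
  series (vwp6 t) @ \oo --> vwp6_sum t.
Proof.
move=> s0 s1 ht; have [M [r [r0 r1 hM]]] := vwp6_bound `|t| s0 s1.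
exact: (csum_cvg geoC r0 r1 (hM t ht (lexx _))).
Qed.

(** The boundary term contains qnodes t N * g^N and tends to 0. *)
Lemma vwp6_sum_rec s t : 0 <= s -> s < 1 -> tame g s t ->
  (1 - g * t) * vwp6_sum t = (1 - v * t) * (1 - w * t) * vwp6_sum (t * q).
Proof.
move=> s0 s1 ht; apply/eqP; rewrite -subr_eq0; apply/eqP.
set k1 := (1 - _) * (1 - _).
have h1 : (fun N => (1 - g * t) * series (vwp6 t) N.+1 -
     k1 * series (vwp6 (t * q)) N.+1) @ \oo -->
    (1 - g * t) * vwp6_sum t - k1 * vwp6_sum (t * q).
  apply: (@cvgB _ C^o); apply: cvgM; try exact: cvg_cst.
    have := vwp6_cvg s0 s1 ht; rewrite -(@cvg_shiftn 1 C^o).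
    by under eq_fun do rewrite addn1.
  have := vwp6_cvg s0 s1 (tame_mulq ht); rewrite -(@cvg_shiftn 1 C^o).
  by under eq_fun do rewrite addn1.
apply: cvgn_uniq h1 _.
have -> : (fun N => (1 - g * t) * series (vwp6 t) N.+1 -
     k1 * series (vwp6 (t * q)) N.+1) = fun N =>
  - (t * g) * (([a]_N.+1 * [b]_N.+1 * [c]_N.+1) / (1 - a) *
     ([q]_N * [v]_N * [w]_N)^-1 * P (a * q ^+ N.+2 * t)) *
     (qnodes t N * g ^+ N).
  by apply/funext => N; rewrite /series /= !mulr_sumr -sumrB big_mkord
    vwp6_telescope.
have [M [r [r0 r1 hM]]] := qnodes_bound g s0 s1.
apply: (bdd_geo_cvg0 r0 r1 _ (hM t ht)).
have Pq := qinf_q geoC q1.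
under eq_fun do rewrite !invfM.
by prove_bdd geoC q1.
Qed.

Lemma qnodes_cvg0 t n :
  qnodes (t * q ^+ N) n @[N --> \oo] --> qnodes 0 n.
Proof.
apply: cvgn_prod => i; apply: (@cvgB _ C^o); last exact: cvg_cst.
exact: (cvg_mulq geoC q1).
Qed.

Lemma vwp6_sum_cvg0 s t : 0 <= s -> s < 1 -> tame g s t ->
  vwp6_sum (t * q ^+ N) @[N --> \oo] --> vwp6_sum 0.
Proof.
move=> s0 s1 ht; have [M [r [r0 r1 hM]]] := vwp6_bound `|t| s0 s1.
have hN N : tame g s (t * q ^+ N).
  elim: N => [|N IH]; first by rewrite expr0 mulr1.
  by rewrite exprSr mulrA; apply: tame_mulq.
apply: (csum_tannery geoC r0 r1 (M := M)) => [N|n].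
  by apply: hM => //; apply: (mulq_bound q1).
rewrite /vwp6 mulr0 (qinf0 geoC q1).
apply: cvgM; first apply: cvgM; first exact: cvg_cst.
  by apply: cvgM; [apply: qnodes_cvg0 | apply: cvg_cst].
under eq_fun do rewrite mulrA.
exact: (qinf_cvg1 geoC q1).
Qed.

Lemma vwp6_sum_one : vwp6_sum 1 = P (a * q).
Proof.
rewrite /vwp6_sum (@csum_finite _ _ 1) => [|n n1].
  rewrite big_ord1 /vwp6 /vwp6_coef /qnodes big_ord0 !qprod0 !expr0 expr1.
  by rewrite !mulr1 invr1 !mulr1 divff // mul1r.
by rewrite /vwp6 -(expr0 q) qnodes_pow // mul0r mulr0 mul0r.
Qed.

(** Climb from t = 1, where the series has a single term, to t = q^k. *)
Lemma vwp6_sum_node k : vwp6_sum (q ^+ k) * ([v]_k * [w]_k) = [g]_k * P (a * q).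
Proof.
elim: k => [|k IH]; first by rewrite !qprod0 expr0 vwp6_sum_one !mulr1 mul1r.
have := @vwp6_sum_rec 0 (q ^+ k) (lexx 0) ltr01 (or_intror (ex_intro _ k erefl)).
rewrite -exprSr !qprodS => h.
transitivity ((1 - v * q ^+ k) * (1 - w * q ^+ k) * vwp6_sum (q ^+ k.+1) *
              ([v]_k * [w]_k)); first by ring.
by rewrite -h -mulrA IH; ring.
Qed.

(** The value at t = 0 is the limit of the values at t = q^k. *)
Lemma vwp6_sum_zero : vwp6_sum 0 * (P v * P w) = P g * P (a * q).
Proof.
apply: cvgn_uniq (_ : (fun k => vwp6_sum (q ^+ k) * ([v]_k * [w]_k)) @ \oo --> _) _.
  apply: cvgM; last by apply: cvgM; apply: (qprod_cvg geoC q1).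
  have := @vwp6_sum_cvg0 0 1 (lexx 0) ltr01.
  under eq_fun do rewrite mul1r.
  by apply; right; exists 0%N; rewrite expr0.
under eq_fun do rewrite vwp6_sum_node.
by apply: cvgM; [apply: (qprod_cvg geoC q1) | apply: cvg_cst].
Qed.

Lemma vwp6_sum_nodeE k : vwp6_sum (q ^+ k) * (P v * P w) =
  [g]_k * (P (v * q ^+ k) * P (w * q ^+ k)) * P (a * q).
Proof.
rewrite (qinf_split geoC q1 v k) (qinf_split geoC q1 w k).
rewrite [RHS]mulrAC -vwp6_sum_node; ring.
Qed.

(** Descend from t to t q^N; the value at 0 fixes the constant. *)
Theorem vwp6_sumE t : `|g * t| < 1 ->
  vwp6_sum t * P (g * t) * (P v * P w) =
  P (v * t) * P (w * t) * (P g * P (a * q)).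
Proof.
move=> gt; have ht : tame g `|g * t| t by left.
have iter N : vwp6_sum t * [g * t]_N = [v * t]_N * [w * t]_N * vwp6_sum (t * q ^+ N).
  elim: N => [|N IH]; first by rewrite !qprod0 expr0 !mulr1 !mul1r.
  have hN : tame g `|g * t| (t * q ^+ N).
    by left; rewrite mulrA (mulq_bound q1).
  have := vwp6_sum_rec (normr_ge0 _) gt hN.
  rewrite -[t * q ^+ N * q]mulrA -exprSr ![_ * (t * q ^+ N)]mulrA => h.
  rewrite !qprodS mulrA IH; transitivity
    ([v * t]_N * [w * t]_N * ((1 - g * t * q ^+ N) * vwp6_sum (t * q ^+ N))).
    by ring.
  by rewrite h; ring.
rewrite -vwp6_sum_zero [RHS]mulrA; congr (_ * _).
have h1 : (fun N => vwp6_sum t * [g * t]_N) @ \oo --> vwp6_sum t * P (g * t).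
  by apply: cvgM; [exact: cvg_cst | apply: (qprod_cvg geoC q1)].
apply: cvgn_uniq h1 _.
under eq_fun do rewrite iter.
apply: cvgM; first by apply: cvgM; apply: (qprod_cvg geoC q1).
exact: vwp6_sum_cvg0 (normr_ge0 _) gt ht.
Qed.

End SixPhiFive.

(** * The nonterminating Watson transformation *)

Section Watson.
Variable C : numClosedFieldType.
Hypothesis geoC : geometric_complete C.
Variable q : C.
Hypothesis q1 : `|q| < 1.
Hypothesis q0 : q != 0.
Local Notation P := (qpoch_inf q).
Local Notation "[ x ]_ n" := (qprod q x n)
  (at level 0, x at level 99, n at level 2, format "[ x ]_ n").

(** Reversal of the order of the factors. *)
Lemma qnodes_shift (y : C) n :
  qnodes q (y * q ^+ n) n = (\prod_(i < n) - q ^+ i) * [y * q]_n.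
Proof.
rewrite /qnodes /qprod [\prod_(i < n) (1 - _)](reindex_inj rev_ord_inj) /=.
rewrite -big_split; apply: eq_bigr => i _ /=.
have -> : q ^+ n = q ^+ i * q * q ^+ (n - i.+1).
  by rewrite -exprSr -exprD; congr (_ ^+ _); rewrite subnKC.
ring.
Qed.

Lemma qnodes_inv (u : C) n : u != 0 -> qnodes q u^-1 n = u ^- n * [u]_n.
Proof.
move=> u0; elim: n => [|n IH].
  by rewrite /qnodes big_ord0 qprod0 expr0 invr1 mulr1.
rewrite qnodesS IH qprodS exprS invfM.
have -> : u^-1 - q ^+ n = u^-1 * (1 - u * q ^+ n) by field.
ring.
Qed.

Definition vwp8 (a b c d e f : C) n : C :=
  (1 - a * q ^+ n.*2) / (1 - a) *
  ([a]_n * [b]_n * [c]_n * [d]_n * [e]_n * [f]_n) /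
  ([q]_n * [a * q / b]_n * [a * q / c]_n * [a * q / d]_n * [a * q / e]_n *
   [a * q / f]_n) *
  (a ^+ 2 * q ^+ 2 / (b * c * d * e * f)) ^+ n.

(** The k-th term of a balanced 4phi3 series, multiplied by the infinite products
    of its denominator parameters. *)
Definition bal43 (y1 y2 y3 y4 x1 x2 x3 : C) k : C :=
  q ^+ k * ([y1]_k * [y2]_k * [y3]_k * [y4]_k) *
  (P (q ^+ k.+1) * P (x1 * q ^+ k) * P (x2 * q ^+ k) * P (x3 * q ^+ k)).

Lemma bal43_cvg y1 y2 y3 y4 x1 x2 x3 :
  cvgn (series (bal43 y1 y2 y3 y4 x1 x2 x3)).
Proof.
have [M hM] : bdd (fun k : nat => ([y1]_k * [y2]_k * [y3]_k * [y4]_k) *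
  (P (q ^+ k.+1) * P (x1 * q ^+ k) * P (x2 * q ^+ k) * P (x3 * q ^+ k))).
  by prove_bdd geoC q1.
apply: (geoC (normr_ge0 q) q1 (M := M)) => k.
by rewrite /bal43 -mulrA normrM normrX mulrC ler_wpM2r ?exprn_ge0.
Qed.

Variables a b c d e f : C.
Hypotheses (a0 : a != 0) (b0 : b != 0) (c0 : c != 0).
Hypotheses (d0 : d != 0) (e0 : e != 0) (f0 : f != 0).
Hypothesis a1 : 1 - a != 0.
Local Notation u := (d * e * f / a).
Local Notation v := (a * q / b).
Local Notation w := (a * q / c).
Local Notation g := (a * q / (b * c)).
Local Notation z := (a ^+ 2 * q ^+ 2 / (b * c * d * e * f)).
Hypotheses (Pv : P v != 0) (Pw : P w != 0).
Hypotheses (Pd : P (a * q / d) != 0) (Pe : P (a * q / e) != 0)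
           (Pf : P (a * q / f) != 0).
Hypothesis z1 : `|z| < 1.

Let vwp6' := vwp6 q a b c.

Lemma vwp8_bound : exists M, geobound M `|z| (vwp8 a b c d e f).
Proof.
have Pq := qinf_q geoC q1.
have [M hM] : bdd (fun n : nat => (1 - a * q ^+ n.*2) * (1 - a)^-1 *
    ([a]_n * [b]_n * [c]_n * [d]_n * [e]_n * [f]_n) *
    (([q]_n)^-1 * ([v]_n)^-1 * ([w]_n)^-1 * ([a * q / d]_n)^-1 *
     ([a * q / e]_n)^-1 * ([a * q / f]_n)^-1)).
  by prove_bdd geoC q1.
exists M => n; rewrite /vwp8 !invfM -!invfM normrM normrX ler_wpM2r ?exprn_ge0 //.
by have := hM n; rewrite -!invfM.
Qed.

(** The summand of the double sum: index n of the very-well-poised series, and the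
    node q^k, respectively (q/u) q^k, of the q-integral. *)
Definition node_term1 n k : C :=
  q ^+ k * ([d]_k * [e]_k * [f]_k * (P (q ^+ k.+1) * P (u * q ^+ k))) *
  vwp6' (q ^+ k) n.

Definition node_term2 n k : C :=
  q ^+ k * ([a * q / (e * f)]_k * [a * q / (d * f)]_k * [a * q / (d * e)]_k *
    (P (q ^+ 2 / u * q ^+ k) * P (q ^+ k.+1))) * vwp6' (q / u * q ^+ k) n.

Lemma u0 : u != 0.
Proof. by rewrite !mulf_neq0 ?invr_eq0. Qed.

Lemma qn0 n : q ^+ n != 0. Proof. by rewrite expf_neq0. Qed.

Let weight n : C := q ^+ n * ([d]_n * [e]_n * [f]_n) * vwp6_coef q a b c n * g ^+ n *
  \prod_(i < n) - q ^+ i.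

(** The q-Saalschuetz sum is used at dq^n, eq^n, fq^n and e := uq^n.  Its k-th
    term sits at the node q^{n+k}: the nodes q^k with k < n contribute 0. *)
Lemma weighted_term1 n k :
  weight n * saalschutz_term q (d * q ^+ n) (e * q ^+ n) (f * q ^+ n) (u * q ^+ n) k =
  P (a * q / (e * f)) * P (a * q / (d * f)) * P (a * q / (d * e)) *
  node_term1 n (n + k).
Proof.
have qn := qn0 n.
rewrite /saalschutz_term /node_term1 /vwp6' /vwp6 /weight.
have -> : d * q ^+ n * q / (u * q ^+ n) = a * q / (e * f).
  by field_nonzero.
have -> : e * q ^+ n * q / (u * q ^+ n) = a * q / (d * f).
  by field_nonzero.
have -> : f * q ^+ n * q / (u * q ^+ n) = a * q / (d * e).
  by field_nonzero.
have -> : d * q ^+ n * (e * q ^+ n) * (f * q ^+ n) * q / (u * q ^+ n) * q ^+ k =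
          a * q ^+ n.+1 * q ^+ (n + k).
  by rewrite exprD exprS; field_nonzero.
have -> : u * q ^+ n * q ^+ k = u * q ^+ (n + k) by rewrite exprD mulrA.
have -> : qnodes q (q ^+ (n + k)) n = (\prod_(i < n) - q ^+ i) * [q ^+ k.+1]_n.
  by rewrite exprSr -qnodes_shift addnC exprD.
rewrite !qprodD (qinf_split geoC q1 (q ^+ k.+1) n) -exprD.
rewrite addSn [(k + n)%N]addnC.
rewrite exprD; ring.
Qed.

Lemma weighted_term2 n k :
  weight n * (q / (u * q ^+ n) *
    saalschutz_term q (d * q ^+ n * q / (u * q ^+ n)) (e * q ^+ n * q / (u * q ^+ n))
      (f * q ^+ n * q / (u * q ^+ n)) (q ^+ 2 / (u * q ^+ n)) k) =
  q / u * (P d * P e * P f) * node_term2 n k.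
Proof.
have qn := qn0 n.
rewrite /saalschutz_term /node_term2 /vwp6' /vwp6 /weight.
have E x : x * q ^+ n * q / (u * q ^+ n) * q / (q ^+ 2 / (u * q ^+ n)) = x * q ^+ n.
  by field_nonzero.
rewrite !E.
have -> : d * q ^+ n * q / (u * q ^+ n) * (e * q ^+ n * q / (u * q ^+ n)) *
   (f * q ^+ n * q / (u * q ^+ n)) * q / (q ^+ 2 / (u * q ^+ n)) * q ^+ k =
    a * q ^+ n.+1 * (q / u * q ^+ k).
  by rewrite (exprS q n); field_nonzero.
have -> : d * q ^+ n * q / (u * q ^+ n) = a * q / (e * f).
  by field_nonzero.
have -> : e * q ^+ n * q / (u * q ^+ n) = a * q / (d * f).
  by field_nonzero.
have -> : f * q ^+ n * q / (u * q ^+ n) = a * q / (d * e).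
  by field_nonzero.
have Eq : q / u * q ^+ k = q / u * q ^+ k / q ^+ n * q ^+ n by field_nonzero.
have -> : qnodes q (q / u * q ^+ k) n =
    (\prod_(i < n) - q ^+ i) * [q ^+ 2 / (u * q ^+ n) * q ^+ k]_n.
  rewrite Eq qnodes_shift; congr (_ * qprod q _ n).
  by field_nonzero.
rewrite (qinf_split geoC q1 (q ^+ 2 / (u * q ^+ n) * q ^+ k) n).
have -> : q ^+ 2 / (u * q ^+ n) * q ^+ k * q ^+ n = q ^+ 2 / u * q ^+ k.
  by field_nonzero.
rewrite (qinf_split geoC q1 d n) (qinf_split geoC q1 e n) (qinf_split geoC q1 f n).
have -> : q / (u * q ^+ n) = q / u / q ^+ n.
  by field_nonzero.
move: (g ^+ n) (vwp6_coef _ _ _ _ n) (\prod_(i < n) - q ^+ i) => G W S.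
set p1 := P _; set p2 := P _; set p3 := P _; set p4 := P _; set p5 := P _;
  set p6 := P _; set m1 := [_]_n; set m2 := [_]_n; set m3 := [_]_n;
  set m4 := [_]_n; set m5 := [_]_k; set m6 := [_]_k; set m7 := [_]_k.
by field_nonzero.
Qed.

Lemma weighted_product n :
  weight n * (P q * P (u * q ^+ n) * P (q / (u * q ^+ n)) *
    (P (e * q ^+ n * (f * q ^+ n) * q / (u * q ^+ n)) *
     P (d * q ^+ n * (f * q ^+ n) * q / (u * q ^+ n)) *
     P (d * q ^+ n * (e * q ^+ n) * q / (u * q ^+ n)))) =
  P q * P u * P (q / u) * (P (a * q / d) * P (a * q / e) * P (a * q / f)) *
  vwp8 a b c d e f n.
Proof.
have qn := qn0 n.
have -> : e * q ^+ n * (f * q ^+ n) * q / (u * q ^+ n) = a * q / d * q ^+ n.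
  by field_nonzero.
have -> : d * q ^+ n * (f * q ^+ n) * q / (u * q ^+ n) = a * q / e * q ^+ n.
  by field_nonzero.
have -> : d * q ^+ n * (e * q ^+ n) * q / (u * q ^+ n) = a * q / f * q ^+ n.
  by field_nonzero.
have hs : (\prod_(i < n) - q ^+ i) * [q / (u * q ^+ n)]_n = u ^- n * [u]_n.
  rewrite -qnodes_inv ?u0 //.
  have -> : q / (u * q ^+ n) = (u * q ^+ n)^-1 * q by rewrite mulrC.
  rewrite -qnodes_shift; congr (qnodes q _ n).
  by field_nonzero.
rewrite (qinf_split geoC q1 (q / (u * q ^+ n)) n).
have -> : q / (u * q ^+ n) * q ^+ n = q / u.
  by field_nonzero.
rewrite (qinf_split geoC q1 u n) (qinf_split geoC q1 (a * q / d) n)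
  (qinf_split geoC q1 (a * q / e) n) (qinf_split geoC q1 (a * q / f) n).
have nd := qprod_neq0 geoC q1 n Pd.
have ne := qprod_neq0 geoC q1 n Pe.
have nf := qprod_neq0 geoC q1 n Pf.
have nv := qprod_neq0 geoC q1 n Pv.
have nw := qprod_neq0 geoC q1 n Pw.
have nq := qprod_neq0 geoC q1 n (qinf_q geoC q1).
rewrite /weight /vwp8 /vwp6_coef.
have -> : z ^+ n = g ^+ n * q ^+ n * u ^- n.
  rewrite -exprVn -!exprMn; congr (_ ^+ n).
  by field_nonzero.
set L := (X in X = _).
have -> : L = ((\prod_(i < n) - q ^+ i) * [q / (u * q ^+ n)]_n) *
    (q ^+ n * ([d]_n * [e]_n * [f]_n) *
     ((1 - a * q ^+ n.*2) / (1 - a) * ([a]_n * [b]_n * [c]_n) /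
      ([q]_n * [v]_n * [w]_n)) * g ^+ n *
     (P q * P (u * q ^+ n) * P (q / u) * (P (a * q / d * q ^+ n) *
       P (a * q / e * q ^+ n) * P (a * q / f * q ^+ n)))).
  rewrite /L; ring.
rewrite hs.
set m1 := [d]_n; set m2 := [e]_n; set m3 := [f]_n; set m4 := [a]_n;
  set m5 := [b]_n; set m6 := [c]_n; set m7 := [u]_n.
set p1 := P q; set p2 := P (u * _); set p3 := P (q / u); set p4 := P _;
  set p5 := P (a * q / e * _); set p6 := P _.
move: nd ne nf nv nw nq.
move: [a * q / d]_n [a * q / e]_n [a * q / f]_n [v]_n [w]_n [q]_n.
move=> n1 n2 n3 n4 n5 n6 h1 h2 h3 h4 h5 h6.
by field; rewrite expf_neq0 ?u0 // h1 h2 h3 h4 h5 h6 a1.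
Qed.

Lemma node_term_bound : exists M r, [/\ 0 <= r, r < 1 &
  forall n k, `|node_term1 n k| <= M * r ^+ n * `|q| ^+ k /\
              `|node_term2 n k| <= M * r ^+ n * `|q| ^+ k].
Proof.
have [M [r [r0 r1 hM]]] := @vwp6_bound _ geoC q q1 a b c Pv Pw `|z|
  (1 + `|q / u|) (normr_ge0 _) z1.
have M0 : 0 <= M.
  apply: (geobound_ge0 (hM 1 _ _)); first by right; exists 0%N.
  by rewrite normr1 lerDl.
have [K1 hK1] : bdd (fun k : nat => [d]_k * [e]_k * [f]_k *
    (P (q ^+ k.+1) * P (u * q ^+ k))) by prove_bdd geoC q1.
have [K2 hK2] : bdd (fun k : nat => [a * q / (e * f)]_k *
    [a * q / (d * f)]_k * [a * q / (d * e)]_k *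
    (P (q ^+ 2 / u * q ^+ k) * P (q ^+ k.+1))) by prove_bdd geoC q1.
have K10 : 0 <= K1 by apply: le_trans (hK1 0%N).
have K20 : 0 <= K2 by apply: le_trans (hK2 0%N).
have aux K x y n k : 0 <= K -> `|x| <= K -> `|y| <= M * r ^+ n ->
    `|q ^+ k * x * y| <= K * M * r ^+ n * `|q| ^+ k.
  move=> K0 hx hy; rewrite -mulrA mulrC normrM normrX ler_wpM2r ?exprn_ge0 //.
  by rewrite normrM -mulrA ler_pM.
exists ((K1 + K2) * M), r; split=> // n k; split.
  apply: le_trans (aux K1 _ _ _ _ K10 (hK1 k) (hM _ _ _ n)) _.
  - by right; exists k.
  - by rewrite normrX (le_trans (exprn_ile1 _ (normr_ge0 _) (ltW q1))) // lerDl.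
  - by rewrite !ler_wpM2r ?exprn_ge0 // lerDl.
apply: le_trans (aux K2 _ _ _ _ K20 (hK2 k) (hM _ _ _ n)) _.
- left; rewrite mulrA; apply: le_trans (mulq_bound q1 _ _) _.
  rewrite le_eqVlt; apply/orP; left; apply/eqP; congr (`|_|).
  by field_nonzero.
- by apply: le_trans (mulq_bound q1 _ _) _; rewrite lerDr.
- by rewrite !ler_wpM2r ?exprn_ge0 // lerDr.
Qed.

(** Sum [weighted_product] over n through the q-Saalschuetz sum, exchange the sums,
    and evaluate the sums over n at each node by the 6phi5 sum.  At the nodes q^k
    the series terminates, at (q/u) q^k its argument is a^2 q^2 / (bcdef) * q^k. *)
Theorem watson_nonterminating :
  cvgn (series (vwp8 a b c d e f)) /\
  P q * P u * P (q / u) * (P (a * q / d) * P (a * q / e) * P (a * q / f)) *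
    csum (vwp8 a b c d e f) * (P v * P w) * P z =
  P (a * q) *
   (P z * (P (a * q / (e * f)) * P (a * q / (d * f)) * P (a * q / (d * e))) *
      csum (bal43 d e f g u v w) -
    q / u * (P d * P e * P f * P g) *
      csum (bal43 (a * q / (e * f)) (a * q / (d * f)) (a * q / (d * e)) z
                 (q ^+ 2 / u) (v * (q / u)) (w * (q / u)))).
Proof.
split; first by have [W hW] := vwp8_bound; apply: geoC hW.
have [M [r [r0 r1 hM]]] := node_term_bound.
have b1 n : geobound (M * r ^+ n) `|q| (node_term1 n) by move=> k; case: (hM n k).
have b2 n : geobound (M * r ^+ n) `|q| (node_term2 n) by move=> k; case: (hM n k).
have cv1 n := geoC (normr_ge0 q) q1 (b1 n).
have cv2 n := geoC (normr_ge0 q) q1 (b2 n).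
set Y := P (a * q / (e * f)) * _ * _.
set X := q / u * (P d * P e * P f).
set K := P q * P u * P (q / u) * _.
have h1 n : csum (fun k => weight n *
    saalschutz_term q (d * q ^+ n) (e * q ^+ n) (f * q ^+ n) (u * q ^+ n) k) =
    Y * csum (node_term1 n).
  rewrite (@csum_shift _ (node_term1 n) n) => [|k kn]; last first.
    by rewrite /node_term1 /vwp6' /vwp6 qnodes_pow // mul0r mulr0 mul0r mulr0.
  rewrite -csumZ; last first.
    apply: (geoC (normr_ge0 q) q1 (M := M * r ^+ n)) => k.
    apply: le_trans (b1 n _) _.
    rewrite ler_wpM2l ?(geobound_ge0 (b1 n)) //.
    by rewrite exprD ler_piMl ?exprn_ge0 // exprn_ile1 // ltW.
  by apply: csum_eq => k; rewrite weighted_term1.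
have claim n : K * vwp8 a b c d e f n =
    Y * csum (node_term1 n) - X * csum (node_term2 n).
  have une : u * q ^+ n != 0 by rewrite mulf_neq0 ?u0 ?qn0.
  rewrite -weighted_product -(@saalschutz_nonterminating _ geoC _ q1) //.
  rewrite /saalschutz_pair mulrBr -h1 csumZ; last exact: (saalschutz_cvg geoC q1).
  congr (_ - _); rewrite -csumZ // mulrA.
  rewrite -csumZ; last exact: (saalschutz_cvg geoC q1).
  by apply: csum_eq => k; rewrite -[LHS]mulrA weighted_term2.
have cvs (t : nat -> nat -> C) :
    (forall n k, `|t n k| <= M * r ^+ n * `|q| ^+ k) ->
    cvgn (series (fun k => csum (fun n => t n k))) /\
    cvgn (series (fun n => csum (t n))).
  move=> ht; split.
    apply: (geoC (normr_ge0 q) q1 (M := M / (1 - r))) => k.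
    have gk : geobound (M * `|q| ^+ k) r (fun n => t n k).
      by move=> n; rewrite mulrAC.
    by rewrite mulrAC; apply: csum_norm_le gk.
  apply: (geoC r0 r1 (M := M / (1 - `|q|))) => n.
  by rewrite mulrAC; apply: (csum_norm_le geoC (normr_ge0 q) q1 (ht n)).
have hM1 n k : `|node_term1 n k| <= M * r ^+ n * `|q| ^+ k by case: (hM n k).
have hM2 n k : `|node_term2 n k| <= M * r ^+ n * `|q| ^+ k by case: (hM n k).
have [c1 c1'] := cvs _ hM1; have [c2 c2'] := cvs _ hM2.
have e1 : P v * P w * csum (fun n => csum (node_term1 n)) =
    P (a * q) * csum (bal43 d e f g u v w).
  rewrite (csum_exchange geoC r0 r1 (normr_ge0 q) q1 hM1) -!csumZ //;
    last exact: bal43_cvg.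
  apply: csum_eq => k; rewrite /node_term1 csumZ; last first.
    by apply: (vwp6_cvg geoC q1 Pv Pw (lexx 0) ltr01 (t := q ^+ k)); right; exists k.
  have := vwp6_sum_nodeE geoC q1 b0 c0 a1 Pv Pw k; rewrite /vwp6_sum -/vwp6' => h.
  rewrite mulrCA [P v * P w * _]mulrC h /bal43; ring.
have gt k : g * (q / u * q ^+ k) = z * q ^+ k.
  by field_nonzero.
have gt1 k : `|g * (q / u * q ^+ k)| < 1.
  by rewrite gt; apply: le_lt_trans (mulq_bound q1 _ _) z1.
have e2 : P v * P w * P z * csum (fun n => csum (node_term2 n)) =
    P (a * q) * P g *
    csum (bal43 (a * q / (e * f)) (a * q / (d * f)) (a * q / (d * e)) z
                 (q ^+ 2 / u) (v * (q / u)) (w * (q / u))).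
  rewrite (csum_exchange geoC r0 r1 (normr_ge0 q) q1 hM2) -!csumZ //;
    last exact: bal43_cvg.
  apply: csum_eq => k; rewrite /node_term2 csumZ; last first.
    by apply: (vwp6_cvg geoC q1 Pv Pw (normr_ge0 _) (gt1 k)); left.
  have := vwp6_sumE geoC q1 b0 c0 a1 Pv Pw (gt1 k).
  rewrite /vwp6_sum -/vwp6' gt (qinf_split geoC q1 z k) /bal43 => h.
  set s := csum _ in h *; rewrite -2!mulrA.
  transitivity ([z]_k * q ^+ k * ([a * q / (e * f)]_k * [a * q / (d * f)]_k *
     [a * q / (d * e)]_k * (P (q ^+ 2 / u * q ^+ k) * P (q ^+ k.+1))) *
     (s * P (z * q ^+ k) * (P v * P w))); first by ring.
  by rewrite h -![_ * (q / u) * q ^+ k]mulrA; ring.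
have e3 : K * csum (vwp8 a b c d e f) =
    Y * csum (fun n => csum (node_term1 n)) - X * csum (fun n => csum (node_term2 n)).
  rewrite -!csumZ //; last by have [W hW] := vwp8_bound; apply: geoC hW.
  rewrite -csumB; last 2 first.
  - exact: cvgn_seriesZ.
  - exact: cvgn_seriesZ.
  by apply: csum_eq => n; rewrite claim.
rewrite e3; transitivity (Y * P z * (P v * P w * csum (fun n => csum (node_term1 n)))
   - X * (P v * P w * P z * csum (fun n => csum (node_term2 n)))); first by ring.
by rewrite e1 e2 /Y /X; ring.
Qed.

End Watson.

(** * Bailey's three-term relation *)

Section ThreeTerm.
Variable C : numClosedFieldType.
Hypothesis geoC : geometric_complete C.
Variable q : C.
Hypothesis q1 : `|q| < 1.
Hypothesis q0 : q != 0.
Local Notation P := (qpoch_inf q).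
Local Notation "[ x ]_ n" := (qprod q x n)
  (at level 0, x at level 99, n at level 2, format "[ x ]_ n").
Local Notation W := (vwp8 q).

Lemma bal43_sym12 y1 y2 y3 y4 x1 x2 x3 :
  csum (bal43 q y1 y2 y3 y4 x1 x2 x3) = csum (bal43 q y1 y2 y3 y4 x2 x1 x3).
Proof. by apply: csum_eq => k; rewrite /bal43; ring. Qed.

Lemma bal43_sym14 y1 y2 y3 y4 x1 x2 x3 :
  csum (bal43 q y1 y2 y3 y4 x1 x2 x3) = csum (bal43 q y4 y2 y3 y1 x1 x2 x3).
Proof. by apply: csum_eq => k; rewrite /bal43; ring. Qed.

(** Three instances of Watson's transformation involve only three balanced series
    s1, s2, s3, one for each of the endpoints 1, q/u, q/v; eliminating s1 and s2
    makes s3 cancel. *)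
Theorem bailey_three_term (a b c d e f : C) :
  a != 0 -> b != 0 -> c != 0 -> d != 0 -> e != 0 -> f != 0 ->
  1 - a != 0 -> 1 - e * f / c != 0 -> 1 - b ^+ 2 / a != 0 ->
  P (a * q / b) != 0 -> P (a * q / c) != 0 -> P (a * q / d) != 0 ->
  P (a * q / e) != 0 -> P (a * q / f) != 0 ->
  P (b * e * f / a) != 0 -> P (f * q / c) != 0 -> P (e * q / c) != 0 ->
  P (b * q / a) != 0 -> P (b * q / c) != 0 -> P (b * q / d) != 0 ->
  P (b * q / e) != 0 -> P (b * q / f) != 0 ->
  P (d * e * f / a) != 0 -> P (a * q / (d * e * f)) != 0 ->
  P (q / c) != 0 -> P (b * e / a) != 0 -> P (b * f / a) != 0 ->
  P (e * f * q / c) != 0 -> P (b ^+ 2 * q / a) != 0 ->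
  `|b * d / a| < 1 -> `|a ^+ 2 * q ^+ 2 / (b * c * d * e * f)| < 1 ->
  [/\ cvgn (series (W a b c d e f)),
      cvgn (series (W (e * f / c) (a * q / (c * d)) (e * f / a) (a * q / (b * c))
                      e f)),
      cvgn (series (W (b ^+ 2 / a) b (b * c / a) (b * d / a) (b * e / a)
                      (b * f / a))) &
  csum (W a b c d e f) =
  (P (a * q) * P (a * q / (d * e)) * P (a * q / (d * f)) *
   P (a * q / (e * f)) * P (e * q / c) * P (f * q / c) * P (b / a) *
   P (b * e * f / a)) /
  (P (a * q / d) * P (a * q / e) * P (a * q / f) * P (a * q / (d * e * f)) *
   P (q / c) * P (e * f * q / c) * P (b * e / a) * P (b * f / a)) *
  csum (W (e * f / c) (a * q / (c * d)) (e * f / a) (a * q / (b * c)) e f) +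
  b / a *
  ((P (a * q) * P (b * q / a) * P (b * q / c) * P (b * q / d) *
    P (b * q / e) * P (b * q / f) * P d * P e * P f * P (a * q / (b * c)) *
    P (b * d * e * f / a ^+ 2) * P (a ^+ 2 * q / (b * d * e * f))) /
   (P (a * q / b) * P (a * q / c) * P (a * q / d) * P (a * q / e) *
    P (a * q / f) * P (b * d / a) * P (b * e / a) * P (b * f / a) *
    P (d * e * f / a) * P (a * q / (d * e * f)) * P (q / c) *
    P (b ^+ 2 * q / a))) *
  csum (W (b ^+ 2 / a) b (b * c / a) (b * d / a) (b * e / a) (b * f / a))].
Proof.
move=> a0 b0 c0 d0 e0 f0 a1 a1' a1'' hab hac had hae haf hbef hfc hec
  hba hbc hbd hbe hbf hdef hadef hqc hbea hbfa hefc hb2 z1' z1.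
have zbd := qinf_small geoC q1 z1'; have zz := qinf_small geoC q1 z1.
have dn x y : x != 0 -> y != 0 -> x / y != 0 :> C.
  by move=> x0 y0; rewrite mulf_neq0 ?invr_eq0.
have [cv1 h1] := watson_nonterminating geoC q1 q0 a0 b0 c0 d0 e0 f0 a1
  hab hac had hae haf z1.
have := watson_nonterminating geoC q1 q0
  (a := e * f / c) (b := a * q / (c * d)) (c := e * f / a)
  (d := a * q / (b * c)) (e := e) (f := f).
have := watson_nonterminating geoC q1 q0
  (a := b ^+ 2 / a) (b := b) (c := b * c / a)
  (d := b * d / a) (e := b * e / a) (f := b * f / a).
have -> : b ^+ 2 / a * q / b = b * q / a by field_nonzero.
have -> : b ^+ 2 / a * q / (b * c / a) = b * q / c by field_nonzero.
have -> : b ^+ 2 / a * q / (b * d / a) = b * q / d by field_nonzero.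
have -> : b ^+ 2 / a * q / (b * e / a) = b * q / e by field_nonzero.
have -> : b ^+ 2 / a * q / (b * f / a) = b * q / f by field_nonzero.
have -> : b * d / a * (b * e / a) * (b * f / a) / (b ^+ 2 / a) =
  b * d * e * f / a ^+ 2 by field_nonzero.
have -> : b ^+ 2 / a * q / (b * (b * c / a)) = q / c by field_nonzero.
have -> : (b ^+ 2 / a) ^+ 2 * q ^+ 2 /
   (b * (b * c / a) * (b * d / a) * (b * e / a) * (b * f / a)) =
   a ^+ 2 * q ^+ 2 / (b * c * d * e * f) by field_nonzero.
have -> : b ^+ 2 / a * q / (b * e / a * (b * f / a)) = a * q / (e * f)
  by field_nonzero.
have -> : b ^+ 2 / a * q / (b * d / a * (b * f / a)) = a * q / (d * f)
  by field_nonzero.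
have -> : b ^+ 2 / a * q / (b * d / a * (b * e / a)) = a * q / (d * e)
  by field_nonzero.
have -> : q / (b * d * e * f / a ^+ 2) = a ^+ 2 * q / (b * d * e * f)
  by field_nonzero.
have -> : q ^+ 2 / (b * d * e * f / a ^+ 2) = a * q / b * (q / (d * e * f / a))
  by field_nonzero.
have -> : b * q / a * (a ^+ 2 * q / (b * d * e * f)) = q ^+ 2 / (d * e * f / a)
  by field_nonzero.
have -> : b * q / c * (a ^+ 2 * q / (b * d * e * f)) =
   a * q / c * (q / (d * e * f / a)) by field_nonzero.
have -> : b ^+ 2 / a * q = b ^+ 2 * q / a by field_nonzero.
move=> /(_ (dn _ _ (expf_neq0 2 b0) a0) b0 (dn _ _ (mulf_neq0 b0 c0) a0)
  (dn _ _ (mulf_neq0 b0 d0) a0) (dn _ _ (mulf_neq0 b0 e0) a0)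
  (dn _ _ (mulf_neq0 b0 f0) a0) a1'' hba hbc hbd hbe hbf z1) [cv2 h2].
have -> : e * f / c * q / (a * q / (c * d)) = d * e * f / a by field_nonzero.
have -> : e * f / c * q / (e * f / a) = a * q / c by field_nonzero.
have -> : e * f / c * q / (a * q / (b * c)) = b * e * f / a by field_nonzero.
have -> : e * f / c * q / e = f * q / c by field_nonzero.
have -> : e * f / c * q / f = e * q / c by field_nonzero.
have -> : (e * f / c) ^+ 2 * q ^+ 2 /
  (a * q / (c * d) * (e * f / a) * (a * q / (b * c)) * e * f) = b * d / a by field_nonzero.
have -> : a * q / (b * c) * e * f / (e * f / c) = a * q / b by field_nonzero.
have -> : e * f / c * q / (e * f) = q / c by field_nonzero.
have -> : e * f / c * q / (a * q / (b * c) * f) = b * e / a by field_nonzero.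
have -> : e * f / c * q / (a * q / (b * c) * e) = b * f / a by field_nonzero.
have -> : e * f / c * q / (a * q / (c * d) * (e * f / a)) = d by field_nonzero.
have -> : q / (a * q / b) = b / a by field_nonzero.
have -> : q ^+ 2 / (a * q / b) = b * q / a by field_nonzero.
have -> : d * e * f / a * (b / a) = b * d * e * f / a ^+ 2 by field_nonzero.
have -> : a * q / c * (b / a) = b * q / c by field_nonzero.
have -> : e * f / c * q = e * f * q / c by field_nonzero.
move=> /(_ (dn _ _ (mulf_neq0 e0 f0) c0)
  (dn _ _ (mulf_neq0 a0 q0) (mulf_neq0 c0 d0)) (dn _ _ (mulf_neq0 e0 f0) a0)
  (dn _ _ (mulf_neq0 a0 q0) (mulf_neq0 b0 c0)) e0 f0 a1' hdef hac hbef hfc hec z1') [cv3 h3].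
rewrite (bal43_sym12 (a * q / (e * f))) in h2.
rewrite (bal43_sym14 (a * q / (b * c))) (bal43_sym12 d) (bal43_sym14 (q / c))
  (bal43_sym12 (b * d / a)) in h3.
have hU : q / (d * e * f / a) = a * q / (d * e * f).
  by field_nonzero.
rewrite hU in h1 h2.
move: h1 h2 h3 (qinf_q geoC q1); move: zbd zz hb2 hefc hbfa hbea hqc hadef hdef.
move: hbf hbe hbd hbc hba hec hfc hbef haf hae had hac hab.
set w1 := csum (W a b c d e f); set w2 := csum (W (e * f / c) _ _ _ _ _).
set w3 := csum (W (b ^+ 2 / a) _ _ _ _ _).
set s1 := csum (bal43 q d _ _ _ _ _ _).
set s2 := csum (bal43 q (a * q / (e * f)) _ _ _ _ _ _).
set s3 := csum (bal43 q (b * d / a) _ _ _ _ _ _).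
move: w1 w2 w3 s1 s2 s3 => w1 w2 w3 s1 s2 s3.
move: (P (a * q / b)) (P (a * q / c)) (P (a * q / d)) (P (a * q / e))
  (P (a * q / f)) (P (b * e * f / a)) (P (f * q / c)) (P (e * q / c))
  (P (b * q / a)) (P (b * q / c)) (P (b * q / d)) (P (b * q / e))
  (P (b * q / f)) (P (d * e * f / a)) (P (a * q / (d * e * f))) (P (q / c))
  (P (b * e / a)) (P (b * f / a)) (P (e * f * q / c)) (P (b ^+ 2 * q / a))
  (P (a ^+ 2 * q ^+ 2 / (b * c * d * e * f))) (P (b * d / a)) (P q)
  => pab pac pad pae paf pbef pfc pec pba pbc pbd pbe pbf pu pu' pqc pbea pbfa
     pefc pb2 pz pbda pq.
move=> hbf hbe hbd hbc hba hec hfc hbef haf hae had hac hab hbda hz hb2 hefc hbfa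
  hbea hqc hu' hu h1 h2 h3 hq.
have E0 : w1 = P (a * q) * (pz * (P (a * q / (e * f)) * P (a * q / (d * f)) *
    P (a * q / (d * e))) * s1 - a * q / (d * e * f) * (P d * P e * P f *
    P (a * q / (b * c))) * s2) / (pq * pu * pu' * (pad * pae * paf) *
    (pab * pac) * pz).
  by rewrite -h1; field; rewrite hz hac hab haf hae had hu' hu hq.
have E1 : s1 = (pq * pab * P (b / a) * (pbef * pfc * pec) * w2 * (pu * pac) *
    pbda / pefc + b / a * (P (a * q / (b * c)) * P e * P f * P d) * s3) /
    (pbda * (pqc * pbea * pbfa)).
  by rewrite h3; field; rewrite hbda hqc hbea hbfa hefc a0.
have E2 : s2 = (pz * (P (a * q / (e * f)) * P (a * q / (d * f)) *
    P (a * q / (d * e))) * s3 - pq * P (b * d * e * f / a ^+ 2) *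
    P (a ^+ 2 * q / (b * d * e * f)) * (pbd * pbe * pbf) * w3 * (pba * pbc) *
    pz / pb2) / (a ^+ 2 * q / (b * d * e * f) * (pbda * pbea * pbfa * pqc)).
  by rewrite h2; field; rewrite hbda hqc hbea hbfa hb2 a0 b0 d0 e0 f0 q0.
split=> //; rewrite E0 E1 E2; field.
by rewrite hbda hqc hbea hbfa hb2 hefc hz hac hab haf hae had hu' hu hq a0 b0 d0 e0 f0 q0.
Qed.

End ThreeTerm.

(** * Shifting the summation index by m *)

Section Shift.
Variable C : numClosedFieldType.
Hypothesis geoC : geometric_complete C.
Variable q : C.
Hypothesis q1 : `|q| < 1.
Hypothesis q0 : q != 0.
Local Notation P := (qpoch_inf q).
Local Notation "[ x ]_ n" := (qprod q x n)
  (at level 0, x at level 99, n at level 2, format "[ x ]_ n").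
Local Notation W := (vwp8 q).

(** Here y itself depends on n; the base point y q^{n-m} is what stays fixed. *)
Lemma qpoch_shiftl (y : C) m n : [y * q ^ (n%:Z - m%:Z)]_m != 0 ->
  qpoch q y (n%:Z - m%:Z) = [y]_n / [y * q ^ (n%:Z - m%:Z)]_m.
Proof.
case: (leqP m n) => mn.
  rewrite subzn // => h; rewrite -[n in [y]_n](subnK mn) qprodD.
  by rewrite -exprnP in h *; rewrite mulfK.
have -> : n%:Z - m%:Z = Negz (m - n).-1.
  by rewrite NegzE prednK ?subn_gt0 // -opprB subzn // ltnW.
set x := y * _ => h /=; rewrite -/x prednK ?subn_gt0 //.
have xy : x * q ^+ (m - n) = y.
  rewrite /x NegzE prednK ?subn_gt0 // -mulrA -exprnN mulVf ?mulr1 //.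
  by rewrite expf_neq0.
have e : [x]_m = [x]_(m - n) * [y]_n by rewrite -xy -qprodD subnK // ltnW.
by move: h; rewrite e mulf_eq0 negb_or => /andP [h1 h2]; field; rewrite h1 h2.
Qed.

Variable m : nat.
Local Notation Q := (q ^+ m).

Lemma Q_neq0 : Q != 0. Proof. by rewrite expf_neq0. Qed.

Lemma qpoch_wdN x : qpoch_wd q x (- m%:Z) = ([x / Q]_m != 0).
Proof.
by rewrite /qpoch_wd; case: m => [|k] //=; rewrite qprod0 oner_neq0.
Qed.

Lemma qpoch_shift x n : [x / Q]_m != 0 ->
  qpoch q x (n%:Z - m%:Z) = [x / Q]_n / [x / Q]_m.
Proof.
move=> h; case: (leqP m n) => mn.
  rewrite subzn //= -[n in RHS](subnKC mn) qprodD divfK ?Q_neq0 //.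
  by rewrite mulrAC divff // mul1r.
have -> : n%:Z - m%:Z = Negz (m - n).-1.
  by rewrite NegzE prednK ?subn_gt0 // -opprB subzn // ltnW.
rewrite /= NegzE prednK ?subn_gt0 //.
have -> : q ^ (- (m - n)%:Z) = q ^+ n / Q.
  by rewrite -exprnN -[m in _ / q ^+ m](subnK (ltnW mn)) exprD; field;
    rewrite !expf_neq0.
have e : [x / Q]_m = [x / Q]_n * [x * (q ^+ n / Q)]_(m - n).
  have -> : x * (q ^+ n / Q) = x / Q * q ^+ n by ring.
  by rewrite -qprodD subnKC // ltnW.
move: h; rewrite e mulf_eq0 negb_or => /andP [h1 h2]; field.
by rewrite h1 h2.
Qed.

Lemma qpoch_N x : [x / Q]_m != 0 -> qpoch q x (- m%:Z) = ([x / Q]_m)^-1.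
Proof. by move=> /(qpoch_shift 0); rewrite sub0r qprod0 mul1r. Qed.

(** Well-definedness of the stacked fractions at all k >= -m says that no factor of
    the infinite product vanishes. *)
Lemma qinf_wd y : (forall k : int, - m%:Z <= k ->
    qpoch_wd q y k && (qpoch q y k != 0)) -> P (y / Q) != 0.
Proof.
move=> h; apply: (qinf_neq0 geoC q1) => n.
have := h (- m%:Z) (lexx _); rewrite qpoch_wdN => /andP [h0 _].
have [|_] := andP (h (n%:Z - m%:Z) _); first by rewrite lerDr.
by rewrite qpoch_shift // mulf_eq0 negb_or => /andP [].
Qed.

Lemma qfrac_shift r n : qfrac_wd q r (- m%:Z) ->
  qfrac q r (n%:Z - m%:Z) = qfrac q r (- m%:Z) *
    ((\prod_(x <- r.1) [x / Q]_n) / (\prod_(y <- r.2) [y / Q]_n)).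
Proof.
case: r => xs ys /andP [/= hx hy].
rewrite /qfrac /= mulrACA -invfM; congr (_ / _).
  elim: xs hx => [|x xs IH] /=; first by rewrite !big_nil mulr1.
  rewrite qpoch_wdN !big_cons => /andP [h1 /IH ->].
  by rewrite qpoch_shift // qpoch_N //; ring.
elim: ys hy => [|y ys IH] /=; first by rewrite !big_nil mulr1.
rewrite qpoch_wdN !big_cons => /andP [/andP [h1 _] /IH ->].
by rewrite qpoch_shift // qpoch_N //; ring.
Qed.

Lemma very_well_poised (x : C) n : 1 - x ^+ 2 != 0 -> [x]_n != 0 -> [- x]_n != 0 ->
  [q * x]_n * [- (q * x)]_n / ([x]_n * [- x]_n) =
  (1 - x ^+ 2 * q ^+ n.*2) / (1 - x ^+ 2).
Proof.
move=> x1 h1 h2.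
have e y : (1 - y) * [q * y]_n = [y]_n * (1 - y * q ^+ n).
  by rewrite mulrC [q * y]mulrC mulrC -qprodSl qprodS.
have e1 := e x; have e2 := e (- x); rewrite mulrN in e2.
have -> : q ^+ n.*2 = q ^+ n * q ^+ n by rewrite -exprD addnn.
have -> : 1 - x ^+ 2 * (q ^+ n * q ^+ n) = (1 - x * q ^+ n) * (1 - - x * q ^+ n).
  by ring.
apply/eqP; rewrite eqr_div // ?mulf_neq0 //; apply/eqP.
transitivity (((1 - x) * [q * x]_n) * ((1 - - x) * [- (q * x)]_n)); first by ring.
by rewrite e1 e2; ring.
Qed.

Lemma qprod_rev (y : C) : y != 0 ->
  [y / Q]_m = y ^+ m * (\prod_(i < m) - q ^- i.+1) * [q / y]_m.
Proof.
move=> y0; rewrite /qprod (reindex_inj rev_ord_inj) /=.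
rewrite -[m in y ^+ m]card_ord -prodr_const -!big_split; apply: eq_bigr => i _ /=.
have -> : Q = q ^+ (m - i.+1) * q ^+ i.+1 by rewrite -exprD subnK.
by rewrite (exprS q i); field; rewrite y0 q0 !expf_neq0.
Qed.

Lemma qprod_rev_shift (y : C) n : y != 0 ->
  [y * q ^ (1 - n%:Z)]_n = y ^+ n * (\prod_(i < n) - q ^- i) * [y^-1]_n.
Proof.
move=> y0; rewrite /qprod (reindex_inj rev_ord_inj) /=.
rewrite -[n in y ^+ n]card_ord -prodr_const -!big_split; apply: eq_bigr => i _ /=.
rewrite -mulrA exprnP -expfzDr //.
have -> : 1 - n%:Z + (n - i.+1)%:Z = - i%:Z by have := ltn_ord i; lia.
by rewrite -exprnN; field; rewrite y0 expf_neq0.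
Qed.

(** The powers of q produced by the two reversals cancel. *)
Lemma qprod_rev_ratio (x y : C) n : x != 0 -> y != 0 -> [y]_n != 0 ->
  [x^-1 * q ^ (1 - n%:Z)]_n / [y^-1 * q ^ (1 - n%:Z)]_n =
  [x]_n / [y]_n * (y / x) ^+ n.
Proof.
move=> x0 y0 hy; rewrite !qprod_rev_shift ?invr_eq0 // !invrK.
set S := \prod_(i < n) _; have S0 : S != 0.
  by apply/prodf_neq0 => i _; rewrite oppr_eq0 invr_eq0 expf_neq0.
rewrite !exprMn !exprVn; field.
by rewrite S0 hy !expf_neq0.
Qed.

Lemma qfrac_N r : qfrac_wd q r (- m%:Z) ->
  qfrac q r (- m%:Z) =
  (\prod_(y <- r.2) [y / Q]_m) / (\prod_(x <- r.1) [x / Q]_m).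
Proof.
case: r => xs ys /andP [/= hx hy].
rewrite /qfrac /= mulrC; congr (_ * _).
  elim: ys hy => [|y ys IH] /=; first by rewrite !big_nil invr1.
  rewrite qpoch_wdN !big_cons => /andP [/andP [h1 _] /IH h].
  by rewrite invfM h qpoch_N // invrK.
elim: xs hx => [|x xs IH] /=; first by rewrite !big_nil invr1.
rewrite qpoch_wdN !big_cons => /andP [h1 /IH h].
by rewrite invfM h qpoch_N.
Qed.

Lemma expfz_shift (x : C) n : x != 0 -> x ^ (n%:Z - m%:Z) = x ^+ n / x ^+ m.
Proof. by move=> x0; rewrite expfzDr // -exprnN. Qed.

Lemma qprod_moveS x n : [x]_n * (1 - x * q ^+ n) = (1 - x) * [x * q]_n.
Proof. by rewrite -qprodS qprodSl. Qed.

Lemma qinf_back x : P (x / Q) = [x / Q]_m * P x.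
Proof. by rewrite {1}(qinf_split geoC q1 (x / Q) m) divfK ?Q_neq0. Qed.

Lemma qinf_forth x : P x = [x]_m * P (x * Q).
Proof. exact: (qinf_split geoC q1 x m). Qed.

Section Terms.
Variables a b c d e f sa sg : C.
Hypotheses (a0 : a != 0) (b0 : b != 0) (c0 : c != 0).
Hypotheses (d0 : d != 0) (e0 : e != 0) (f0 : f != 0).
Hypotheses (sqa : sa ^+ 2 = a) (sqg : sg ^+ 2 = e * f / c).

Local Notation A := (a / Q ^+ 2).
Local Notation B := (b / Q).
Local Notation C' := (c / Q).
Local Notation D := (d / Q).
Local Notation E := (e / Q).

(** The term of index k = -m of the left-hand sum. *)
Definition lhs_head : C :=
  [Q * f / a]_m * [q]_m / ([q * Q / a]_m * [f]_m) *
  ((1 - A) / (1 - a)) *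
  ([a * q / b / Q]_m * [a * q / c / Q]_m * [a * q / d / Q]_m * [a * q / e / Q]_m /
   ([b / Q]_m * [c / Q]_m * [d / Q]_m * [e / Q]_m)) /
  (q * a ^+ 2 / (b * c * d * e)) ^+ m.

(** The term of index k = -m of the first right-hand sum. *)
Definition rhs1_head : C :=
  (1 - e * f / c) / (1 - e * f / c * Q ^+ 2) *
  ([q]_m * [b * e * f / a]_m * ([d * e * f / a]_m * [a * q / c / Q]_m *
    [f * q * Q / c]_m * [e * q / c]_m) /
   ([e * f / c]_m * [a * q / (b * c)]_m * ([a * q / (c * d)]_m *
    [e * f * Q / a]_m * [e / Q]_m * [f]_m))) / (b * d / a) ^+ m.

(** The term of index k = -m of the second right-hand sum. *)
Definition rhs2_head : C :=
  (1 - b ^+ 2 / a) / (1 - b ^+ 2 / a * Q ^+ 2) *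
  ([q]_m * ([b * q * Q / a]_m * [b * q / c]_m * [b * q / d]_m *
     [b * q / e]_m * [b * q / f / Q]_m) /
   ([b ^+ 2 / a]_m * ([B]_m * [b * c / a]_m * [b * d / a]_m *
     [b * e / a]_m * [b * f * Q / a]_m))) /
  (a ^+ 2 * q ^+ 2 / (b * c * d * e * f)) ^+ m.

Let L1 (k : int) :=
    ([:: q ^ (m%:Z - k + 1) / a; f * q ^+ m],
     [:: q ^ (m%:Z - k) * f / a; q ^+ (1 + m)]).
Let L2 :=
    ([:: q * sa; - (q * sa); b; c; d; e],
     [:: sa; - sa; a * q / b; a * q / c; a * q / d; a * q / e]).

(** The first fraction of the left-hand sum has parameters that move with k.  Read
    backwards they become (A; q)_n and (Aq/f; q)_n with fixed parameters. *)
Lemma moving_param1 n : q ^ (m%:Z - (n%:Z - m%:Z) + 1) / a = A^-1 * q ^ (1 - n%:Z).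
Proof.
have -> : m%:Z - (n%:Z - m%:Z) + 1 = m%:Z + m%:Z + (1 - n%:Z) by ring.
rewrite expfzDr // [q ^ (m%:Z + m%:Z)]expfzDr // -exprnP.
by field; rewrite ?a0 ?Q_neq0.
Qed.

Lemma moving_param2 n : q ^ (m%:Z - (n%:Z - m%:Z)) * f / a =
  (A * q / f)^-1 * q ^ (1 - n%:Z).
Proof.
have -> : m%:Z - (n%:Z - m%:Z) = m%:Z + m%:Z - 1 + (1 - n%:Z) by ring.
rewrite expfzDr // expfzDr // expfzDr // -exprnP exprN1.
by field; rewrite ?a0 ?f0 ?q0 ?Q_neq0.
Qed.

Lemma moving_base1 n : q ^ (m%:Z - (n%:Z - m%:Z) + 1) / a * q ^ (n%:Z - m%:Z) =
  q * Q / a.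
Proof.
rewrite mulrAC -expfzDr //.
have -> : m%:Z - (n%:Z - m%:Z) + 1 + (n%:Z - m%:Z) = (m.+1)%:Z by rewrite intS; ring.
by rewrite -exprnP exprS.
Qed.

Lemma moving_base2 n : q ^ (m%:Z - (n%:Z - m%:Z)) * f / a * q ^ (n%:Z - m%:Z) =
  Q * f / a.
Proof.
set x := q ^ _; set y := q ^ _.
have -> : x * f / a * y = x * y * f / a by ring.
by rewrite /x /y -expfzDr // subrK -exprnP.
Qed.

Hypothesis wdL : forall k : int, - m%:Z <= k ->
  qfrac_wd q (L1 k) k && qfrac_wd q L2 k.

(** What the well-definedness of the left-hand terms says about the shifted
    parameters. *)
Lemma lhs_nonzero :
  [/\ 1 - A != 0, 1 - a != 0, [q * Q / a]_m != 0, [f]_m != 0 &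
      [Q * f / a]_m != 0] /\
  [/\ P (A * q / B) != 0, P (A * q / C') != 0, P (A * q / D) != 0,
      P (A * q / E) != 0 & P (A * q / f) != 0].
Proof.
have Q0 := Q_neq0.
have wd2 y : y \in L2.2 -> P (y / Q) != 0.
  move=> yL; apply: qinf_wd => k /wdL /andP [_ /andP [_ /allP h]].
  exact: h.
have hsa : P (sa / Q) != 0 by apply: wd2; rewrite !inE eqxx.
have hsa' : P (- sa / Q) != 0 by apply: wd2; rewrite !inE eqxx orbT.
have := wdL (lexx _).
rewrite /L1 /L2 /qfrac_wd /=.
rewrite !qpoch_wdN => /andP [/andP [/andP [h1 /andP [h2 _]] /andP [/andP [h3 _] _]] _].
have EQ : q ^ (m%:Z - - m%:Z) = Q * Q by rewrite opprK expfzDr.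
split.
  split.
  - have := qprod_neq0 geoC q1 1 hsa; have := qprod_neq0 geoC q1 1 hsa'.
    rewrite !qprodS !qprod0 !mul1r expr0 !mulr1 => k1 k2.
    have -> : 1 - A = (1 - sa / Q) * (1 - - sa / Q) by rewrite -sqa; field.
    by rewrite mulf_neq0.
  - have := qprod_neq0 geoC q1 m.+1 hsa; have := qprod_neq0 geoC q1 m.+1 hsa'.
    rewrite !qprodS !mulf_eq0 !negb_or !divfK // => /andP [_ k1] /andP [_ k2].
    have -> : 1 - a = (1 - sa) * (1 - - sa) by rewrite -sqa; ring.
    by rewrite mulf_neq0.
  - move: h1; rewrite expfzDr // EQ expr1z.
    by have -> : Q * Q * q / a / Q = q * Q / a by field; rewrite a0.
  - by move: h2; rewrite mulfK.
  - move: h3; rewrite EQ.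
    by have -> : Q * Q * f / a / Q = Q * f / a by field; rewrite a0.
have AE y : y != 0 -> A * q / (y / Q) = a * q / y / Q.
  by move=> y0; field; rewrite y0 Q0.
split; try by rewrite AE //; apply: wd2; rewrite !inE eqxx ?orbT.
apply: (qinf_neq0 geoC q1) => n; apply/negP => /eqP z0.
have /andP [/andP [_ /= /andP [/andP [_ nz] _]] _] :
    qfrac_wd q (L1 (n%:Z - m%:Z)) (n%:Z - m%:Z) && qfrac_wd q L2 (n%:Z - m%:Z).
  by apply: wdL; rewrite lerDr.
have hQf : [Q * f / a]_m != 0.
  by move: h3; rewrite EQ; have -> : Q * Q * f / a / Q = Q * f / a by field; rewrite a0.
move: nz; rewrite qpoch_shiftl moving_base2 //.
have nf : (A * q / f)^-1 != 0 by rewrite invr_eq0 !mulf_neq0 ?invr_eq0 ?expf_neq0.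
rewrite moving_param2 (qprod_rev_shift _ nf).
by rewrite invrK z0 mulr0 mul0r eqxx.
Qed.

Lemma moving_shift n :
  qfrac q (L1 (n%:Z - m%:Z)) (n%:Z - m%:Z) =
  [Q * f / a]_m * [q]_m / ([q * Q / a]_m * [f]_m) *
  ([A]_n * [f]_n / ([A * q / f]_n * [q]_n) * (q / f) ^+ n).
Proof.
have [[_ _ h1 h2 h3] [_ _ _ _ /(qprod_neq0 geoC q1 n) h4]] := lhs_nonzero.
have Q0 := Q_neq0; have hq k := qprod_neq0 geoC q1 k (qinf_q geoC q1).
rewrite /qfrac /= !big_cons !big_nil !mulr1.
have := @qpoch_shiftl (q ^ (m%:Z - (n%:Z - m%:Z) + 1) / a) m n.
rewrite moving_base1 => -> //.
have := @qpoch_shiftl (q ^ (m%:Z - (n%:Z - m%:Z)) * f / a) m n.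
rewrite moving_base2 => -> //.
have Eq1 : q ^+ (1 + m) = q * Q by rewrite add1n exprS.
rewrite Eq1 (@qpoch_shift (f * Q)) ?(@qpoch_shift (q * Q)) !mulfK //.
rewrite moving_param1 moving_param2.
have A0 : A != 0 by rewrite mulf_neq0 ?invr_eq0 ?expf_neq0.
have Af0 : A * q / f != 0 by rewrite !mulf_neq0 ?invr_eq0 ?expf_neq0.
have := qprod_rev_ratio A0 Af0 h4.
have -> : A * q / f / A = q / f by field_nonzero.
move=> e1.
transitivity ([A^-1 * q ^ (1 - n%:Z)]_n / [(A * q / f)^-1 * q ^ (1 - n%:Z)]_n *
  ([Q * f / a]_m * [q]_m / ([q * Q / a]_m * [f]_m)) * ([f]_n / [q]_n)).
  by rewrite !invfM !invrK; ring.
rewrite e1 !invfM; ring.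
Qed.

Lemma vwp_pair (x y : C) n : x ^+ 2 = y -> P x != 0 -> P (- x) != 0 ->
  [q * x]_n * [- (q * x)]_n / ([x]_n * [- x]_n) = (1 - y * q ^+ n.*2) / (1 - y).
Proof.
move=> <- hx hx'; rewrite very_well_poised ?qprod_neq0 //.
have := qprod_neq0 geoC q1 1 hx; have := qprod_neq0 geoC q1 1 hx'.
rewrite !qprodS !qprod0 !mul1r expr0 !mulr1 => h h'.
have -> : 1 - x ^+ 2 = (1 - x) * (1 - - x) by ring.
by rewrite mulf_neq0.
Qed.

Lemma lhs_shift n :
  qfrac q (L1 (n%:Z - m%:Z)) (n%:Z - m%:Z) * qfrac q L2 (n%:Z - m%:Z) *
    (q * a ^+ 2 / (b * c * d * e)) ^ (n%:Z - m%:Z) =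
  lhs_head * W A B C' D E f n.
Proof.
have Q0 := Q_neq0.
have /andP [_ w2] := wdL (lexx _).
have hw y : y \in L2.2 -> P (y / Q) != 0.
  move=> yL; apply: qinf_wd => k /wdL /andP [_ /andP [_ /allP h]].
  exact: h.
have hsa : P (sa / Q) != 0 by apply: hw; rewrite !inE eqxx.
have hsa' : P (- (sa / Q)) != 0 by rewrite -mulNr; apply: hw; rewrite !inE eqxx orbT.
have sA : (sa / Q) ^+ 2 = A by rewrite expr_div_n sqa.
rewrite moving_shift qfrac_shift // qfrac_N //.
rewrite expfz_shift; last by rewrite !mulf_neq0 ?invr_eq0 ?mulf_neq0 ?expf_neq0.
rewrite !big_cons !big_nil !mulr1 !mulNr.
have -> : q * sa / Q = q * (sa / Q) by rewrite mulrA.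
set z0 := q * a ^+ 2 / _.
transitivity ([Q * f / a]_m * [q]_m / ([q * Q / a]_m * [f]_m) *
  ([A]_n * [f]_n / ([A * q / f]_n * [q]_n) * (q / f) ^+ n) *
  (([q * (sa / Q)]_m * [- (q * (sa / Q))]_m / ([sa / Q]_m * [- (sa / Q)]_m))^-1 *
   ([a * q / b / Q]_m * [a * q / c / Q]_m * [a * q / d / Q]_m * [a * q / e / Q]_m /
   ([b / Q]_m * [c / Q]_m * [d / Q]_m * [e / Q]_m))) *
  ([q * (sa / Q)]_n * [- (q * (sa / Q))]_n / ([sa / Q]_n * [- (sa / Q)]_n) *
   (([b / Q]_n * [c / Q]_n * [d / Q]_n * [e / Q]_n) /
   ([a * q / b / Q]_n * [a * q / c / Q]_n * [a * q / d / Q]_n * [a * q / e / Q]_n))) *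
  (z0 ^+ n / z0 ^+ m)).
  by rewrite !invfM !invrK; ring.
rewrite !(vwp_pair _ sA hsa hsa').
have -> : A * q ^+ m.*2 = a by rewrite -addnn exprD; field; rewrite Q0.
have AE y : y != 0 -> A * q / (y / Q) = a * q / y / Q.
  by move=> y0; field; rewrite y0 Q0.
rewrite /vwp8 /lhs_head !AE // -/z0.
have -> : A ^+ 2 * q ^+ 2 / (B * C' * D * E * f) = q / f * z0.
  by rewrite /z0; field_nonzero.
rewrite [(q / f * z0) ^+ n]exprMn !invfM !invrK; ring.
Qed.

Lemma rhs1_shift n :
  let A3 :=
    ([:: e * f * q ^+ m / c; q ^+ (1 + m) * sg; - (q ^+ (1 + m) * sg);
         a * q ^+ (1 + m) / (b * c)],
     [:: q ^+ (1 + m); q ^+ m * sg; - (q ^+ m * sg);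
         b * e * f * q ^+ m / a]) in
  let A4 :=
    ([:: a * q ^+ (1 + m) / (c * d); e * f * q ^+ (2 * m) / a; e; f * q ^+ m],
     [:: d * e * f * q ^+ m / a; a * q / c; f * q ^+ (1 + 2 * m) / c;
         e * q ^+ (1 + m) / c]) in
  b * d / a != 0 ->
  qfrac_wd q A3 (- m%:Z) && qfrac_wd q A4 (- m%:Z) ->
  P sg != 0 -> P (- sg) != 0 ->
  qfrac q A3 (n%:Z - m%:Z) * qfrac q A4 (n%:Z - m%:Z) *
    (b * d / a) ^ (n%:Z - m%:Z) =
  rhs1_head * W (E * f / C') (A * q / (C' * D)) (E * f / A) (A * q / (B * C')) E f n.
Proof.
have Q0 := Q_neq0.
have Eq1 : q ^+ (1 + m) = q * Q by rewrite add1n exprS.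
have Eq2 : q ^+ (2 * m) = Q ^+ 2 by rewrite mulnC exprM.
have Eq3 : q ^+ (1 + 2 * m) = q * Q ^+ 2 by rewrite add1n exprS Eq2.
move=> A3 A4 z0 /andP [w3 w4] hg hg'.
rewrite (qfrac_shift _ w3) (qfrac_shift _ w4) (qfrac_N w3) (qfrac_N w4).
rewrite expfz_shift // /A3 /A4 Eq1 Eq2 Eq3 !big_cons !big_nil !mulr1 !mulNr.
have N (x y : C) : x * Q / y / Q = x / y by rewrite mulrAC mulfK.
have -> : e * f * Q / c / Q = e * f / c by field_nonzero.
have -> : q * Q * sg / Q = q * sg by field.
have -> : a * (q * Q) / (b * c) / Q = a * q / (b * c) by field_nonzero.
have -> : q * Q / Q = q by field.
have -> : Q * sg / Q = sg by field.
have -> : b * e * f * Q / a / Q = b * e * f / a by field_nonzero.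
have -> : a * (q * Q) / (c * d) / Q = a * q / (c * d) by field_nonzero.
have -> : e * f * Q ^+ 2 / a / Q = e * f * Q / a by field_nonzero.
have -> : f * Q / Q = f by field.
have -> : d * e * f * Q / a / Q = d * e * f / a by field_nonzero.
have -> : f * (q * Q ^+ 2) / c / Q = f * q * Q / c by field_nonzero.
have -> : e * (q * Q) / c / Q = e * q / c by field_nonzero.
transitivity (
  ([q * sg]_m * [- (q * sg)]_m / ([sg]_m * [- sg]_m))^-1 *
  ([q]_m * [b * e * f / a]_m * ([d * e * f / a]_m * [a * q / c / Q]_m *
    [f * q * Q / c]_m * [e * q / c]_m) /
   ([e * f / c]_m * [a * q / (b * c)]_m * ([a * q / (c * d)]_m *
    [e * f * Q / a]_m * [e / Q]_m * [f]_m))) *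
  ([q * sg]_n * [- (q * sg)]_n / ([sg]_n * [- sg]_n) *
   (([e * f / c]_n * [a * q / (b * c)]_n * ([a * q / (c * d)]_n *
    [e * f * Q / a]_n * [e / Q]_n * [f]_n)) /
   ([q]_n * [b * e * f / a]_n * ([d * e * f / a]_n * [a * q / c / Q]_n *
    [f * q * Q / c]_n * [e * q / c]_n)))) *
  ((b * d / a) ^+ n / (b * d / a) ^+ m)).
  by rewrite !invfM !invrK; ring.
rewrite !(vwp_pair _ sqg hg hg') /rhs1_head /vwp8.
have -> : E * f / C' = e * f / c by field_nonzero.
have -> : q ^+ m.*2 = Q ^+ 2 by rewrite -addnn exprD.
have -> : A * q / (C' * D) = a * q / (c * d) by field_nonzero.
have -> : A * q / (B * C') = a * q / (b * c) by field_nonzero.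
have -> : E * f / A = e * f * Q / a by field_nonzero.
have -> : e * f / c * q / (a * q / (c * d)) = d * e * f / a.
  by field_nonzero.
have -> : e * f / c * q / (e * f * Q / a) = a * q / c / Q.
  by field_nonzero.
have -> : e * f / c * q / (a * q / (b * c)) = b * e * f / a.
  by field_nonzero.
have -> : e * f / c * q / E = f * q * Q / c by field_nonzero.
have -> : e * f / c * q / f = e * q / c by field_nonzero.
have -> : (e * f / c) ^+ 2 * q ^+ 2 /
   (a * q / (c * d) * (e * f * Q / a) * (a * q / (b * c)) * E * f) = b * d / a.
  by field_nonzero.
rewrite !invfM !invrK; ring.
Qed.

Lemma rhs2_shift n :
  let B4 :=
    ([:: b ^+ 2 * q ^+ m / a; q ^+ (1 + m) * b / sa;
         - (q ^+ (1 + m) * b / sa)],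
     [:: q ^+ (1 + m); q ^+ m * b / sa; - (q ^+ m * b / sa)]) in
  let B5 :=
    ([:: b; b * c * q ^+ m / a; b * d * q ^+ m / a; b * e * q ^+ m / a;
         b * f * q ^+ (2 * m) / a],
     [:: b * q ^+ (1 + 2 * m) / a; b * q ^+ (1 + m) / c;
         b * q ^+ (1 + m) / d; b * q ^+ (1 + m) / e; b * q / f]) in
  qfrac_wd q B4 (- m%:Z) && qfrac_wd q B5 (- m%:Z) ->
  P (b / sa) != 0 -> P (- (b / sa)) != 0 ->
  qfrac q B4 (n%:Z - m%:Z) * qfrac q B5 (n%:Z - m%:Z) *
    (a ^+ 2 * q ^+ 2 / (b * c * d * e * f)) ^ (n%:Z - m%:Z) =
  rhs2_head * W (B ^+ 2 / A) B (B * C' / A) (B * D / A) (B * E / A) (B * f / A) n.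
Proof.
have Q0 := Q_neq0.
have Eq1 : q ^+ (1 + m) = q * Q by rewrite add1n exprS.
have Eq2 : q ^+ (2 * m) = Q ^+ 2 by rewrite mulnC exprM.
have Eq3 : q ^+ (1 + 2 * m) = q * Q ^+ 2 by rewrite add1n exprS Eq2.
move=> B4 B5 /andP [w3 w4] hg hg'.
have sa0 : sa != 0 by move: a0; rewrite -sqa expf_eq0.
have sb : (b / sa) ^+ 2 = b ^+ 2 / a by rewrite expr_div_n sqa.
rewrite (qfrac_shift _ w3) (qfrac_shift _ w4) (qfrac_N w3) (qfrac_N w4).
rewrite expfz_shift; last by rewrite !mulf_neq0 ?invr_eq0 ?mulf_neq0 ?expf_neq0.
rewrite /B4 /B5 Eq1 Eq2 Eq3 !big_cons !big_nil !mulr1 !mulNr.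
set z0 := a ^+ 2 * q ^+ 2 / _.
have -> : b ^+ 2 * Q / a / Q = b ^+ 2 / a by field_nonzero.
have -> : q * Q * b / sa / Q = q * (b / sa) by field_nonzero.
have -> : q * Q / Q = q by field.
have -> : Q * b / sa / Q = b / sa by field_nonzero.
have -> : b * c * Q / a / Q = b * c / a by field_nonzero.
have -> : b * d * Q / a / Q = b * d / a by field_nonzero.
have -> : b * e * Q / a / Q = b * e / a by field_nonzero.
have -> : b * f * Q ^+ 2 / a / Q = b * f * Q / a by field_nonzero.
have -> : b * (q * Q ^+ 2) / a / Q = b * q * Q / a by field_nonzero.
have -> : b * (q * Q) / c / Q = b * q / c by field_nonzero.
have -> : b * (q * Q) / d / Q = b * q / d by field_nonzero.
have -> : b * (q * Q) / e / Q = b * q / e by field_nonzero.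
transitivity (
  ([q * (b / sa)]_m * [- (q * (b / sa))]_m / ([b / sa]_m * [- (b / sa)]_m))^-1 *
  ([q]_m * ([b * q * Q / a]_m * [b * q / c]_m * [b * q / d]_m *
     [b * q / e]_m * [b * q / f / Q]_m) /
   ([b ^+ 2 / a]_m * ([B]_m * [b * c / a]_m * [b * d / a]_m *
     [b * e / a]_m * [b * f * Q / a]_m))) *
  ([q * (b / sa)]_n * [- (q * (b / sa))]_n / ([b / sa]_n * [- (b / sa)]_n) *
  (([b ^+ 2 / a]_n * ([B]_n * [b * c / a]_n * [b * d / a]_n *
     [b * e / a]_n * [b * f * Q / a]_n)) /
   ([q]_n * ([b * q * Q / a]_n * [b * q / c]_n * [b * q / d]_n *
     [b * q / e]_n * [b * q / f / Q]_n)))) *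
  (z0 ^+ n / z0 ^+ m)).
  by rewrite !invfM !invrK; ring.
rewrite !(vwp_pair _ sb hg hg') /rhs2_head /vwp8.
have -> : B ^+ 2 / A = b ^+ 2 / a by field_nonzero.
have -> : B * C' / A = b * c / a by field_nonzero.
have -> : B * D / A = b * d / a by field_nonzero.
have -> : B * E / A = b * e / a by field_nonzero.
have -> : B * f / A = b * f * Q / a by field_nonzero.
have -> : q ^+ m.*2 = Q ^+ 2 by rewrite -addnn exprD.
have -> : b ^+ 2 / a * q / B = b * q * Q / a by field_nonzero.
have -> : b ^+ 2 / a * q / (b * c / a) = b * q / c by field_nonzero.
have -> : b ^+ 2 / a * q / (b * d / a) = b * q / d by field_nonzero.
have -> : b ^+ 2 / a * q / (b * e / a) = b * q / e by field_nonzero.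
have -> : b ^+ 2 / a * q / (b * f * Q / a) = b * q / f / Q.
  by field_nonzero.
have -> : (b ^+ 2 / a) ^+ 2 * q ^+ 2 / (B * (b * c / a) * (b * d / a) *
    (b * e / a) * (b * f * Q / a)) = z0.
  by rewrite /z0; field_nonzero.
rewrite -/z0 !invfM !invrK; ring.
Qed.

End Terms.

End Shift.

(** * The coefficients of the three-term relation after the shift *)

Section Coef.
Variable C : numClosedFieldType.
Hypothesis geoC : geometric_complete C.
Variable q : C.
Hypothesis q1 : `|q| < 1.
Hypothesis q0 : q != 0.
Local Notation P := (qpoch_inf q).
Local Notation "[ x ]_ n" := (qprod q x n)
  (at level 0, x at level 99, n at level 2, format "[ x ]_ n").
Variable m : nat.
Local Notation Q := (q ^+ m).
Variables a b c d e f : C.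
Hypotheses (a0 : a != 0) (b0 : b != 0) (c0 : c != 0).
Hypotheses (d0 : d != 0) (e0 : e != 0) (f0 : f != 0).
Local Notation A := (a / Q ^+ 2).
Local Notation B := (b / Q).
Local Notation C' := (c / Q).
Local Notation D := (d / Q).
Local Notation E := (e / Q).

Let tau := \prod_(i < m) - q ^- i.+1.

Lemma tau_neq0 : tau != 0.
Proof. by apply/prodf_neq0 => i _; rewrite oppr_eq0 invr_eq0 expf_neq0. Qed.

(** Passing from the shifted to the original parameter costs a finite product, whose
    factors are reversed to match those of T_1 and T_2. *)
Lemma qinf_back_rev y : y != 0 -> P (y / Q) = y ^+ m * tau * [q / y]_m * P y.
Proof. by move=> y0; rewrite (qinf_back geoC q1 q0) qprod_rev. Qed.

(** P(Aq) contributes (1/a; q)_{2m} after reversal; together with the very-well-poised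
    factor (1 - A)/(1 - a) and the moving parameter q^{m+1}/a this leaves
    (q/a; q)_m. *)
Lemma qinf_base : 1 - A != 0 -> 1 - a != 0 -> [q * Q / a]_m != 0 ->
  P (A * q) * ((1 - A) / (1 - a)) / [q * Q / a]_m =
  (a ^+ 2 * q ^+ 2 / Q) ^+ m * tau ^+ 2 / (Q ^+ 2) * [q / a]_m * P (a * q).
Proof.
move=> A1 a1 nz; have Q0 := Q_neq0 q0 m.
have -> : A * q = a * q / Q / Q by field_nonzero.
rewrite qinf_back_rev ?mulf_neq0 ?invr_eq0 // qinf_back_rev ?mulf_neq0 //.
have -> : q / (a * q / Q) = a^-1 * Q by field_nonzero.
have -> : q / (a * q) = a^-1 by field_nonzero.
(* Both sides are (1/a; q)_{2m+1}. *)
have h : [a^-1]_m * [a^-1 * Q]_m * (1 - a^-1 * Q * Q) =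
         (1 - a^-1) * [q / a]_m * [q * Q / a]_m.
  rewrite -qprodD -mulrA -exprD -qprodS qprodSl qprodD.
  have -> : a^-1 * q = q / a by rewrite mulrC.
  have -> : q / a * Q = q * Q / a by ring.
  by ring.
have n1 : 1 - a^-1 * Q * Q != 0.
  have -> : 1 - a^-1 * Q * Q = - (Q ^+ 2 / a) * (1 - A) by field; rewrite a0 Q0.
  by rewrite mulf_neq0 // oppr_eq0 mulf_neq0 ?invr_eq0 ?expf_neq0.
have {}h : [a^-1]_m * [a^-1 * Q]_m =
    (1 - a^-1) * [q / a]_m * [q * Q / a]_m / (1 - a^-1 * Q * Q).
  by rewrite -h mulfK.
transitivity ((a * q / Q) ^+ m * (a * q) ^+ m * tau ^+ 2 * P (a * q) *
  ((1 - A) / (1 - a) / [q * Q / a]_m) * ([a^-1]_m * [a^-1 * Q]_m)); first by ring.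
rewrite h -exprMn.
have -> : a * q / Q * (a * q) = a ^+ 2 * q ^+ 2 / Q by ring.
have n2 : a - Q ^+ 2 != 0.
  have -> : a - Q ^+ 2 = a * (1 - a^-1 * Q * Q) by field.
  by rewrite mulf_neq0.
have n3 : Q ^+ 2 - a != 0 by rewrite -opprB oppr_eq0.
move: (_ ^+ m) [q / a]_m [q * Q / a]_m nz (P _) tau => x y z nz p t.
by field_nonzero.
Qed.


(** Each infinite product of the three-term relation is moved back to the original
    parameters; the finite products that appear are those of the first terms and of
    T_1.  The powers of a, ..., f are collected in one identity (POW). *)
Lemma rhs1_coefficient :
  let A1 :=
    ([:: q / a; d * f / a; e * f / a; a * q / (b * c); a * q / (c * d);
         e * f * q ^+ m / a],
     [:: f / a; q / b; q / c; q / d; d * e * f / a; f * q ^+ (1 + m) / c]) in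
  let A2 :=
    ([:: a * q; a * q / (d * e); a * q / (d * f); a * q / (e * f);
         e * q ^+ (1 + m) / c; f * q ^+ (1 + m) / c; b / a;
         b * e * f * q ^+ m / a],
     [:: a * q / d; a * q / e; a * q / f; a * q / (d * e * f);
         q ^+ (1 + m) / c; e * f * q ^+ (1 + m) / c; b * e / a;
         b * f * q ^+ m / a]) in
  1 - A != 0 -> 1 - a != 0 -> [q * Q / a]_m != 0 -> [f]_m != 0 ->
  [Q * f / a]_m != 0 ->
  1 - e * f * Q / c != 0 -> 1 - e * f * Q ^+ 2 / c != 0 ->
  [f / a]_m != 0 -> [q / b]_m != 0 -> [q / c]_m != 0 -> [q / d]_m != 0 ->
  [e / Q]_m != 0 -> [e * f / c]_m != 0 -> [e * f * q / c]_m != 0 ->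
  [d * e * f / a]_m != 0 -> [f * q * Q / c]_m != 0 ->
  [a * q / (b * c)]_m != 0 -> [a * q / (c * d)]_m != 0 ->
  [e * f * Q / a]_m != 0 ->
  P (a * q / d / Q) != 0 -> P (a * q / e / Q) != 0 -> P (a * q / f) != 0 ->
  P (a * q / (d * e * f)) != 0 -> P (q * Q / c) != 0 ->
  P (e * f * (q * Q) / c) != 0 -> P (b * e / a) != 0 -> P (b * f * Q / a) != 0 ->
  (1 - e * f * q ^+ (2 * m) / c) / (1 - e * f * q ^+ m / c)
    * qfrac q A1 m%:Z * qfrac_inf q A2 *
  rhs1_head q m a b c d e f =
  lhs_head q m a b c d e f *
  ((P (A * q) * P (A * q / (D * E)) * P (A * q / (D * f)) *
   P (A * q / (E * f)) * P (E * q / C') * P (f * q / C') * P (B / A) *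
   P (B * E * f / A)) /
  (P (A * q / D) * P (A * q / E) * P (A * q / f) * P (A * q / (D * E * f)) *
   P (q / C') * P (E * f * q / C') * P (B * E / A) * P (B * f / A))).
Proof.
move=> L1 L2 A1 a1 nqQa nf nQfa n1 n2 nfa nqb nqc nqd ne nefc nefqc ndef nfqc nabc nacd nefa
  pd pe pf pdef pqc pefqc pbe pbf.
have Q0 := Q_neq0 q0 m.
rewrite /L1 /L2 /qfrac /qfrac_inf /= !big_cons !big_nil !mulr1 add1n.
rewrite [q ^+ m.+1]exprS [(2 * m)%N]mulnC [q ^+ (m * 2)]exprM.
have -> : f * (q * Q) / c = f * q * Q / c by ring.
have -> : e * (q * Q) / c = e * q * Q / c by ring.
have F := qinf_base A1 a1 nqQa.
have -> : A * q / (D * E) = a * q / (d * e) by field_nonzero.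
have -> : A * q / (D * f) = a * q / (d * f) / Q by field_nonzero.
have -> : A * q / (E * f) = a * q / (e * f) / Q by field_nonzero.
have -> : E * q / C' = e * q / c by field_nonzero.
have -> : f * q / C' = f * q * Q / c by field_nonzero.
have -> : B / A = b / a * Q by field_nonzero.
have -> : B * E * f / A = b * e * f / a by field_nonzero.
have -> : A * q / D = a * q / d / Q by field_nonzero.
have -> : A * q / E = a * q / e / Q by field_nonzero.
have -> : A * q / f = a * q / f / Q / Q by field_nonzero.
have -> : A * q / (D * E * f) = a * q / (d * e * f) by field_nonzero.
have -> : q / C' = q * Q / c by field_nonzero.
have -> : E * f * q / C' = e * f * q / c by field_nonzero.
have -> : B * E / A = b * e / a by field_nonzero.
have -> : B * f / A = b * f * Q / a by field_nonzero.
have nz x y : x != 0 -> y != 0 -> x / y != 0 :> C.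
  by move=> x0 y0; rewrite mulf_neq0 ?invr_eq0.
have nzb := mulf_neq0 a0 q0.
rewrite (qinf_back_rev (nz _ _ nzb (mulf_neq0 d0 f0))).
rewrite (qinf_back_rev (nz _ _ nzb (mulf_neq0 e0 f0))).
rewrite (qinf_back_rev (nz _ _ (nz _ _ nzb f0) Q0)) (qinf_back_rev (nz _ _ nzb f0)).
rewrite [P (a * q / d / Q)](qinf_back geoC q1 q0).
rewrite [P (a * q / e / Q)](qinf_back geoC q1 q0).
rewrite (qinf_forth geoC q1 m (e * q / c)) (qinf_forth geoC q1 m (b * e * f / a)).
rewrite (qinf_forth geoC q1 m (b / a)) (qinf_forth geoC q1 m (e * f * q / c)).
rewrite /lhs_head /rhs1_head (qprod_rev q0 m (nz _ _ nzb b0)).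
rewrite (qprod_rev q0 m b0) (qprod_rev q0 m c0) (qprod_rev q0 m d0) -/tau.
have -> : q / (a * q / (d * f)) = d * f / a by field_nonzero.
have -> : q / (a * q / (e * f)) = e * f / a by field_nonzero.
have -> : q / (a * q / f / Q) = Q * f / a by field_nonzero.
have -> : q / (a * q / f) = f / a by field_nonzero.
have -> : q / (a * q / b) = b / a by field_nonzero.
have -> : e * q / c * Q = e * q * Q / c by field.
have -> : b * e * f / a * Q = b * e * f * Q / a by field.
have -> : e * f * q / c * Q = e * f * (q * Q) / c by field.
have G : [e * f / c]_m * (1 - e * f / c * Q) = (1 - e * f / c) * [e * f * q / c]_m.
  by rewrite qprod_moveS [e * f / c * q]mulrAC.
have pd2 := pd; rewrite (qinf_back geoC q1 q0) mulf_eq0 negb_or in pd2.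
have pe2 := pe; rewrite (qinf_back geoC q1 q0) mulf_eq0 negb_or in pe2.
case/andP: pd2 => nd2 pd2; case/andP: pe2 => ne2 pe2.
have n2' : 1 - e * f / c * Q ^+ 2 != 0 by rewrite mulrAC.
have EF : P (A * q) = (a ^+ 2 * q ^+ 2 / Q) ^+ m * tau ^+ 2 / Q ^+ 2 *
    [q / a]_m * P (a * q) * [q * Q / a]_m * (1 - a) / (1 - A).
  rewrite -F; move: (1 - A) (1 - a) A1 a1 => x y x0 y0.
  by field; rewrite x0 y0 nqQa.
have EG : [e * f / c]_m = (1 - e * f / c) * [e * f * q / c]_m /
    (1 - e * f * Q / c).
  by rewrite -G [e * f / c * Q]mulrAC mulfK.
have ng : 1 - e * f / c != 0.
  by apply: contraNneq nefc => h; rewrite EG h !mul0r.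
have POW : (b * d / a) ^+ m = Q ^+ 2 * (b ^+ m * c ^+ m * d ^+ m *
    (q * a ^+ 2 / (b * c * d * e)) ^+ m *
    ((a * q / f / Q) ^+ m * (a * q / f) ^+ m)) / ((a * q / b) ^+ m *
    (a * q / (d * f)) ^+ m * (a * q / (e * f)) ^+ m *
    (a ^+ 2 * q ^+ 2 / Q) ^+ m).
  rewrite -[Q ^+ 2]exprM [(m * 2)%N]mulnC [q ^+ (2 * m)]exprM -!exprMn -expr_div_n.
  by congr (_ ^+ m); field_nonzero.
rewrite POW EF EG [e * f / c * Q ^+ 2]mulrAC.
have nzm x : x != 0 -> x ^+ m != 0 :> C by move=> x0; rewrite expf_neq0.
have := nzm _ (nz _ _ (nz _ _ nzb f0) Q0); have := nzm _ (nz _ _ nzb f0).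
have := nzm _ (nz _ _ nzb b0); have := nzm _ (nz _ _ nzb (mulf_neq0 d0 f0)).
have := nzm _ (nz _ _ nzb (mulf_neq0 e0 f0)).
have := nzm _ (nz _ _ (mulf_neq0 (expf_neq0 2 a0) (expf_neq0 2 q0)) Q0).
have := nzm _ (nz _ _ (mulf_neq0 q0 (expf_neq0 2 a0))
  (mulf_neq0 (mulf_neq0 (mulf_neq0 b0 c0) d0) e0)).
have := nzm _ b0; have := nzm _ c0; have := nzm _ d0; have := tau_neq0.
move: A1 a1 n1 n2 ng.
move: tau (d ^+ m) (c ^+ m) (b ^+ m) ((q * a ^+ 2 / (b * c * d * e)) ^+ m)
  ((a ^+ 2 * q ^+ 2 / Q) ^+ m) ((a * q / (e * f)) ^+ m)
  ((a * q / (d * f)) ^+ m) ((a * q / b) ^+ m) ((a * q / f) ^+ m)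
  ((a * q / f / Q) ^+ m).
move: (1 - A) (1 - a) (1 - e * f * Q / c) (1 - e * f * Q ^+ 2 / c) (1 - e * f / c).
move=> y1 y2 y3 y4 y5 x1 x2 x3 x4 x5 x6 x7 x8 x9 x10 x11.
move=> z1 z2 z3 z4 z5 w1 w2 w3 w4 w5 w6 w7 w8 w9 w10 w11.
by field; repeat (apply/andP; split).
Qed.

(** The same bookkeeping for T_2. *)
Lemma rhs2_coefficient :
  let B1 := ([:: q / a; b * c / a], [:: f / a]) in
  let B2 :=
    ([:: a * q; b * q ^+ (1 + 2 * m) / a; b * q ^+ (1 + m) / c],
     [:: a * q / b; a * q / c; a * q / d]) in
  let B3 :=
    ([:: b * q ^+ (1 + m) / d; b * q ^+ (1 + m) / e; b * q / f; d; e;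
         f * q ^+ m; a * q / (b * c); b * d * e * f / a ^+ 2;
         a ^+ 2 * q / (b * d * e * f)],
     [:: a * q / e; a * q / f; b * d * q ^+ m / a; b * e * q ^+ m / a;
         b * f * q ^+ (2 * m) / a; d * e * f / a; a * q / (d * e * f); q / c;
         b ^+ 2 * q ^+ (1 + m) / a]) in
  1 - A != 0 -> 1 - a != 0 -> [q * Q / a]_m != 0 -> [f]_m != 0 ->
  [Q * f / a]_m != 0 ->
  1 - b ^+ 2 * Q / a != 0 -> 1 - b ^+ 2 * Q ^+ 2 / a != 0 ->
  [f / a]_m != 0 -> [q / c]_m != 0 -> [b / Q]_m != 0 -> [d / Q]_m != 0 ->
  [e / Q]_m != 0 -> [b ^+ 2 / a]_m != 0 -> [b ^+ 2 * q / a]_m != 0 ->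
  [b * c / a]_m != 0 -> [b * d / a]_m != 0 -> [b * e / a]_m != 0 ->
  [b * f * Q / a]_m != 0 ->
  P (a * q / b / Q) != 0 -> P (a * q / c / Q) != 0 ->
  P (a * q / d / Q) != 0 -> P (a * q / e / Q) != 0 -> P (a * q / f) != 0 ->
  P (b * d * Q / a) != 0 -> P (b * e * Q / a) != 0 ->
  P (b * f * Q ^+ 2 / a) != 0 -> P (d * e * f / a) != 0 ->
  P (a * q / (d * e * f)) != 0 -> P (q / c) != 0 ->
  P (b ^+ 2 * (q * Q) / a) != 0 ->
  b / a * ((1 - b ^+ 2 * q ^+ (2 * m) / a) / (1 - b ^+ 2 * q ^+ m / a))
    * (a ^+ 2 * q / (b * c * d * e)) ^+ m
    * qfrac q B1 m%:Z * qfrac_inf q B2 * qfrac_inf q B3 *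
  rhs2_head q m a b c d e f =
  lhs_head q m a b c d e f *
  (B / A *
  ((P (A * q) * P (B * q / A) * P (B * q / C') * P (B * q / D) *
    P (B * q / E) * P (B * q / f) * P D * P E * P f * P (A * q / (B * C')) *
    P (B * D * E * f / A ^+ 2) * P (A ^+ 2 * q / (B * D * E * f))) /
   (P (A * q / B) * P (A * q / C') * P (A * q / D) * P (A * q / E) *
    P (A * q / f) * P (B * D / A) * P (B * E / A) * P (B * f / A) *
    P (D * E * f / A) * P (A * q / (D * E * f)) * P (q / C') *
    P (B ^+ 2 * q / A)))).
Proof.
move=> M1 M2 M3 A1 a1 nqQa nf nQfa n1 n2 nfa nqc nb nd ne nb2 nb2q nbc nbd nbe nbf
  pb pc pd pe pf pbd pbe pbf pdef padef pqc pb2.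
have Q0 := Q_neq0 q0 m.
rewrite /M1 /M2 /M3 /qfrac /qfrac_inf /= !big_cons !big_nil !mulr1 !add1n.
rewrite ![q ^+ _.+1]exprS ![(2 * m)%N]mulnC ![q ^+ (m * 2)]exprM.
have F := qinf_base A1 a1 nqQa.
have -> : B / A = b / a * Q by field_nonzero.
have -> : B * q / A = b * q * Q / a by field_nonzero.
have -> : B * q / C' = b * q / c by field_nonzero.
have -> : B * q / D = b * q / d by field_nonzero.
have -> : B * q / E = b * q / e by field_nonzero.
have -> : B * q / f = b * q / f / Q by field_nonzero.
have -> : A * q / (B * C') = a * q / (b * c) by field_nonzero.
have -> : B * D * E * f / A ^+ 2 = b * d * e * f / a ^+ 2 * Q.
  by field_nonzero.
have -> : A ^+ 2 * q / (B * D * E * f) = a ^+ 2 * q / (b * d * e * f) / Q.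
  by field_nonzero.
have -> : A * q / B = a * q / b / Q by field_nonzero.
have -> : A * q / C' = a * q / c / Q by field_nonzero.
have -> : A * q / D = a * q / d / Q by field_nonzero.
have -> : A * q / E = a * q / e / Q by field_nonzero.
have -> : A * q / f = a * q / f / Q / Q by field_nonzero.
have -> : B * D / A = b * d / a by field_nonzero.
have -> : B * E / A = b * e / a by field_nonzero.
have -> : B * f / A = b * f * Q / a by field_nonzero.
have -> : D * E * f / A = d * e * f / a by field_nonzero.
have -> : A * q / (D * E * f) = a * q / (d * e * f) by field_nonzero.
have -> : q / C' = q / c * Q by field_nonzero.
have -> : B ^+ 2 * q / A = b ^+ 2 * q / a by field_nonzero.
have nz x y : x != 0 -> y != 0 -> x / y != 0 :> C.
  by move=> x0 y0; rewrite mulf_neq0 ?invr_eq0.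
have nzb := mulf_neq0 a0 q0.
have nzd := nz _ _ (mulf_neq0 (expf_neq0 2 a0) q0)
  (mulf_neq0 (mulf_neq0 (mulf_neq0 b0 d0) e0) f0).
rewrite (qinf_back_rev (nz _ _ (nz _ _ nzb f0) Q0)) (qinf_back_rev (nz _ _ nzb f0)).
rewrite (qinf_back_rev nzd).
rewrite [P (a * q / b / Q)](qinf_back geoC q1 q0) in pb *.
rewrite [P (a * q / c / Q)](qinf_back geoC q1 q0) in pc *.
rewrite [P (a * q / d / Q)](qinf_back geoC q1 q0) in pd *.
rewrite [P (a * q / e / Q)](qinf_back geoC q1 q0) in pe *.
rewrite [P (b * q / f / Q)](qinf_back geoC q1 q0).
rewrite [P (d / Q)](qinf_back geoC q1 q0) [P (e / Q)](qinf_back geoC q1 q0).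
rewrite (qinf_forth geoC q1 m (b * q * Q / a)) (qinf_forth geoC q1 m (b * q / c)).
rewrite (qinf_forth geoC q1 m (b * q / d)) (qinf_forth geoC q1 m (b * q / e)).
rewrite (qinf_forth geoC q1 m f) (qinf_forth geoC q1 m (b * d / a)).
rewrite (qinf_forth geoC q1 m (b * e / a)) (qinf_forth geoC q1 m (b * f * Q / a)).
rewrite (qinf_forth geoC q1 m (q / c)) (qinf_forth geoC q1 m (b ^+ 2 * q / a)).
rewrite (qinf_forth geoC q1 m (b * d * e * f / a ^+ 2)) in pdef *.
rewrite /lhs_head /rhs2_head (qprod_rev q0 m c0) -/tau.
have -> : q / (a * q / f / Q) = Q * f / a by field_nonzero.
have -> : q / (a * q / f) = f / a by field_nonzero.
have -> : q / (a ^+ 2 * q / (b * d * e * f)) = b * d * e * f / a ^+ 2.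
  by field_nonzero.
have -> : b * q * Q / a * Q = b * (q * Q ^+ 2) / a by ring.
have -> : b * q / c * Q = b * (q * Q) / c by ring.
have -> : b * q / d * Q = b * (q * Q) / d by ring.
have -> : b * q / e * Q = b * (q * Q) / e by ring.
have -> : b * d / a * Q = b * d * Q / a by ring.
have -> : b * e / a * Q = b * e * Q / a by ring.
have -> : b * f * Q / a * Q = b * f * Q ^+ 2 / a by ring.
have -> : b ^+ 2 * q / a * Q = b ^+ 2 * (q * Q) / a by ring.
have G : [b ^+ 2 / a]_m * (1 - b ^+ 2 / a * Q) = (1 - b ^+ 2 / a) * [b ^+ 2 * q / a]_m.
  by rewrite qprod_moveS [b ^+ 2 / a * q]mulrAC.
have EF : P (A * q) = (a ^+ 2 * q ^+ 2 / Q) ^+ m * tau ^+ 2 / Q ^+ 2 *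
    [q / a]_m * P (a * q) * [q * Q / a]_m * (1 - a) / (1 - A).
  rewrite -F; move: (1 - A) (1 - a) A1 a1 => x y x0 y0.
  by field; rewrite x0 y0 nqQa.
have EG : [b ^+ 2 / a]_m = (1 - b ^+ 2 / a) * [b ^+ 2 * q / a]_m /
    (1 - b ^+ 2 * Q / a).
  by rewrite -G [b ^+ 2 / a * Q]mulrAC mulfK.
have ng : 1 - b ^+ 2 / a != 0.
  by apply: contraNneq nb2 => h; rewrite EG h !mul0r.
have POW : (a ^+ 2 * q / (b * c * d * e)) ^+ m =
    (a ^+ 2 * q ^+ 2 / (b * c * d * e * f)) ^+ m *
    ((a ^+ 2 * q ^+ 2 / Q) ^+ m * (a ^+ 2 * q / (b * d * e * f)) ^+ m * Q) /
    (c ^+ m * (q * a ^+ 2 / (b * c * d * e)) ^+ m *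
     ((a * q / f / Q) ^+ m * (a * q / f) ^+ m) * Q ^+ 2).
  rewrite -[Q ^+ 2]exprM [(m * 2)%N]mulnC [q ^+ (2 * m)]exprM.
  rewrite -!exprMn -expr_div_n.
  by congr (_ ^+ m); field_nonzero.
move: pb pc pd pe; rewrite !mulf_eq0 !negb_or => /andP [? ?] /andP [? ?]
  /andP [? ?] /andP [? ?].
have ? : [q]_m != 0 := qprod_neq0 geoC q1 m (qinf_q geoC q1).
have ? := qprod_neq0 geoC q1 m pqc; have ? := qinf_shift_neq0 geoC q1 m pqc.
rewrite POW EF EG [b ^+ 2 / a * Q ^+ 2]mulrAC.
have nzm x : x != 0 -> x ^+ m != 0 :> C by move=> x0; rewrite expf_neq0.
have := nzm _ (nz _ _ (nz _ _ nzb f0) Q0); have := nzm _ (nz _ _ nzb f0).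
have := nzm _ nzd.
have := nzm _ (nz _ _ (mulf_neq0 (expf_neq0 2 a0) (expf_neq0 2 q0)) Q0).
have := nzm _ (nz _ _ (mulf_neq0 q0 (expf_neq0 2 a0))
  (mulf_neq0 (mulf_neq0 (mulf_neq0 b0 c0) d0) e0)).
have := nzm _ (nz _ _ (mulf_neq0 (expf_neq0 2 a0) (expf_neq0 2 q0))
  (mulf_neq0 (mulf_neq0 (mulf_neq0 (mulf_neq0 b0 c0) d0) e0) f0)).
have := nzm _ c0; have := tau_neq0.
move: A1 a1 n1 n2 ng.
move: tau (c ^+ m) ((a ^+ 2 * q ^+ 2 / (b * c * d * e * f)) ^+ m)
  ((q * a ^+ 2 / (b * c * d * e)) ^+ m)
  ((a ^+ 2 * q ^+ 2 / Q) ^+ m) ((a ^+ 2 * q / (b * d * e * f)) ^+ m)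
  ((a * q / f) ^+ m) ((a * q / f / Q) ^+ m).
move: (1 - A) (1 - a) (1 - b ^+ 2 * Q / a) (1 - b ^+ 2 * Q ^+ 2 / a) (1 - b ^+ 2 / a).
move=> y1 y2 y3 y4 y5 x1 x2 x3 x4 x5 x6 x7 x8.
move=> z1 z2 z3 z4 z5 w1 w2 w3 w4 w5 w6 w7 w8.
by field; repeat (apply/andP; split).
Qed.

End Coef.

(** * Assembling the statement *)

Section Assembly.
Variable C : numClosedFieldType.
Hypothesis geoC : geometric_complete C.
Variable q : C.
Hypothesis q1 : `|q| < 1.
Hypothesis q0 : q != 0.
Local Notation P := (qpoch_inf q).
Local Notation "[ x ]_ n" := (qprod q x n)
  (at level 0, x at level 99, n at level 2, format "[ x ]_ n").

Lemma sum_from_shift m (t : int -> C) (k : C) (w : nat -> C) :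
  (forall n : nat, t (n%:Z - m%:Z) = k * w n) -> cvgn (series w) ->
  summable_from m t /\ sum_from m t = k * csum w.
Proof.
move=> h cw; have e : (fun n : nat => t (n%:Z - m%:Z)) = fun n => k * w n.
  exact/funext.
rewrite /summable_from /sum_from e; split; first exact: cvgn_seriesZ.
by rewrite -csumZ.
Qed.

(** The factors at x and at -x pair up; k = 0 and k = m give the two
    very-well-poised factors of each head term. *)
Lemma one_sub_sq (x y : C) k : x ^+ 2 = y -> P x != 0 -> P (- x) != 0 ->
  1 - y * (q ^+ k) ^+ 2 != 0.
Proof.
move=> <- h h'.
have := qprod_neq0 geoC q1 k.+1 h; have := qprod_neq0 geoC q1 k.+1 h'.
rewrite !qprodS !mulf_eq0 !negb_or => /andP [_ h1] /andP [_ h2].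
have -> : 1 - x ^+ 2 * (q ^+ k) ^+ 2 = (1 - x * q ^+ k) * (1 - - x * q ^+ k).
  by ring.
by rewrite mulf_neq0.
Qed.

Lemma qprod_mulq_neq0 x n : 1 - x != 0 -> qprod q x n != 0 ->
  1 - x * q ^+ n != 0 -> qprod q (x * q) n != 0.
Proof.
move=> h1 h2 h3; have : qprod q x n * (1 - x * q ^+ n) != 0 by rewrite mulf_neq0.
by rewrite qprod_moveS mulf_eq0 negb_or => /andP [].
Qed.

Lemma qprod_eq_neq0 n x y : qprod q x n != 0 -> y = x -> qprod q y n != 0.
Proof. by move=> h ->. Qed.

Lemma qinf_eq_neq0 x y : P x != 0 -> y = x -> P y != 0.
Proof. by move=> h ->. Qed.

Lemma combine_terms (s1 s2 s3 x1 x2 c1 c2 w u1 u2 : C) :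
  w = c1 * u1 + c2 * u2 -> x1 * s2 = s1 * c1 -> x2 * s3 = s1 * c2 ->
  s1 * w = x1 * (s2 * u1) + x2 * (s3 * u2).
Proof. by move=> -> h1 h2; rewrite mulrDr !mulrA -h1 -h2. Qed.

End Assembly.

Local Ltac inlist := by rewrite !inE eqxx ?orbT.

Theorem proposition4p1 (R : realType) (q : R[i]) (m : nat)
    (a b c d e f : R[i])
    (* sa is the chosen a^{1/2} and sg the chosen (ef/c)^{1/2} *)
    (sa sg : R[i]) :
  q != 0 -> `|q| < 1 ->
  sa ^+ 2 = a -> sg ^+ 2 = e * f / c ->
  (* left-hand side *)
  let L1 (k : int) :=
    ([:: q ^ (m%:Z - k + 1) / a; f * q ^+ m],
     [:: q ^ (m%:Z - k) * f / a; q ^+ (1 + m)]) in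
  let L2 :=
    ([:: q * sa; - (q * sa); b; c; d; e],
     [:: sa; - sa; a * q / b; a * q / c; a * q / d; a * q / e]) in
  let lhs (k : int) :=
    qfrac q (L1 k) k * qfrac q L2 k * (q * a ^+ 2 / (b * c * d * e)) ^ k in
  (* first term on the right-hand side *)
  let A1 :=
    ([:: q / a; d * f / a; e * f / a; a * q / (b * c); a * q / (c * d);
         e * f * q ^+ m / a],
     [:: f / a; q / b; q / c; q / d; d * e * f / a; f * q ^+ (1 + m) / c]) in
  let A2 :=
    ([:: a * q; a * q / (d * e); a * q / (d * f); a * q / (e * f);
         e * q ^+ (1 + m) / c; f * q ^+ (1 + m) / c; b / a;
         b * e * f * q ^+ m / a],
     [:: a * q / d; a * q / e; a * q / f; a * q / (d * e * f);
         q ^+ (1 + m) / c; e * f * q ^+ (1 + m) / c; b * e / a;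
         b * f * q ^+ m / a]) in
  let A3 :=
    ([:: e * f * q ^+ m / c; q ^+ (1 + m) * sg; - (q ^+ (1 + m) * sg);
         a * q ^+ (1 + m) / (b * c)],
     [:: q ^+ (1 + m); q ^+ m * sg; - (q ^+ m * sg);
         b * e * f * q ^+ m / a]) in
  let A4 :=
    ([:: a * q ^+ (1 + m) / (c * d); e * f * q ^+ (2 * m) / a; e; f * q ^+ m],
     [:: d * e * f * q ^+ m / a; a * q / c; f * q ^+ (1 + 2 * m) / c;
         e * q ^+ (1 + m) / c]) in
  let rhs1 (k : int) := qfrac q A3 k * qfrac q A4 k * (b * d / a) ^ k in
  let T1 :=
    (1 - e * f * q ^+ (2 * m) / c) / (1 - e * f * q ^+ m / c)
    * qfrac q A1 m%:Z * qfrac_inf q A2 * sum_from m rhs1 in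
  (* second term on the right-hand side *)
  let B1 := ([:: q / a; b * c / a], [:: f / a]) in
  let B2 :=
    ([:: a * q; b * q ^+ (1 + 2 * m) / a; b * q ^+ (1 + m) / c],
     [:: a * q / b; a * q / c; a * q / d]) in
  let B3 :=
    ([:: b * q ^+ (1 + m) / d; b * q ^+ (1 + m) / e; b * q / f; d; e;
         f * q ^+ m; a * q / (b * c); b * d * e * f / a ^+ 2;
         a ^+ 2 * q / (b * d * e * f)],
     [:: a * q / e; a * q / f; b * d * q ^+ m / a; b * e * q ^+ m / a;
         b * f * q ^+ (2 * m) / a; d * e * f / a; a * q / (d * e * f); q / c;
         b ^+ 2 * q ^+ (1 + m) / a]) in
  let B4 :=
    ([:: b ^+ 2 * q ^+ m / a; q ^+ (1 + m) * b / sa;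
         - (q ^+ (1 + m) * b / sa)],
     [:: q ^+ (1 + m); q ^+ m * b / sa; - (q ^+ m * b / sa)]) in
  let B5 :=
    ([:: b; b * c * q ^+ m / a; b * d * q ^+ m / a; b * e * q ^+ m / a;
         b * f * q ^+ (2 * m) / a],
     [:: b * q ^+ (1 + 2 * m) / a; b * q ^+ (1 + m) / c;
         b * q ^+ (1 + m) / d; b * q ^+ (1 + m) / e; b * q / f]) in
  let rhs2 (k : int) :=
    qfrac q B4 k * qfrac q B5 k
    * (a ^+ 2 * q ^+ 2 / (b * c * d * e * f)) ^ k in
  let T2 :=
    b / a * ((1 - b ^+ 2 * q ^+ (2 * m) / a) / (1 - b ^+ 2 * q ^+ m / a))
    * (a ^+ 2 * q / (b * c * d * e)) ^+ m
    * qfrac q B1 m%:Z * qfrac_inf q B2 * qfrac_inf q B3 * sum_from m rhs2 in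
  (* no division by zero occurs *)
  [/\ a != 0, b != 0 & c != 0] -> [/\ d != 0, e != 0 & f != 0] ->
  (forall k : int, - m%:Z <= k ->
     [/\ qfrac_wd q (L1 k) k && qfrac_wd q L2 k,
         qfrac_wd q A3 k && qfrac_wd q A4 k &
         qfrac_wd q B4 k && qfrac_wd q B5 k]) ->
  1 - e * f * q ^+ m / c != 0 -> 1 - b ^+ 2 * q ^+ m / a != 0 ->
  qfrac_wd q A1 m%:Z -> qfrac_wd q B1 m%:Z ->
  qfrac_inf_wd q A2 -> qfrac_inf_wd q B2 -> qfrac_inf_wd q B3 ->
  `|b * d / a| < 1 ->
  `|a ^+ 2 * q ^+ 2 / (b * c * d * e * f)| < 1 ->
  [/\ summable_from m lhs, summable_from m rhs1 & summable_from m rhs2] /\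
  sum_from m lhs = T1 + T2.
Proof.
move=> q0 q1 sqa sqg L1 L2 lhs A1 A2 A3 A4 rhs1 T1 B1 B2 B3 B4 B5 rhs2 T2.
move=> [a0 b0 c0] [d0 e0 f0] wd n1 n2 wA1 wB1 wA2 wB2 wB3 zbd z.
have geoC := @complex_geometric_complete R.
have Q0 := Q_neq0 q0 m.
have Eq1 : q ^+ (1 + m) = q * q ^+ m by rewrite add1n exprS.
have Eq2 : q ^+ (2 * m) = (q ^+ m) ^+ 2 by rewrite mulnC exprM.
have Eq3 : q ^+ (1 + 2 * m) = q * (q ^+ m) ^+ 2 by rewrite add1n exprS Eq2.
have wdL k : - m%:Z <= k -> qfrac_wd q (L1 k) k && qfrac_wd q L2 k.
  by move=> /wd [].
have [[nA na nqQa nf nQfa] [pAB pAC pAD pAE pAf]] :=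
  lhs_nonzero geoC q1 q0 a0 b0 c0 d0 e0 f0 sqa wdL.
(* The denominators of the right-hand terms, seen at the shifted parameters. *)
have hA3 y : y \in A3.2 -> qpoch_inf q (y / q ^+ m) != 0.
  move=> yA; apply: (qinf_wd geoC q1 q0) => k /wd [_ /andP [/andP [_ /allP h] _] _].
  exact: h.
have hA4 y : y \in A4.2 -> qpoch_inf q (y / q ^+ m) != 0.
  move=> yA; apply: (qinf_wd geoC q1 q0) => k /wd [_ /andP [_ /andP [_ /allP h]] _].
  exact: h.
have hB4 y : y \in B4.2 -> qpoch_inf q (y / q ^+ m) != 0.
  move=> yA; apply: (qinf_wd geoC q1 q0) => k /wd [_ _ /andP [/andP [_ /allP h] _]].
  exact: h.
have hB5 y : y \in B5.2 -> qpoch_inf q (y / q ^+ m) != 0.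
  move=> yA; apply: (qinf_wd geoC q1 q0) => k /wd [_ _ /andP [_ /andP [_ /allP h]]].
  exact: h.
have [_ wA34 w5] := wd _ (lexx _).
have sa0 : sa != 0 by move: a0; rewrite -sqa expf_eq0.
have psg : qpoch_inf q sg != 0.
  by apply: (qinf_eq_neq0 (hA3 (q ^+ m * sg) _)); [inlist | field].
have psg' : qpoch_inf q (- sg) != 0.
  by apply: (qinf_eq_neq0 (hA3 (- (q ^+ m * sg)) _)); [inlist | field].
have psb : qpoch_inf q (b / sa) != 0.
  by apply: (qinf_eq_neq0 (hB4 (q ^+ m * b / sa) _)); [inlist | field_nonzero].
have psb' : qpoch_inf q (- (b / sa)) != 0.
  by apply: (qinf_eq_neq0 (hB4 (- (q ^+ m * b / sa)) _)); [inlist | field_nonzero].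
have sqb : (b / sa) ^+ 2 = b ^+ 2 / a by rewrite expr_div_n sqa.
(* These are the very-well-poised factors of the two right-hand series. *)
have g1 k := one_sub_sq geoC q1 k sqg psg psg'.
have g2 k := one_sub_sq geoC q1 k sqb psb psb'.
have g10 : 1 - e * f / c != 0 by have := g1 0%N; rewrite expr0 expr1n mulr1.
have g20 : 1 - b ^+ 2 / a != 0 by have := g2 0%N; rewrite expr0 expr1n mulr1.
(* The remaining hypotheses, one parameter list at a time. *)
have hA2 y : y \in A2.2 -> qpoch_inf q y != 0 by move/(allP wA2).
have hB2 y : y \in B2.2 -> qpoch_inf q y != 0 by move/(allP wB2).
have hB3 y : y \in B3.2 -> qpoch_inf q y != 0 by move/(allP wB3).
have hA1 y : y \in A1.2 -> qprod q y m != 0.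
  by case/andP: wA1 => _ /allP h /h /andP [].
have hB1 y : y \in B1.2 -> qprod q y m != 0.
  by case/andP: wB1 => _ /allP h /h /andP [].
case/andP: (wA34) => /andP [/allP w3n _] /andP [/allP w4n _].
case/andP: (w5) => /andP [/allP w5n _] /andP [/allP w6n _].
have hA3n y : y \in A3.1 -> qprod q (y / q ^+ m) m != 0.
  by move/w3n; rewrite qpoch_wdN.
have hA4n y : y \in A4.1 -> qprod q (y / q ^+ m) m != 0.
  by move/w4n; rewrite qpoch_wdN.
have hB4n y : y \in B4.1 -> qprod q (y / q ^+ m) m != 0.
  by move/w5n; rewrite qpoch_wdN.
have hB5n y : y \in B5.1 -> qprod q (y / q ^+ m) m != 0.
  by move/w6n; rewrite qpoch_wdN.
(* The hypotheses of the three-term relation at the shifted parameters. *)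
have A0 : a / (q ^+ m) ^+ 2 != 0 by rewrite mulf_neq0 ?invr_eq0 ?expf_neq0.
have B0 : b / q ^+ m != 0 by rewrite mulf_neq0 ?invr_eq0.
have C0 : c / q ^+ m != 0 by rewrite mulf_neq0 ?invr_eq0.
have D0 : d / q ^+ m != 0 by rewrite mulf_neq0 ?invr_eq0.
have E0 : e / q ^+ m != 0 by rewrite mulf_neq0 ?invr_eq0.
have n1c : 1 - (e / q ^+ m) * f / (c / q ^+ m) != 0.
  by have -> : (e / q ^+ m) * f / (c / q ^+ m) = e * f / c by field_nonzero.
have n2c : 1 - (b / q ^+ m) ^+ 2 / (a / (q ^+ m) ^+ 2) != 0.
  by have -> : (b / q ^+ m) ^+ 2 / (a / (q ^+ m) ^+ 2) = b ^+ 2 / a by field_nonzero.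
have pBEF : qpoch_inf q ((b / q ^+ m) * (e / q ^+ m) * f / (a / (q ^+ m) ^+ 2)) != 0.
  apply: (qinf_eq_neq0 (hA3 (b * e * f * q ^+ m / a) _)); first inlist.
  by rewrite ?Eq1 ?Eq2 ?Eq3; field_nonzero.
have pFC : qpoch_inf q (f * q / (c / q ^+ m)) != 0.
  apply: (qinf_eq_neq0 (hA4 (f * q ^+ (1 + 2 * m) / c) _)); first inlist.
  by rewrite ?Eq1 ?Eq2 ?Eq3; field_nonzero.
have pEC : qpoch_inf q ((e / q ^+ m) * q / (c / q ^+ m)) != 0.
  apply: (qinf_eq_neq0 (hA4 (e * q ^+ (1 + m) / c) _)); first inlist.
  by rewrite ?Eq1 ?Eq2 ?Eq3; field_nonzero.
have pDEF : qpoch_inf q ((d / q ^+ m) * (e / q ^+ m) * f / (a / (q ^+ m) ^+ 2)) != 0.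
  apply: (qinf_eq_neq0 (hA4 (d * e * f * q ^+ m / a) _)); first inlist.
  by rewrite ?Eq1 ?Eq2 ?Eq3; field_nonzero.
have pBA : qpoch_inf q ((b / q ^+ m) * q / (a / (q ^+ m) ^+ 2)) != 0.
  apply: (qinf_eq_neq0 (hB5 (b * q ^+ (1 + 2 * m) / a) _)); first inlist.
  by rewrite ?Eq1 ?Eq2 ?Eq3; field_nonzero.
have pBC : qpoch_inf q ((b / q ^+ m) * q / (c / q ^+ m)) != 0.
  apply: (qinf_eq_neq0 (hB5 (b * q ^+ (1 + m) / c) _)); first inlist.
  by rewrite ?Eq1 ?Eq2 ?Eq3; field_nonzero.
have pBD : qpoch_inf q ((b / q ^+ m) * q / (d / q ^+ m)) != 0.
  apply: (qinf_eq_neq0 (hB5 (b * q ^+ (1 + m) / d) _)); first inlist.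
  by rewrite ?Eq1 ?Eq2 ?Eq3; field_nonzero.
have pBE : qpoch_inf q ((b / q ^+ m) * q / (e / q ^+ m)) != 0.
  apply: (qinf_eq_neq0 (hB5 (b * q ^+ (1 + m) / e) _)); first inlist.
  by rewrite ?Eq1 ?Eq2 ?Eq3; field_nonzero.
have pBf : qpoch_inf q ((b / q ^+ m) * q / f) != 0.
  apply: (qinf_eq_neq0 (hB5 (b * q / f) _)); first inlist.
  by rewrite ?Eq1 ?Eq2 ?Eq3; field_nonzero.
have padef : qpoch_inf q ((a / (q ^+ m) ^+ 2) * q / ((d / q ^+ m) * (e / q ^+ m) * f)) != 0.
  apply: (qinf_eq_neq0 (hA2 (a * q / (d * e * f)) _)); first inlist.
  by rewrite ?Eq1 ?Eq2 ?Eq3; field_nonzero.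
have pqC : qpoch_inf q (q / (c / q ^+ m)) != 0.
  apply: (qinf_eq_neq0 (hA2 (q ^+ (1 + m) / c) _)); first inlist.
  by rewrite ?Eq1 ?Eq2 ?Eq3; field_nonzero.
have pbe : qpoch_inf q ((b / q ^+ m) * (e / q ^+ m) / (a / (q ^+ m) ^+ 2)) != 0.
  apply: (qinf_eq_neq0 (hA2 (b * e / a) _)); first inlist.
  by rewrite ?Eq1 ?Eq2 ?Eq3; field_nonzero.
have pbf : qpoch_inf q ((b / q ^+ m) * f / (a / (q ^+ m) ^+ 2)) != 0.
  apply: (qinf_eq_neq0 (hA2 (b * f * q ^+ m / a) _)); first inlist.
  by rewrite ?Eq1 ?Eq2 ?Eq3; field_nonzero.
have qefc : qprod q (e * f / c) m != 0.
  apply: (qprod_eq_neq0 (hA3n (e * f * q ^+ m / c) _)); first inlist.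
  by rewrite ?Eq1 ?Eq2 ?Eq3; field_nonzero.
have qefqc : qprod q (e * f * q / c) m != 0.
  have := @qprod_mulq_neq0 _ q (e * f / c) m g10 qefc.
  by rewrite !(mulrAC _ c^-1) => /(_ n1).
have qb2 : qprod q (b ^+ 2 / a) m != 0.
  apply: (qprod_eq_neq0 (hB4n (b ^+ 2 * q ^+ m / a) _)); first inlist.
  by rewrite ?Eq1 ?Eq2 ?Eq3; field_nonzero.
have qb2q : qprod q (b ^+ 2 * q / a) m != 0.
  have := @qprod_mulq_neq0 _ q (b ^+ 2 / a) m g20 qb2.
  by rewrite !(mulrAC _ a^-1) => /(_ n2).
have pefc : qpoch_inf q ((e / q ^+ m) * f * q / (c / q ^+ m)) != 0.
  have -> : (e / q ^+ m) * f * q / (c / q ^+ m) = e * f * q / c by field_nonzero.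
  rewrite (qinf_forth geoC q1 m (e * f * q / c)); apply: (mulf_neq0 qefqc).
  apply: (qinf_eq_neq0 (hA2 (e * f * q ^+ (1 + m) / c) _)); first inlist.
  by rewrite Eq1; ring.
have pb2 : qpoch_inf q ((b / q ^+ m) ^+ 2 * q / (a / (q ^+ m) ^+ 2)) != 0.
  have -> : (b / q ^+ m) ^+ 2 * q / (a / (q ^+ m) ^+ 2) = b ^+ 2 * q / a by field_nonzero.
  rewrite (qinf_forth geoC q1 m (b ^+ 2 * q / a)); apply: (mulf_neq0 qb2q).
  apply: (qinf_eq_neq0 (hB3 (b ^+ 2 * q ^+ (1 + m) / a) _)); first inlist.
  by rewrite Eq1; ring.
have zC : `|(b / q ^+ m) * (d / q ^+ m) / (a / (q ^+ m) ^+ 2)| < 1.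
  by have -> : (b / q ^+ m) * (d / q ^+ m) / (a / (q ^+ m) ^+ 2) = b * d / a by field_nonzero.
have zA : `|(a / (q ^+ m) ^+ 2) ^+ 2 * q ^+ 2 /
    ((b / q ^+ m) * (c / q ^+ m) * (d / q ^+ m) * (e / q ^+ m) * f)| < 1.
  have -> : (a / (q ^+ m) ^+ 2) ^+ 2 * q ^+ 2 /
    ((b / q ^+ m) * (c / q ^+ m) * (d / q ^+ m) * (e / q ^+ m) * f) =
    a ^+ 2 * q ^+ 2 / (b * c * d * e * f) by field_nonzero.
  exact: z.
have [cv1 cv2 cv3 key] := bailey_three_term geoC q1 q0 A0 B0 C0 D0 E0 f0 nA n1c n2c
  pAB pAC pAD pAE pAf pBEF pFC pEC pBA pBC pBD pBE pBf pDEF padef pqC pbe pbf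
  pefc pb2 zC zA.
(* The finite products in the denominators of T_1 and T_2. *)
have k1 : qprod q (f / a) m != 0.
  apply: (qprod_eq_neq0 (hA1 (f / a) _)); first inlist.
  by rewrite ?Eq1 ?Eq2 ?Eq3; field_nonzero.
have k2 : qprod q (q / b) m != 0.
  apply: (qprod_eq_neq0 (hA1 (q / b) _)); first inlist.
  by rewrite ?Eq1 ?Eq2 ?Eq3; field_nonzero.
have k3 : qprod q (q / c) m != 0.
  apply: (qprod_eq_neq0 (hA1 (q / c) _)); first inlist.
  by rewrite ?Eq1 ?Eq2 ?Eq3; field_nonzero.
have k4 : qprod q (q / d) m != 0.
  apply: (qprod_eq_neq0 (hA1 (q / d) _)); first inlist.
  by rewrite ?Eq1 ?Eq2 ?Eq3; field_nonzero.
have k5 : qprod q (e / q ^+ m) m != 0.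
  apply: (qprod_eq_neq0 (hA4n (e) _)); first inlist.
  by rewrite ?Eq1 ?Eq2 ?Eq3; field_nonzero.
have k6 : qprod q (d * e * f / a) m != 0.
  apply: (qprod_eq_neq0 (hA1 (d * e * f / a) _)); first inlist.
  by rewrite ?Eq1 ?Eq2 ?Eq3; field_nonzero.
have k7 : qprod q (f * q * q ^+ m / c) m != 0.
  apply: (qprod_eq_neq0 (hA1 (f * q ^+ (1 + m) / c) _)); first inlist.
  by rewrite ?Eq1 ?Eq2 ?Eq3; field_nonzero.
have k8 : qprod q (a * q / (b * c)) m != 0.
  apply: (qprod_eq_neq0 (hA3n (a * q ^+ (1 + m) / (b * c)) _)); first inlist.
  by rewrite ?Eq1 ?Eq2 ?Eq3; field_nonzero.
have k9 : qprod q (a * q / (c * d)) m != 0.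
  apply: (qprod_eq_neq0 (hA4n (a * q ^+ (1 + m) / (c * d)) _)); first inlist.
  by rewrite ?Eq1 ?Eq2 ?Eq3; field_nonzero.
have k10 : qprod q (e * f * q ^+ m / a) m != 0.
  apply: (qprod_eq_neq0 (hA4n (e * f * q ^+ (2 * m) / a) _)); first inlist.
  by rewrite ?Eq1 ?Eq2 ?Eq3; field_nonzero.
have pb : qpoch_inf q (a * q / b / q ^+ m) != 0.
  by apply: (qinf_eq_neq0 pAB); rewrite ?Eq1 ?Eq2 ?Eq3; field_nonzero.
have pc : qpoch_inf q (a * q / c / q ^+ m) != 0.
  by apply: (qinf_eq_neq0 pAC); rewrite ?Eq1 ?Eq2 ?Eq3; field_nonzero.
have pd : qpoch_inf q (a * q / d / q ^+ m) != 0.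
  by apply: (qinf_eq_neq0 pAD); rewrite ?Eq1 ?Eq2 ?Eq3; field_nonzero.
have pe : qpoch_inf q (a * q / e / q ^+ m) != 0.
  by apply: (qinf_eq_neq0 pAE); rewrite ?Eq1 ?Eq2 ?Eq3; field_nonzero.
have paf : qpoch_inf q (a * q / f) != 0.
  apply: (qinf_eq_neq0 (hA2 (a * q / f) _)); first inlist.
  by rewrite ?Eq1 ?Eq2 ?Eq3; field_nonzero.
have pdef : qpoch_inf q (a * q / (d * e * f)) != 0.
  apply: (qinf_eq_neq0 (hA2 (a * q / (d * e * f)) _)); first inlist.
  by rewrite ?Eq1 ?Eq2 ?Eq3; field_nonzero.
have pqcQ : qpoch_inf q (q * q ^+ m / c) != 0.
  apply: (qinf_eq_neq0 (hA2 (q ^+ (1 + m) / c) _)); first inlist.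
  by rewrite ?Eq1 ?Eq2 ?Eq3; field_nonzero.
have pefcQ : qpoch_inf q (e * f * (q * q ^+ m) / c) != 0.
  apply: (qinf_eq_neq0 (hA2 (e * f * q ^+ (1 + m) / c) _)); first inlist.
  by rewrite ?Eq1 ?Eq2 ?Eq3; field_nonzero.
have pbe' : qpoch_inf q (b * e / a) != 0.
  apply: (qinf_eq_neq0 (hA2 (b * e / a) _)); first inlist.
  by rewrite ?Eq1 ?Eq2 ?Eq3; field_nonzero.
have pbf' : qpoch_inf q (b * f * q ^+ m / a) != 0.
  apply: (qinf_eq_neq0 (hA2 (b * f * q ^+ m / a) _)); first inlist.
  by rewrite ?Eq1 ?Eq2 ?Eq3; field_nonzero.
have n1' : 1 - e * f * (q ^+ m) ^+ 2 / c != 0 by have := g1 m; rewrite mulrAC.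
have n2' : 1 - b ^+ 2 * (q ^+ m) ^+ 2 / a != 0 by have := g2 m; rewrite mulrAC.
have E1 := rhs1_coefficient geoC q1 q0 a0 b0 c0 d0 e0 f0 nA na nqQa nf nQfa n1 n1'
  k1 k2 k3 k4 k5 qefc qefqc k6 k7 k8 k9 k10 pd pe paf pdef pqcQ pefcQ pbe' pbf'.
have /andP [_ /andP [/allP wLn _]] := wdL _ (lexx _).
have l1 : qprod q (d / q ^+ m) m != 0 by rewrite -qpoch_wdN; apply: wLn; inlist.
have l2 : qprod q (b / q ^+ m) m != 0.
  apply: (qprod_eq_neq0 (hB5n (b) _)); first inlist.
  by rewrite ?Eq1 ?Eq2 ?Eq3; field_nonzero.
have l3 : qprod q (b * c / a) m != 0.
  apply: (qprod_eq_neq0 (hB5n (b * c * q ^+ m / a) _)); first inlist.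
  by rewrite ?Eq1 ?Eq2 ?Eq3; field_nonzero.
have l4 : qprod q (b * d / a) m != 0.
  apply: (qprod_eq_neq0 (hB5n (b * d * q ^+ m / a) _)); first inlist.
  by rewrite ?Eq1 ?Eq2 ?Eq3; field_nonzero.
have l5 : qprod q (b * e / a) m != 0.
  apply: (qprod_eq_neq0 (hB5n (b * e * q ^+ m / a) _)); first inlist.
  by rewrite ?Eq1 ?Eq2 ?Eq3; field_nonzero.
have l6 : qprod q (b * f * q ^+ m / a) m != 0.
  apply: (qprod_eq_neq0 (hB5n (b * f * q ^+ (2 * m) / a) _)); first inlist.
  by rewrite ?Eq1 ?Eq2 ?Eq3; field_nonzero.
have r1 : qpoch_inf q (b * d * q ^+ m / a) != 0.
  apply: (qinf_eq_neq0 (hB3 (b * d * q ^+ m / a) _)); first inlist.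
  by rewrite ?Eq1 ?Eq2 ?Eq3; field_nonzero.
have r2 : qpoch_inf q (b * e * q ^+ m / a) != 0.
  apply: (qinf_eq_neq0 (hB3 (b * e * q ^+ m / a) _)); first inlist.
  by rewrite ?Eq1 ?Eq2 ?Eq3; field_nonzero.
have r3 : qpoch_inf q (b * f * (q ^+ m) ^+ 2 / a) != 0.
  apply: (qinf_eq_neq0 (hB3 (b * f * q ^+ (2 * m) / a) _)); first inlist.
  by rewrite ?Eq1 ?Eq2 ?Eq3; field_nonzero.
have r4 : qpoch_inf q (d * e * f / a) != 0.
  apply: (qinf_eq_neq0 (hB3 (d * e * f / a) _)); first inlist.
  by rewrite ?Eq1 ?Eq2 ?Eq3; field_nonzero.
have r5 : qpoch_inf q (q / c) != 0.
  apply: (qinf_eq_neq0 (hB3 (q / c) _)); first inlist.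
  by rewrite ?Eq1 ?Eq2 ?Eq3; field_nonzero.
have r6 : qpoch_inf q (b ^+ 2 * (q * q ^+ m) / a) != 0.
  apply: (qinf_eq_neq0 (hB3 (b ^+ 2 * q ^+ (1 + m) / a) _)); first inlist.
  by rewrite ?Eq1 ?Eq2 ?Eq3; field_nonzero.
have E2 := rhs2_coefficient geoC q1 q0 a0 b0 c0 d0 e0 f0 nA na nqQa nf nQfa n2 n2'
  k1 k3 l2 l1 k5 qb2 qb2q l3 l4 l5 l6 pb pc pd pe paf r1 r2 r3 r4 pdef r5 r6.
have bda0 : b * d / a != 0 by rewrite !mulf_neq0 ?invr_eq0.
have t1 := lhs_shift geoC q1 q0 a0 b0 c0 d0 e0 f0 sqa wdL.
have t2 n := rhs1_shift geoC q1 q0 a0 b0 c0 d0 e0 f0 sqg n bda0 wA34 psg psg'.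
have t3 n := rhs2_shift geoC q1 q0 a0 b0 c0 d0 e0 f0 sqa n w5 psb psb'.
have [s1 e1] := @sum_from_shift _ m lhs _ _ t1 cv1.
have [s2 e2] := @sum_from_shift _ m rhs1 _ _ t2 cv2.
have [s3 e3] := @sum_from_shift _ m rhs2 _ _ t3 cv3.
split; first by split.
rewrite /T1 /T2 /A1 /A2 /B1 /B2 /B3 e1 e2 e3.
exact: combine_terms key E1 E2.
Qed.
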